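(* Let $\Theta=\sum_{k=1}^\infty\theta_k\delta_{\psi_k}$ be an exponential CRM on $\Psi$ with no fixed-location atoms and with ordinary component having rate measure $\nu(d\theta)\cdot G(d\psi)$, where $G$ is a diffuse probability distribution on $\Psi$ and $\nu(\mathbb{R}_+)=\infty$. Conditional on $\Theta$, let $X_n=\sum_{k=1}^\infty x_{n,k}\delta_{\psi_k}$ be i.i.d. across $n$, generated according to an exponential CRM with fixed-location atoms at $\{\psi_k\}_{k=1}^\infty$ and no ordinary component, where the weight $x_{n,k}\in\{0,1,2,\dots\}$ at $\psi_k$ has (independently across $n,k$) probability mass function $$h(x\mid\theta_k)=\kappa(x)\exp\{\langle\eta(\theta_k),\phi(x)\rangle-A(\theta_k)\}.$$ Suppose $\sum_{x=1}^\infty\int_{\theta\in\mathbb{R}_+}\nu(d\theta)\,h(x\mid\theta)<\infty$. Let the distribution of $\Theta$ be the conjugate prior for this likelihood, i.e. $$\nu(d\theta)=\gamma\exp\{\langle\xi,\eta(\theta)\rangle+\lambda[-A(\theta)]\}\,d\theta$$ with fixed hyperparameters $\gamma,\xi,\lambda$. Then we can write $$\Theta=\sum_{m=1}^\infty\sum_{x=1}^\infty\sum_{j=1}^{\rho_{m,x}}\theta_{m,x,j}\,\delta_{\psi_{m,x,j}},$$ where - $\psi_{m,x,j}\sim G$, i.i.d. across $m,x,j$; - $M_{m,x}=\gamma\cdot\kappa(0)^{m-1}\kappa(x)\cdot\exp\{B(\xi+(m-1)\phi(0)+\phi(x),\,\lambda+m)\}$; - $\rho_{m,x}\sim\mathrm{Poisson}(M_{m,x})$,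 independently across $m,x$; - $\theta_{m,x,j}$ has density $$f_{size,m,x}(\theta)=\exp\{\langle\xi+(m-1)\phi(0)+\phi(x),\eta(\theta)\rangle+(\lambda+m)[-A(\theta)]-B(\xi+(m-1)\phi(0)+\phi(x),\lambda+m)\},$$ i.i.d. across $j$ and independently across $m,x$; and the families $(\psi_{m,x,j})$, $(\rho_{m,x})$, $(\theta_{m,x,j})$ are mutually independent.
   Context: $\Psi$ is a measurable space whose $\sigma$-algebra contains all singletons; $\mathbb{R}_+$ denotes the non-negative reals (if the parameter $\theta$ of $h$ ranges only over a subset of $\mathbb{R}_+$, all densities and rate measures in $\theta$ are supported on, and all integrals are over, that subset); $d\theta$ is Lebesgue measure. A completely random measure (CRM) on $\Psi$ is a random measure taking independent values on disjoint measurable sets; its ordinary component with rate measure $\nu(d\theta)G(d\psi)$ is $\sum_k\theta_k\delta_{\psi_k}$ where $\{(\theta_k,\psi_k)\}$ are the points of a Poisson point process on $\mathbb{R}_+\times\Psi$ with that rate (mean) measure; a fixed-location component is a sum of atoms with independent random weights at deterministic distinct locations. CRMs here have no deterministic component. Exponential CRM: a CRM whose fixed-location atoms (finitely or infinitely many) have weights with densities of the form $\kappa(\theta)\exp\{\langle\eta(\zeta_k),\phi(\theta)\rangle-A(\zeta_k)\}$, with base density $\kappa$, natural parameter function $\eta$, sufficient statistic $\phi$ and log partition function $A$ shared across atoms and $\zeta_k$ an atom-specific parameter, and whose ordinary component has rate measure $\nu(d\theta)\cdot G(d\psi)$ with $G$ a probability distribution and weight rate measure of the form $\nu(d\theta)=\gamma\exp\{\langle\eta(\zeta),\phi(\theta)\rangle\}d\theta$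 with the same $\eta,\phi$. The prior above is an exponential CRM with sufficient statistic $(\eta',-A)'$ and natural parameter $(\xi',\lambda)'$. $B$ is the corresponding log partition function: $B(\xi,\lambda)=\log\int\exp\{\langle\xi,\eta(\theta)\rangle-\lambda A(\theta)\}\,d\theta$.
   Formalization: It is assumed that κ(x)>0 for some x≥1 (otherwise every X_n is 0, all M_{m,x}=0 and the representation would force Θ=0), and the density f_{size,m,x} is claimed only when B is finite, which is proved whenever κ(x)>0. *)

(* Defs.v *)
From HB Require Import structures.
From mathcomp Require Import all_boot all_order all_algebra.
From mathcomp Require Import all_classical all_reals all_analysis measurable_realfun.

Set Implicit Arguments.
Unset Strict Implicit.
Unset Printing Implicit Defensive.
Import Order.TTheory GRing.Theory Num.Theory.
Import numFieldNormedType.Exports.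
Local Open Scope classical_set_scope.
Local Open Scope ring_scope.
Local Open Scope ereal_scope.

Definition events_of (d d' : measure_display) (Omega : measurableType d)
    (S : measurableType d') (X : Omega -> S) : set (set Omega) :=
  preimage_set_system setT X measurable.

Definition mutually_independent (R : realType) (d : measure_display)
    (Omega : measurableType d) (P : probability Omega R) (I : choiceType)
    (D : set I) (E : I -> set (set Omega)) : Prop :=
  forall (s : seq I) (F : I -> set Omega), uniq s ->
    (forall i, i \in s -> D i /\ E i (F i)) ->
    P (\big[setI/setT]_(i <- s) F i) = \prod_(i <- s) P (F i).

(* The second argument of [poisson_prob] is not used by the library, and
   [poisson_prob r _] is the Dirac mass at 0 when [r = 0], whereas
   [poisson_pmf 0 k = 1] for every [k]. *)
Definition poisson_law (R : realType) (r : R) (n : nat) : \bar R :=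
  poisson_prob r 0%N [set n].

Definition point_count (R : realType) (d d' : measure_display)
    (Omega : measurableType d) (S : measurableType d')
    (p : nat -> Omega -> S) (C : set S) (w : Omega) : \bar R :=
  \sum_(0 <= k <oo) \d_(p k w) C.

(* The process is infinite and enumerated by nat; point_count counts points with
   multiplicity. Applying the independence clause to sequences that are
   eventually empty covers finite families of disjoint sets. *)
Definition poisson_point_process (R : realType) (d d' : measure_display)
    (Omega : measurableType d) (S : measurableType d') (P : probability Omega R)
    (mu : set S -> \bar R) (p : nat -> Omega -> S) : Prop :=
  [/\ forall k, measurable_fun setT (p k),
      forall C, measurable C -> mu C < +oo -> forall n : nat,
        P [set w | point_count R p C w = n%:R%:E] = poisson_law (fine (mu C)) n,
      forall C, measurable C -> mu C = +oo ->
        P [set w | point_count R p C w = +oo] = 1 &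
      forall C : nat -> set S, (forall i, measurable (C i)) -> trivIset setT C ->
        mutually_independent P setT (fun i => events_of (point_count R p (C i)))].

Definition atomic_measure (R : realType) (d d' : measure_display)
    (Omega : measurableType d) (S : measurableType d')
    (wgt : nat -> Omega -> R) (loc : nat -> Omega -> S)
    (w : Omega) (C : set S) : \bar R :=
  \sum_(0 <= k <oo) (wgt k w)%:E * \d_(loc k w) C.

(* Theta is a completely random measure consisting of an ordinary component
   with rate measure nu(dtheta) G(dpsi), the weights theta k lying in T. *)
Definition ordinary_crm (R : realType) (d d' : measure_display)
    (Omega : measurableType d) (Psi : measurableType d') (P : probability Omega R)
    (T : set R) (nu : {measure set (measurableTypeR R) -> \bar R})
    (G : probability Psi R)
    (Theta : Omega -> {measure set Psi -> \bar R})
    (theta : nat -> Omega -> measurableTypeR R) (psi : nat -> Omega -> Psi) : Prop :=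
  [/\ forall k w, T (theta k w),
      poisson_point_process P (nu \x G) (fun k w => (theta k w, psi k w)) &
      forall w C, measurable C -> Theta w C = atomic_measure theta psi w C].

Definition inner (R : realType) (r : nat) (u v : 'rV[R]_r) : R :=
  (\sum_(i < r) u 0 i * v 0 i)%R.

Definition expfam_pmf (R : realType) (r : nat) (kappa : nat -> R)
    (eta : R -> 'rV[R]_r) (phi : nat -> 'rV[R]_r) (A : R -> R)
    (x : nat) (t : R) : R :=
  (kappa x * expR (inner (eta t) (phi x) - A t))%R.

(* Conditionally on the atoms (theta k, psi k) of Theta, the measures X n are
   i.i.d. completely random measures with no ordinary component and with
   fixed-location atoms at the psi k, the weight x n k at psi k having
   probability mass function h _ (theta k). The second clause is the conditional
   law in integrated form: E ranges over the sigma-algebra of the atoms. *)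
Definition fixed_atoms_crm_given (R : realType) (d d' : measure_display)
    (Omega : measurableType d) (Psi : measurableType d') (P : probability Omega R)
    (h : nat -> R -> R)
    (theta : nat -> Omega -> measurableTypeR R) (psi : nat -> Omega -> Psi)
    (X : nat -> Omega -> {measure set Psi -> \bar R})
    (x : nat -> nat -> Omega -> nat) : Prop :=
  [/\ forall n k, measurable_fun setT (x n k),
      forall (s : seq (nat * nat)) (a : nat * nat -> nat) (E : set Omega),
        uniq s ->
        <<s \bigcup_k events_of (fun w => (theta k w, psi k w)) >> E ->
        P (E `&` [set w | forall i, i \in s -> x i.1 i.2 w = a i]) =
          \int[P]_(w in E) (\prod_(i <- s) h (a i) (theta i.2 w))%:E &
      forall n w C, measurable C ->
        X n w C = atomic_measure (fun k w => (x n k w)%:R%R : R) psi w C].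

(* Unnormalised density of the conjugate prior. *)
Definition conj_kernel (R : realType) (r : nat) (eta : R -> 'rV[R]_r) (A : R -> R)
    (xi : 'rV[R]_r) (lambda : R) (t : R) : R :=
  expR (inner xi (eta t) + lambda * (- A t)).

(* The log partition function; it is +oo when the integral diverges. *)
Definition logpart (R : realType) (r : nat) (T : set R) (eta : R -> 'rV[R]_r)
    (A : R -> R) (xi : 'rV[R]_r) (lambda : R) : \bar R :=
  lne (\int[@lebesgue_measure R]_(t in T) (conj_kernel eta A xi lambda t)%:E).

(* In this section m and x are meant to be positive. *)
Section SizeBiased.
Variables (R : realType) (r : nat) (T : set R) (kappa : nat -> R)
  (eta : R -> 'rV[R]_r) (phi : nat -> 'rV[R]_r) (A : R -> R)
  (gamma : R) (xi : 'rV[R]_r) (lambda : R).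

Definition size_xi (m x : nat) : 'rV[R]_r :=
  (xi + phi 0%N *+ m.-1 + phi x)%R.

Definition size_B (m x : nat) : \bar R :=
  logpart T eta A (size_xi m x) (lambda + m%:R).

(* When kappa x = 0 this is 0 even if size_B m x = +oo, as 0 * +oo = 0. *)
Definition size_M (m x : nat) : \bar R :=
  (gamma * (kappa 0%N ^+ m.-1 * kappa x))%:E * expeR (size_B m x).

(* Only meaningful when size_B m x is finite. *)
Definition size_density (m x : nat) (t : R) : R :=
  expR (inner (size_xi m x) (eta t) + (lambda + m%:R) * (- A t)
        - fine (size_B m x)).

End SizeBiased.

(* The three families are put into one, so that independence within each of
   them and between them is a single mutual independence statement. The summands
   index psi_(m,x,j), rho_(m,x) and theta_(m,x,j), with m, x >= 1 and j counted
   from 0. *)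
Definition size_index : Type := (nat * nat * nat + nat * nat + nat * nat * nat)%type.

Definition size_range : set size_index := fun i =>
  match i with
  | inl (inl (m, x, _)) => (0 < m)%N /\ (0 < x)%N
  | inl (inr (m, x)) => (0 < m)%N /\ (0 < x)%N
  | inr (m, x, _) => (0 < m)%N /\ (0 < x)%N
  end.

Definition size_events (R : realType) (d d' : measure_display)
    (Omega : measurableType d) (Psi : measurableType d')
    (psi : nat -> nat -> nat -> Omega -> Psi)
    (rho : nat -> nat -> Omega -> nat)
    (theta : nat -> nat -> nat -> Omega -> measurableTypeR R)
    (i : size_index) : set (set Omega) :=
  match i with
  | inl (inl (m, x, j)) => events_of (psi m x j)
  | inl (inr (m, x)) => events_of (rho m x)
  | inr (m, x, j) => events_of (theta m x j)
  end.

(* Main.v *)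
Require Import Defs.
From HB Require Import structures.
From mathcomp Require Import all_boot all_order all_algebra.
From mathcomp Require Import all_classical all_reals all_analysis measurable_realfun.
From mathcomp Require Import ring lra.
Set Implicit Arguments.
Unset Strict Implicit.
Unset Printing Implicit Defensive.
Import Order.TTheory GRing.Theory Num.Theory.
Import numFieldNormedType.Exports.
Local Open Scope classical_set_scope.
Local Open Scope ring_scope.
Local Open Scope ereal_scope.

(** Why the representation holds. Give every atom (theta_k, psi_k) of Theta the label
(m, x) when m is the first round in which its weight is nonzero and x is that weight.
Given Theta, labels of different atoms are independent, and an atom of weight theta has
label (m, x) with probability h(0 | theta)^(m-1) h(x | theta). Sorting the atoms by
label therefore splits the Poisson process into independent Poisson processes, that of
(m, x) having the rate measure h(0 | theta)^(m-1) h(x | theta) nu(dtheta) G(dpsi). By conjugacy its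
factor in theta is gamma kappa(0)^(m-1) kappa(x) times the kernel of the prior with updated
hyperparameters ([label_weight_kernel]); its mass is M_(m,x), which is finite, and the
normalised kernel has density f_(size,m,x) ([exists_size_law]). A Poisson process of finite
mass M consists of a Poisson(M) number of points that are independent with the normalised
law. Finally h(0 | theta) < 1 implies that almost surely every atom gets a label
([labelled_ae]), so that the classes exhaust Theta.

The splitting is proved from the definition of a Poisson process, which concerns the
independence of the numbers of points in disjoint sets. It gives the limit of the
expectation of the product of a function over the first K points ([laplace_functional]).
Replacing the function g by g + t f and differentiating at t = 0, one factor f after the
other, gives the limit of the expected sum over all placements of finitely many factors at
distinct points, the other points carrying g: it is the product of the means of the factors
times exp(- mu(1 - g)) ([cvg_placements]). With suitable factors, such a placement sum is
the conditional probability, given the points, that the list of each class has a prescribed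
length and its entries lie in prescribed sets ([arrangement_law]). Hence the lengths of the
complete lists are independent Poisson variables, and their entries are independent of the
lengths and of each other ([final_law]); in particular the classes are almost surely finite
([settled_ae]).

Two kinds of extra randomness are needed, which is why the probability space is extended.
The given enumeration of the atoms may be correlated with their positions, so that the
entries of a class are only independent when they are listed in a uniformly random order;
to this end each new point of a class is inserted at a random position of its list
([arrange]). Moreover the values with index j beyond the count are to be defined and
independent of the count; they are fillers with the right law ([class_value]). The product of
countably many probability spaces on which these variables live is obtained by extending
a content from the algebra of cylinders ([countable_product]). The outcome is
[marked_representation], for an arbitrary marked Poisson process; the independence of the
three families is then read off from finite grids of indices ([grid_independence]). *)

(** * Events decided by countably many alternatives *)

Lemma measurable_prop d (W : measurableType d) (Q : Prop) : measurable [set _ : W | Q].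
Proof.
have [q|nq] := pselect Q; [rewrite (_ : mkset _ = setT)//|rewrite (_ : mkset _ = set0)//];
  by apply/seteqP; split.
Qed.

Lemma measurable_forall_in d (W : measurableType d) (I : choiceType) (s : seq I) (A : I -> set W) :
  (forall i, measurable (A i)) -> measurable [set w | forall i, i \in s -> A i w].
Proof.
move=> mA; rewrite (_ : mkset _ = \big[setI/setT]_(i <- s) A i); first exact: bigsetI_measurable.
by rewrite -bigcap_seq; apply/seteqP; split.
Qed.

Lemma measurable_forall_below d (W : measurableType d) N (A : nat -> set W) :
  (forall i, measurable (A i)) -> measurable [set w | forall i, (i < N)%N -> A i w].
Proof.
move=> mA; rewrite (_ : mkset _ = \bigcap_(i in [set i | (i < N)%N]) A i); last by apply/seteqP; split.
by apply: bigcap_measurableType.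
Qed.

(** The event splits along the countably many values of [f]; random indices and
random lists of indices are always eliminated in this way. *)
Lemma measurable_glue d (W : measurableType d) (T : countType) (f : W -> T)
    (A : T -> set W) : (forall t, measurable [set w | f w = t]) ->
  (forall t, measurable (A t)) -> measurable [set w | A (f w) w].
Proof.
move=> mf mA.
rewrite (_ : mkset _ = \bigcup_n (if unpickle n is Some t then
    [set w | f w = t] `&` A t else set0)).
  apply: bigcup_measurable => n _; case: unpickle => // t; exact: measurableI.
apply/seteqP; split => w /=.
  by move=> Aw; exists (pickle (f w)) => //; rewrite pickleK.
by move=> [n _]; case: unpickle => // t [/= -> ].
Qed.

Lemma measurable_listed d d' (W : measurableType d) (S : measurableType d') (p : nat -> W -> S)
    (l : W -> seq nat) (C : seq (set S)) : (forall k, measurable_fun setT (p k)) ->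
  (forall v, measurable [set w | l w = v]) -> (forall j, measurable (nth set0 C j)) ->
  measurable [set w | size (l w) = size C /\
    forall j, (j < size C)%N -> nth set0 C j (p (nth 0%N (l w) j) w)].
Proof.
move=> mp ml mC.
pose A v := [set _ : W | size v = size C] `&`
  [set w | forall j, (j < size C)%N -> nth set0 C j (p (nth 0%N v j) w)].
apply: (@measurable_glue _ _ (seq nat) l A) => // v; apply: measurableI.
  exact: measurable_prop.
apply: (@measurable_forall_below _ _ _ (fun j => p (nth 0%N v j) @^-1` nth set0 C j)) => j.
by rewrite -[X in measurable X]setTI; exact: mp.
Qed.

Lemma nth_index_fst (T : eqType) (U : eqType) (u0 : U) (s : seq (T * U)) y :
  uniq (map fst s) -> y \in s -> nth u0 (map snd s) (index y.1 (map fst s)) = y.2.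
Proof.
move=> us ys; have iy : (index y s < size s)%N by rewrite index_mem.
have -> : index y.1 (map fst s) = index y s.
  by rewrite -[in LHS](nth_index y ys) -(nth_map y y.1 fst)// index_uniq ?size_map.
by rewrite (nth_map y)// nth_index.
Qed.

(** * Countable products of probability measures *)

Section Cylinders.
Context (d : measure_display) (S : measurableType d).

Definition coordinate_sets : set (set (nat -> S)) :=
  \bigcup_n preimage_set_system setT (fun w : nat -> S => w n) measurable.

Notation coordT := (g_sigma_algebraType coordinate_sets).

Lemma measurable_coordinate n : measurable_fun setT (fun w : coordT => w n).
Proof.
by move=> _ B mB; rewrite setTI; apply: sub_sigma_algebra; exists n => //; exists B;
  rewrite ?setTI.
Qed.

Lemma measurable_to_coord d' (T : measurableType d') (f : T -> coordT) :
  (forall n, measurable_fun setT (fun t => f t n)) -> measurable_fun setT f.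
Proof.
move=> mf; apply: (@measurability _ _ _ coordT setT f coordinate_sets) => //.
by move=> _ [_ [n _ [B mB <-]] <-]; rewrite !setTI; have := mf n measurableT B mB; rewrite setTI.
Qed.

Definition depends_below (N : nat) (A : set (nat -> S)) :=
  forall w w', (forall i, (i < N)%N -> w i = w' i) -> A w -> A w'.

(** Measurability is required besides dependence on finitely many coordinates:
a set of sequences that looks at one coordinate only may fail to be measurable. *)
Definition cylinder : set (set (nat -> S)) :=
  [set A | (measurable : set (set coordT)) A /\ exists N, depends_below N A].

Lemma depends_below_le N M A : (N <= M)%N -> depends_below N A -> depends_below M A.
Proof. by move=> NM hA w w' h; apply: hA => i iN; apply: h; exact: leq_trans NM. Qed.

Lemma cylinder0 : cylinder set0.
Proof. by split; [exact: measurable0 | exists 0%N]. Qed.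

Lemma cylinderU : setU_closed cylinder.
Proof.
move=> A B [mA [N hA]] [mB [M hB]]; split; first exact: (@measurableU _ coordT).
exists (maxn N M) => w w' h [Aw|Bw].
- by left; exact: depends_below_le (leq_maxl _ _) hA _ _ h Aw.
- by right; exact: depends_below_le (leq_maxr _ _) hB _ _ h Bw.
Qed.

Lemma cylinderC : setC_closed cylinder.
Proof.
move=> A [mA [N hA]]; split; first exact: (@measurableC _ coordT).
by exists N => w w' h nAw Aw'; apply: nAw; apply: hA Aw' => i iN; rewrite h.
Qed.

Lemma cylinder_box N (B : nat -> set S) : (forall i, measurable (B i)) ->
  cylinder [set v | forall i, (i < N)%N -> B i (v i)].
Proof.
move=> mB; split; last by exists N => w w' h Bw i iN; rewrite -h//; exact: Bw.
apply: (@measurable_forall_below _ coordT _ (fun i => (fun w : coordT => w i) @^-1` B i)) => i.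
by rewrite -[X in measurable X]setTI; exact: measurable_coordinate.
Qed.

(** A copy of the space of sequences that carries only the algebra of cylinders,
so that a content on it can be extended to the sigma-algebra it generates. *)
Definition seq_space : Type := nat -> S.
HB.instance Definition _ := Pointed.on seq_space.

Definition cylinder_display : measure_display.
Proof. exact: default_measure_display. Qed.

HB.instance Definition _ := @isAlgebraOfSets.Build cylinder_display seq_space
  cylinder cylinder0 cylinderU cylinderC.

End Cylinders.

Section InfiniteProduct.
Context (d : measure_display) (S : measurableType d) (R : realType).
Variable mu : nat -> probability S R.

Local Notation coordT := (g_sigma_algebraType (@coordinate_sets _ S)).

Definition update (w : nat -> S) (n : nat) (s : S) : nat -> S :=
  fun i => if i == n then s else w i.

(** Integrates out the coordinates [n], ..., [n + N - 1] of [w], one after the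
other. If [A] is decided by the coordinates below [n + N], this is the conditional
probability of [A] given the coordinates of [w] below [n]. *)
Fixpoint resample (N n : nat) (w : nat -> S) (A : set (nat -> S)) : \bar R :=
  if N is N'.+1 then \int[mu n]_s resample N' n.+1 (update w n s) A
  else (\1_A w)%:E.

Lemma resample_ge0 N n w A : 0 <= resample N n w A.
Proof.
elim: N n w => [|N IH] n w /=; first by rewrite lee_fin.
by apply: integral_ge0.
Qed.

Lemma measurable_update n : measurable_fun setT
  (fun p : coordT * S => update p.1 n p.2 : coordT).
Proof.
apply: measurable_to_coord => i; rewrite /update; case: eqP => _.
  exact: measurable_snd.
exact: (measurableT_comp (measurable_coordinate i) measurable_fst).
Qed.

Lemma measurable_resample N n (A : set coordT) : measurable A ->
  measurable_fun setT (fun w : coordT => resample N n w A).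
Proof.
move=> mA; elim: N n => [|N IH] n /=.
  by apply/measurable_EFinP; exact: measurable_indic.
apply: (@measurable_fun_fubini_tonelli_F _ _ _ _ _ (mu n)
   (fun p : coordT * S => resample N n.+1 (update p.1 n p.2) A)).
  exact: (measurableT_comp (IH n.+1) (measurable_update n)).
by move=> p; exact: resample_ge0.
Qed.

Lemma measurable_resample_update N n w (A : set coordT) : measurable A ->
  measurable_fun setT (fun s => resample N n.+1 (update w n s) A).
Proof.
move=> mA; apply: (measurableT_comp (measurable_resample N n.+1 mA)).
apply: measurable_to_coord => i; rewrite /update; case: eqP => _ //.
Qed.

Lemma resampleU N n w (A B : set coordT) : measurable A -> measurable B ->
  [disjoint A & B] -> resample N n w (A `|` B) = resample N n w A + resample N n w B.
Proof.
move=> mA mB AB; elim: N n w => [|N IH] n w /=.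
  rewrite -EFinD -natrD; congr (_%:R%:E); rewrite in_setU.
  have [wA|wA] := boolP (w \in A); have [wB|wB] := boolP (w \in B) => //=.
  by move/disj_setPS: AB => /(_ w) []; split; exact: set_mem.
rewrite -ge0_integralD//.
- by apply: eq_integral => s _; rewrite IH.
- by move=> *; exact: resample_ge0.
- exact: measurable_resample_update.
- by move=> *; exact: resample_ge0.
- exact: measurable_resample_update.
Qed.

Lemma resampleT N n w : resample N n w setT = 1.
Proof.
elim: N n w => [|N IH] n w /=; first by rewrite indicT.
under eq_integral do rewrite IH.
by rewrite integral_cst//= probability_setT mule1.
Qed.

Lemma le_resample N n w (A B : set coordT) : measurable A -> measurable B ->
  A `<=` B -> resample N n w A <= resample N n w B.
Proof.
move=> mA mB AB; rewrite -(setDUK AB) resampleU//.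
- by rewrite leeDl// resample_ge0.
- exact: measurableD.
- by apply/disj_setPS => x [Ax []].
Qed.

Lemma update_agree N n w s A : depends_below N A -> (N <= n)%N ->
  \1_A (update w n s) = \1_A w :> R.
Proof.
move=> hA Nn; rewrite !indicE; congr (_%:R); congr nat_of_bool.
have h i : (i < N)%N -> update w n s i = w i.
  by move=> iN; rewrite /update ltn_eqF// (leq_trans iN).
by apply/idP/idP => /set_mem Aw; apply/mem_set; apply: hA Aw => i /h.
Qed.

Lemma resampleS N n w A : depends_below (n + N) A ->
  resample N.+1 n w A = resample N n w A.
Proof.
elim: N n w => [|N IH] n w hA.
  rewrite /=; under eq_integral.
    move=> s _; rewrite (update_agree w s hA) ?addn0//; over.
  by rewrite integral_cst//= probability_setT mule1.
rewrite [LHS]/= [RHS]/=; apply: eq_integral => s _.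
by have /= := IH n.+1 (update w n s); rewrite addSnnS => /(_ hA).
Qed.

Lemma resample_large N M n w A : depends_below (n + N) A -> (N <= M)%N ->
  resample M n w A = resample N n w A.
Proof.
move=> hA; elim: M => [|M IH]; first by rewrite leqn0 => /eqP ->.
rewrite leq_eqVlt => /predU1P[->//|]; rewrite ltnS => NM.
rewrite resampleS ?IH//; apply: depends_below_le hA.
by rewrite leq_add2l.
Qed.

Section Continuity.
Variables (A : (set (nat -> S))^nat) (N : nat -> nat).
Hypothesis mA : forall k, (measurable : set (set coordT)) (A k).
Hypothesis dA : forall k, depends_below (N k) (A k).
Hypothesis niA : forall k, A k.+1 `<=` A k.

Let tail n w k := resample (N k - n) n w (A k).

Let tailE M n w k : (N k <= M)%N -> tail n w k = resample (M - n) n w (A k).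
Proof.
move=> NM; rewrite /tail (@resample_large (N k - n) (M - n))//.
  by move: (@dA k); apply: depends_below_le; rewrite -leq_subLR.
by rewrite leq_sub2r.
Qed.

Let tail_ge0 n w k : 0 <= tail n w k. Proof. exact: resample_ge0. Qed.

Let tail_noninc n w : nonincreasing_seq (tail n w).
Proof.
apply/nonincreasing_seqP => k; pose M := maxn (N k) (N k.+1).
rewrite (@tailE M) ?leq_maxr// (@tailE M n w k) ?leq_maxl//.
exact: le_resample.
Qed.

Let tail_le1 n w k : tail n w k <= 1.
Proof. by rewrite -(resampleT (N k - n) n w); apply: le_resample. Qed.

Let tailS n w k : tail n w k = \int[mu n]_s tail n.+1 (update w n s) k.
Proof.
rewrite (@tailE (maxn (N k) n.+1)) ?leq_maxl//.
under eq_integral do rewrite (@tailE (maxn (N k) n.+1)) ?leq_maxl//.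
by rewrite subnS; case: (_ - n)%N (subn_gt0 n (maxn (N k) n.+1)) => // ;
  rewrite leq_maxr.
Qed.

Let tail_lim n w := limn (tail n w).

Let tail_cvg n w : tail n w @ \oo --> tail_lim n w.
Proof. exact: (ereal_nonincreasing_is_cvgn (@tail_noninc n w)). Qed.

Let tail_limS n w : tail_lim n w = \int[mu n]_s tail_lim n.+1 (update w n s).
Proof.
apply/cvg_lim => //; rewrite (_ : tail n w = fun k =>
  \int[mu n]_s tail n.+1 (update w n s) k); last by apply/funext => k; exact: tailS.
apply: (@dominated_cvg _ _ _ (mu n) setT measurableT
   (fun k s => tail n.+1 (update w n s) k) _ (cst 1)) => //=.
- by move=> k; exact: measurable_resample_update.
- exact: finite_measure_integrable_cst.
- by move=> k s _; rewrite gee0_abs.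
Qed.

Let tail_lim_ge0 n w : 0 <= tail_lim n w.
Proof. by apply: lime_ge => //; exact: nearW. Qed.

Let tail_lim_step n w : 0 < tail_lim n w ->
  exists s, 0 < tail_lim n.+1 (update w n s).
Proof.
rewrite tail_limS => h; apply: contrapT => /forallNP no.
move: h; rewrite integral0_eq ?ltxx// => s _.
by apply/eqP; rewrite eq_le tail_lim_ge0 andbT leNgt; apply/negP/no.
Qed.

(** The coordinates of [w] are chosen one by one: the limit in [k] of the
conditional probability of [A k] given the coordinates chosen so far is an
integral over the next coordinate, so that some value of it keeps the limit
positive. As [A k] only looks at finitely many coordinates, its conditional
probability eventually is 0 or 1, hence 1. *)
Lemma cylinder_continuity w0 :
  (exists2 e : R, (0 < e)%R & forall k, e%:E <= resample (N k) 0 w0 (A k)) ->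
  exists w, forall k, A k w.
Proof.
move=> [e e0 he].
have L0 : 0 < tail_lim 0 w0.
  apply: lt_le_trans (_ : e%:E <= _); first by rewrite lte_fin.
  by apply: lime_ge => //; apply: nearW => k; rewrite /tail subn0.
pose pick n w := xget point [set s | 0 < tail_lim n.+1 (update w n s)].
pose fix walk n := if n is n'.+1 then update (walk n') n' (pick n' (walk n')) else w0.
have L n : 0 < tail_lim n (walk n).
  elim: n => //= n /tail_lim_step[s hs]; rewrite /pick.
  exact: (@xgetI _ point [set s | 0 < tail_lim n.+1 (update (walk n) n s)] s hs).
have walkE m n : (m < n)%N -> walk n m = walk m.+1 m.
  elim: n => // n IH; rewrite ltnS leq_eqVlt => /predU1P[<-//|mn].
  by rewrite [LHS]/= {1}/update ltn_eqF// IH.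
exists (fun n => walk n.+1 n) => k.
apply: (dA (w := walk (N k))); first by move=> i /walkE ->.
have : 0 < tail (N k) (walk (N k)) k.
  apply: lt_le_trans (L (N k)) _.
  apply: lime_le; first exact: ereal_nonincreasing_is_cvgn.
  by exists k => // m /= km; exact: tail_noninc.
rewrite /tail subnn /= lte_fin indicE.
by have [/set_mem|] := boolP (walk (N k) \in A k); rewrite ?ltxx.
Qed.

End Continuity.

(** Any sufficiently large number of coordinates gives the same value, by
[resample_large]; [xget] picks one. *)
Definition product_content (A : set (seq_space S)) : \bar R :=
  resample (xget 0%N [set N | depends_below N A]) 0 point A.

Lemma product_contentE N A : depends_below N A ->
  product_content A = resample N 0 point A.
Proof.
move=> hA; rewrite /product_content.
have := @xgetI _ 0%N [set N | depends_below N A] N hA.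
set M := xget _ _ => /= hM; have [MN|/ltnW NM] := leqP M N.
  by rewrite (@resample_large M N).
by rewrite (@resample_large N M).
Qed.

Let product_content0 : product_content set0 = 0.
Proof. by rewrite (@product_contentE 0)//= indic0. Qed.

Let product_content_ge0 A : 0 <= product_content A.
Proof. exact: resample_ge0. Qed.

Let product_contentT : product_content setT = 1.
Proof. by rewrite (@product_contentE 0)//= indicT. Qed.

Let product_contentU (A B : set (seq_space S)) : measurable A -> measurable B ->
  [disjoint A & B] ->
  product_content (A `|` B) = product_content A + product_content B.
Proof.
move=> [mA [N hA]] [mB [M hB]] AB.
have hA' := depends_below_le (leq_maxl N M) hA.
have hB' := depends_below_le (leq_maxr N M) hB.
have hAB : depends_below (maxn N M) (A `|` B).
  by move=> w w' h [Aw|Bw]; [left; exact: hA' h Aw|right; exact: hB' h Bw].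
by rewrite (product_contentE hA') (product_contentE hB') (product_contentE hAB) resampleU.
Qed.

Let product_content_fin A : measurable A -> product_content A \is a fin_num.
Proof.
move=> mA; rewrite ge0_fin_numE//; apply: (@le_lt_trans _ _ 1); last exact: ltry.
rewrite -product_contentT -(setUv A) product_contentU ?leeDl//; first exact: measurableC.
by apply/disj_setPS; rewrite setICr.
Qed.

Let product_content_sum (F : (set (seq_space S))^nat) n :
  (forall i, measurable (F i)) -> trivIset setT F ->
  product_content (\big[setU/set0]_(i < n) F i) =
    \sum_(i < n) product_content (F i).
Proof.
move=> mF tF; elim: n => [|n IH]; first by rewrite !big_ord0.
rewrite !big_ord_recr /= product_contentU ?IH//.
- exact: bigsetU_measurable.
- apply/disj_setPS => x; rewrite -bigcup_mkord => -[[i /= iltn Fi] Fn].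
  by have E := tF i n I I (ex_intro _ x (conj Fi Fn)); rewrite E ltnn in iltn.
Qed.

(** Continuity at the empty set, which is what makes a content on an algebra
sigma-additive: a decreasing sequence of cylinders whose contents stay away from 0
has a common point. *)
Let product_content_cvg0 (D : (set (seq_space S))^nat) :
  (forall k, measurable (D k)) -> (forall k, D k.+1 `<=` D k) ->
  \bigcap_k D k = set0 -> product_content \o D @ \oo --> 0.
Proof.
move=> mD niD D0.
have [N hN] : {N : nat -> nat & forall k, depends_below (N k) (D k)}.
  by apply: (@choice _ _ (fun k n => depends_below n (D k))) => k; have [_] := mD k.
have mD' k : (measurable : set (set coordT)) (D k) by have [] := mD k.
have ni : nonincreasing_seq (product_content \o D).
  apply/nonincreasing_seqP => k /=.
  rewrite -(setDUK (niD k)) product_contentU ?leeDl//.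
  - exact: measurableD.
  - by apply/disj_setPS => x [Ax []].
have cv := ereal_nonincreasing_is_cvgn ni.
suff -> : 0 = limn (product_content \o D) by [].
apply/esym/eqP; rewrite eq_le; apply/andP; split; last first.
  by apply: lime_ge => //; apply: nearW => k; exact: product_content_ge0.
rewrite leNgt; apply/negP => l0.
have lle k : limn (product_content \o D) <= product_content (D k).
  by apply: lime_le => //; exists k => // m /= km; exact: ni.
have lfin : limn (product_content \o D) \is a fin_num.
  rewrite ge0_fin_numE ?ltW// (le_lt_trans (lle 0%N))//.
  by rewrite -ge0_fin_numE// product_content_fin.
have [w hw] : exists w, forall k, D k w.
  apply: (cylinder_continuity mD' hN niD (w0 := point)).
  exists (fine (limn (product_content \o D))); first by rewrite fine_gt0// l0 ltey_eq lfin.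
  by move=> k; rewrite fineK// -(product_contentE (hN k)).
by have : (\bigcap_k D k) w by []; rewrite D0.
Qed.

Let product_content_sigma_additive : semi_sigma_additive product_content.
Proof.
move=> F mF tF mUF; set U := \bigcup_n F n in mUF *.
pose D n := U `\` \big[setU/set0]_(i < n) F i.
have mD n : measurable (D n).
  by apply: measurableD => //; exact: bigsetU_measurable.
have DE : (fun n => \sum_(0 <= i < n) product_content (F i)) =
    (fun n => product_content U - product_content (D n)).
  apply/funext => n; rewrite big_mkord -product_content_sum//.
  have sub : \big[setU/set0]_(i < n) F i `<=` U.
    by rewrite -bigcup_mkord => x [i _ Fi]; exists i.
  rewrite -[in RHS](setDUK sub) product_contentU//.
  - by rewrite -/(D n) addeK// product_content_fin.
  - exact: bigsetU_measurable.
  - exact: mD.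
  - by apply/disj_setPS => x [Ax []].
rewrite DE -[X in _ --> X]sube0; apply: cvgeB.
- by rewrite fin_num_adde_defl.
- exact: cvg_cst.
apply: product_content_cvg0 => //.
- move=> k x [Ux nx]; split => //; apply: contra_not nx => h.
  by rewrite big_ord_recr; left.
- rewrite -subset0 => x hx; have [[n _ Fn] _] := hx 0%N I.
  by have [_ []] := hx n.+1 I; rewrite -bigcup_mkord; exists n => //=.
Qed.

HB.instance Definition _ := isMeasure.Build _ _ _ product_content
  product_content0 product_content_ge0 product_content_sigma_additive.

Let resample_box N (B : nat -> set S) n w : (forall i, measurable (B i)) ->
  resample N n w [set v | forall i, (n <= i < n + N)%N -> B i (v i)] =
  \prod_(n <= i < n + N) mu i (B i).
Proof.
move=> mB.
(* The first [m - n] constraints bear on coordinates that are already fixed. *)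
have gen M m v : (m <= n + N)%N -> (m + M = n + N)%N -> (n <= m)%N ->
    resample M m v [set v | forall i, (n <= i < n + N)%N -> B i (v i)] =
    (\1_[set v | forall i, (n <= i < m)%N -> B i (v i)] v)%:E *
    \prod_(m <= i < n + N) mu i (B i).
  elim: M m v => [|M IH] m v mN mM nm.
    by move: mM; rewrite addn0 => <-; rewrite big_geq// mule1.
  have mltN : (m < n + N)%N by rewrite -mM addnS ltnS leq_addr.
  rewrite /= big_ltn//.
  under eq_integral => s _.
    rewrite IH ?addSnnS// ?leqW//.
    rewrite (_ : \1__ _ = \1_[set v | forall i, (n <= i < m)%N -> B i (v i)] v * \1_(B m) s)%R; last first.
      rewrite !indicE -natrM mulnb; congr (_%:R); congr nat_of_bool.
      apply/idP/andP => [/set_mem /= h|[/set_mem /= h1 /set_mem h2]].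
        split; apply/mem_set.
          move=> i /andP[ni im]; have := h i; rewrite ni ltnS (ltnW im) => /(_ isT).
          by rewrite /update ltn_eqF.
        by have := h m; rewrite nm ltnSn => /(_ isT); rewrite /update eqxx.
      apply/mem_set => i /andP[ni]; rewrite ltnS leq_eqVlt => /predU1P[->|im].
        by rewrite /update eqxx.
      by rewrite /update ltn_eqF//; apply: h1; rewrite ni.
    rewrite EFinM -muleA (muleC _ (\prod_(_ <= _ < _) _)) muleA.
    over.
  rewrite /= ge0_integralZl//.
  - by rewrite integral_indic// setIT -muleA (muleC (mu m (B m))).
  - by apply/measurable_EFinP; exact: measurable_indic.
  - by apply: mule_ge0; [rewrite lee_fin|exact: prode_ge0].
rewrite (gen N n w)// ?leq_addr// (_ : \1__ _ = 1%R) ?mul1e// indicE mem_set//= => i.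
by case: ltngtP.
Qed.

Local Notation prodT := (g_sigma_algebraType (@measurable _ (seq_space S))).

Definition product_measure_seq : set prodT -> \bar R :=
  measure_extension product_content.

HB.instance Definition _ := Measure.on product_measure_seq.

Lemma product_measure_seqE (A : set (seq_space S)) : measurable A ->
  product_measure_seq A = product_content A.
Proof. exact: measurable_mu_extE. Qed.

Let product_measure_seqT : product_measure_seq setT = 1.
Proof. by rewrite product_measure_seqE//; exact: measurableT. Qed.

HB.instance Definition _ := Measure_isProbability.Build _ _ _
  product_measure_seq product_measure_seqT.

Lemma product_measure_box N (B : nat -> set S) : (forall i, measurable (B i)) ->
  product_measure_seq [set v | forall i, (i < N)%N -> B i (v i)] =
  \prod_(i < N) mu i (B i).
Proof.
move=> mB; rewrite product_measure_seqE; last exact: cylinder_box.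
rewrite (@product_contentE N); last by move=> w w' h Bw i iN; rewrite -h//; exact: Bw.
rewrite -(big_mkord xpredT (fun i => mu i (B i))).
exact: (@resample_box N B 0%N point mB).
Qed.

End InfiniteProduct.

Theorem infinite_product (d : measure_display) (S : measurableType d) (R : realType)
    (mu : nat -> probability S R) :
  exists (d' : measure_display) (Q : measurableType d') (PQ : probability Q R)
    (Z : nat -> Q -> S),
    (forall n, measurable_fun setT (Z n)) /\
    forall N (B : nat -> set S), (forall i, measurable (B i)) ->
      PQ [set w | forall i, (i < N)%N -> B i (Z i w)] = \prod_(i < N) mu i (B i).
Proof.
exists _, (g_sigma_algebraType (@measurable _ (seq_space S))),
  (product_measure_seq mu : probability _ _), (fun n w => w n); split; last first.
  exact: product_measure_box.
move=> n _ B mB; rewrite setTI; apply: sub_sigma_algebra.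
have := @cylinder_box _ S n.+1 (fun i => if i == n then B else setT).
rewrite (_ : mkset _ = [set w | B (w n)]).
  by apply => i; case: eqP => // _; exact: measurableT.
apply/seteqP; split => w /= h; first by have := h n; rewrite eqxx; exact.
by move=> i _; case: eqP => [->|].
Qed.

(** The index set is embedded in [nat] by [pickle]; numbers outside the image get
a Dirac law, on which no constraint is put. *)
Corollary countable_product (d : measure_display) (S : measurableType d) (R : realType)
    (I : countType) (mu : I -> probability S R) :
  exists (d' : measure_display) (Q : measurableType d') (PQ : probability Q R)
    (Z : I -> Q -> S),
    (forall i, measurable_fun setT (Z i)) /\
    forall (s : seq I) (B : I -> set S), uniq s -> (forall i, measurable (B i)) ->
      PQ [set w | forall i, i \in s -> B i (Z i w)] = \prod_(i <- s) mu i (B i).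
Proof.
pose nu n : probability S R := if pickle_inv n is Some i then mu i else dirac point.
have [d' [Q [PQ [Z [mZ hZ]]]]] := infinite_product nu.
exists d', Q, PQ, (fun i => Z (pickle i)); split => [i|s B us mB]; first exact: mZ.
pose N := (\max_(i <- s) pickle i).+1.
pose C n : set S := if pickle_inv n is Some i then (if i \in s then B i else setT) else setT.
have mC n : measurable (C n).
  by rewrite /C; case: pickle_inv => // i; case: ifP => _; [exact: mB|exact: measurableT].
have sN i : i \in s -> (pickle i < N)%N.
  by move=> i_s; rewrite ltnS; exact: (@leq_bigmax_seq _ s xpredT pickle i).
transitivity (PQ [set w | forall n, (n < N)%N -> C n (Z n w)]).
  congr (PQ _); apply/seteqP; split => w /= h.
    move=> n nN; rewrite /C; case E : (pickle_inv n) => [i|//].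
    case: ifPn => // i_s; have := h i i_s; suff -> : pickle i = n by [].
    by have := @pickle_invK I n; rewrite E.
  by move=> i i_s; have := h _ (sN i i_s); rewrite /C pickleK_inv i_s.
rewrite hZ// -(big_mkord xpredT (fun n => nu n (C n))).
rewrite (bigID (mem (map pickle s))) /= [X in _ * X]big1 ?mule1; last first.
  move=> n; rewrite /C /nu; case E : (pickle_inv n) => [i|] ns.
    rewrite ifN ?probability_setT//; apply: contra ns => i_s.
    by have := @pickle_invK I n; rewrite E /= => <-; exact: map_f.
  exact: diracT.
have sE : perm_eq [seq n <- index_iota 0 N | n \in map pickle s] (map pickle s).
  apply: uniq_perm.
  - by rewrite filter_uniq// iota_uniq.
  - by rewrite map_inj_uniq//; exact: (pcan_inj pickleK_inv).
  - move=> n; rewrite mem_filter mem_index_iota; apply: andb_idr => /mapP[i i_s ->].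
    exact: sN.
rewrite -big_filter (perm_big _ sE) big_map; apply: eq_big_seq => i i_s.
by rewrite /nu /C pickleK_inv i_s.
Qed.

(** * The Laplace functional of a Poisson point process *)

Lemma nneseries_single (R : realType) (f : nat -> \bar R) n :
  (forall i, i != n -> f i = 0) -> 0 <= f n -> \sum_(0 <= i <oo) f i = f n.
Proof.
move=> f0 fn.
have f_ge0 i : true -> 0 <= f i by have [->|/f0 ->] := eqVneq i n.
by rewrite (nneseriesD1 f_ge0 (n := n))// eseries0 ?adde0// => i _ /andP[_ /f0].
Qed.

Lemma ae_of_probability1 (R : realType) (d : measure_display) (T : measurableType d)
    (P : probability T R) (A : set T) : measurable A -> P A = 1 ->
  {ae P, forall w, A w}.
Proof.
move=> mA PA; exists (~` A); split => //; first exact: measurableC.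
by rewrite probability_setC// PA subee.
Qed.

Section IndependentCounts.
Context (R : realType) (d : measure_display) (Omega : measurableType d)
  (P : probability Omega R).
Variable X : nat -> Omega -> \bar R.
Hypothesis mX : forall i, measurable_fun setT (X i).
Hypothesis indX : mutually_independent P setT (fun i => events_of (X i)).
Variable phi : nat -> nat -> R.
Hypothesis phi_ge0 : forall i m, (0 <= phi i m)%R.
Hypothesis phi_le1 : forall i m, (phi i m <= 1)%R.

(** This is [phi i] at the value of [X i], extended by 0 to values that are not
natural numbers. *)
Definition at_count (i : nat) (w : Omega) : R :=
  if pselect (exists m : nat, X i w = m%:R%:E) is left ex then
    phi i (projT1 (cid ex)) else 0%R.

Lemma at_countE i w (m : nat) : X i w = m%:R%:E -> at_count i w = phi i m.
Proof.
move=> Xm; rewrite /at_count; case: pselect => [ex|[]]; last by exists m.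
case: cid => m' /=; rewrite Xm => -[] /eqP; rewrite eqr_nat => /eqP <-.
by [].
Qed.

Lemma at_count_ge0 i w : (0 <= at_count i w)%R.
Proof. by rewrite /at_count; case: pselect. Qed.

Lemma at_count_le1 i w : (at_count i w <= 1)%R.
Proof. by rewrite /at_count; case: pselect. Qed.

Let fixed (k n : nat) (a : nat -> nat) : set Omega :=
  [set w | forall i, (k <= i < n)%N -> X i w = (a i)%:R%:E].

Let measurable_value i (m : nat) : measurable [set w | X i w = m%:R%:E].
Proof.
rewrite -[X in measurable X]setTI.
by have := mX i measurableT (emeasurable_set1 m%:R%:E).
Qed.

Let fixedE k n a : fixed k n a =
  \big[setI/setT]_(i <- index_iota k n) [set w | X i w = (a i)%:R%:E].
Proof.
rewrite -bigcap_seq; apply/seteqP; split => w /= h i.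
  by move=> /= ik; apply: h; rewrite -mem_index_iota.
by move=> ik; apply: h; rewrite /= mem_index_iota.
Qed.

Let mfixed k n a : measurable (fixed k n a).
Proof. by rewrite fixedE; apply: bigsetI_measurable => i _; exact: measurable_value. Qed.

Lemma measurable_at_count i : measurable_fun setT (at_count i).
Proof.
apply/measurable_EFinP.
rewrite (_ : EFin \o _ = fun w =>
    \sum_(0 <= m <oo) (phi i m)%:E * (\1_[set w | X i w = m%:R%:E] w)%:E).
  apply: ge0_emeasurable_sum => [m w _ _|m _].
    by rewrite mule_ge0 ?lee_fin.
  apply/measurable_EFinP; apply: measurable_funM => //.
apply/funext => w /=; have [[m Xm]|nX] := pselect (exists m : nat, X i w = m%:R%:E).
  rewrite (at_countE Xm) (@nneseries_single _ _ m).
  - by rewrite indicE mem_set//= mule1.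
  - move=> m' mm'; rewrite indicE memNset ?mule0//= Xm => -[] /eqP.
    by rewrite eqr_nat eq_sym (negbTE mm').
  - by rewrite mule_ge0 ?lee_fin.
rewrite eseries0 => [|m _ _].
  by rewrite /at_count; case: pselect.
by rewrite indicE memNset ?mule0//= => Xm; apply: nX; exists m.
Qed.

(** Independence is given for events only. In [gen] the first [k] variables enter
through functions and the others through events that fix their values; expanding
the function of the [k]-th variable along its countably many values goes from
events to functions one variable at a time. *)
Lemma expectation_at_counts n :
  \int[P]_w (\prod_(i < n) at_count i w)%:E =
  \prod_(i < n) \sum_(0 <= m <oo) (phi i m)%:E * P [set w | X i w = m%:R%:E].
Proof.
have gen k : forall n a, (k <= n)%N ->
  \int[P]_w (\prod_(i < k) at_count i w * \1_(fixed k n a) w)%:E =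
  (\prod_(i < k) \sum_(0 <= m <oo) (phi i m)%:E * P [set w | X i w = m%:R%:E]) *
  \prod_(k <= i < n) P [set w | X i w = (a i)%:R%:E].
  elim: k => [|k IH] {}n a kn.
    under eq_integral do rewrite big_ord0 mul1r.
    rewrite big_ord0 mul1e integral_indic ?setIT// fixedE.
    apply: indX; first exact: iota_uniq.
    move=> i _; split=> //; exists [set (a i)%:R%:E]; first exact: emeasurable_set1.
    by rewrite setTI.
  pose upd m i := if i == k then m else a i.
  transitivity (\int[P]_w \sum_(0 <= m <oo) (phi k m)%:E *
     (\prod_(i < k) at_count i w * \1_(fixed k n (upd m)) w)%:E).
    apply: eq_integral => w _; rewrite big_ord_recr /=.
    have fixedS m : \1_(fixed k n (upd m)) w =
        (\1_[set w | X k w = m%:R%:E] w * \1_(fixed k.+1 n a) w)%R :> R.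
      rewrite !indicE -natrM mulnb; congr (_%:R); congr nat_of_bool.
      apply/idP/andP => [/set_mem /= h|[/set_mem /= h1 /set_mem h2]].
        split; apply/mem_set => /=.
          by have := h k; rewrite leqnn kn => /(_ isT); rewrite /upd eqxx.
        move=> i /andP[ki iN]; have := h i; rewrite (ltnW ki) iN => /(_ isT).
        by rewrite /upd gtn_eqF.
      apply/mem_set => i /andP[]; rewrite leq_eqVlt => /predU1P[<- _|ki iN].
        by rewrite /upd eqxx.
      by rewrite /upd gtn_eqF//; apply: h2; rewrite ki.
    have [[m Xm]|nX] := pselect (exists m : nat, X k w = m%:R%:E).
      rewrite (at_countE Xm) (@nneseries_single _ _ m).
      - rewrite fixedS [in RHS]indicE mem_set//= mul1r -EFinM; congr EFin.
        by rewrite mulrCA mulrA.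
      - move=> m' mm'; rewrite fixedS [X in (_ * (X * _))%R]indicE memNset.
          by rewrite mul0r mulr0 mule0.
        by rewrite /= Xm => -[] /eqP; rewrite eqr_nat eq_sym (negbTE mm').
      - by rewrite -EFinM lee_fin !mulr_ge0// prodr_ge0// => i _; exact: at_count_ge0.
    rewrite eseries0 => [|m _ _].
      by rewrite [X in (_ * X * _)%R](_ : _ = 0%R) ?mulr0 ?mul0r// /at_count; case: pselect.
    rewrite fixedS [X in (_ * (X * _))%R]indicE memNset ?mul0r ?mulr0 ?mule0//=.
    by move=> Xm; apply: nX; exists m.
  have mterm m : measurable_fun setT (fun w =>
      (\prod_(i < k) at_count i w * \1_(fixed k n (upd m)) w)%:E).
    apply/measurable_EFinP; apply: measurable_funM; last exact: measurable_indic.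
    by apply: measurable_prod => i _; exact: measurable_at_count.
  have term0 m w : 0 <= (\prod_(i < k) at_count i w * \1_(fixed k n (upd m)) w)%:E.
    by rewrite lee_fin mulr_ge0// prodr_ge0// => i _; exact: at_count_ge0.
  rewrite integral_nneseries//; last 2 first.
    by move=> m; exact: measurable_funeM.
    by move=> m w _; rewrite mule_ge0// lee_fin.
  transitivity (\sum_(0 <= m <oo) (phi k m)%:E * P [set w | X k w = m%:R%:E] *
    ((\prod_(i < k) \sum_(0 <= m <oo) (phi i m)%:E * P [set w | X i w = m%:R%:E]) *
     \prod_(k.+1 <= i < n) P [set w | X i w = (a i)%:R%:E])).
    apply: eq_eseriesr => m _.
    rewrite ge0_integralZl//; last by rewrite lee_fin.
    rewrite IH ?(ltnW kn)// (big_ltn kn) {1}/upd eqxx -muleA; congr (_ * _).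
    rewrite muleCA; congr (_ * (_ * _)).
    by apply: eq_big_nat => i /andP[ki _]; rewrite /upd gtn_eqF.
  have cfin : \prod_(i < k) (\sum_(0 <= m <oo) (phi i m)%:E *
      P [set w | X i w = m%:R%:E]) \is a fin_num.
    have := IH k (fun=> 0%N) (leqnn k); rewrite [X in _ = _ * X]big_geq// mule1 => <-.
    rewrite ge0_fin_numE; last first.
      apply: integral_ge0 => w _; rewrite lee_fin mulr_ge0// prodr_ge0// => i _.
      exact: at_count_ge0.
    apply: (@le_lt_trans _ _ (\int[P]_w 1)); last first.
      by rewrite integral_cst//= probability_setT mule1 ltry.
    apply: ge0_le_integral => //.
    - move=> w _; rewrite lee_fin mulr_ge0// prodr_ge0// => i _.
      exact: at_count_ge0.
    - apply/measurable_EFinP; apply: measurable_funM; last exact: measurable_indic.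
      by apply: measurable_prod => i _; exact: measurable_at_count.
    - move=> w _; rewrite lee_fin mulr_ile1//.
      + by rewrite prodr_ge0// => i _; exact: at_count_ge0.
      + by rewrite prodr_ile1// => i _; rewrite at_count_ge0 at_count_le1.
  have pfin : \prod_(k.+1 <= i < n) P [set w | X i w = (a i)%:R%:E] \is a fin_num.
    by apply: prode_fin_num => i _; apply: fin_num_measure; exact: measurable_value.
  rewrite -(fineK cfin) -(fineK pfin) -EFinM.
  under eq_eseriesr do rewrite muleC.
  rewrite nneseriesZl; last first.
    by move=> m _; rewrite mule_ge0// lee_fin.
  by rewrite big_ord_recr /= -(fineK cfin) /= EFinM -!muleA (muleC (fine _)%:E (\sum_(0 <= m <oo) _)).
have := gen n n (fun=> 0%N) (leqnn n).
rewrite [X in _ = _ * X]big_geq// mule1 => <-; apply: eq_integral => w _.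
by rewrite indicE mem_set ?mulr1// => i; case: ltngtP.
Qed.

End IndependentCounts.

Lemma poisson_lawE (R : realType) (r : R) n : (0 <= r)%R ->
  poisson_law r n = (r ^+ n / n`!%:R * expR (- r))%:E.
Proof.
move=> r0; rewrite /poisson_law /poisson_prob; case: ifPn => [rp|].
  by rewrite esum_set1 /poisson_pmf ?rp// lee_fin mulr_ge0 ?expR_ge0// divr_ge0// exprn_ge0.
rewrite -leNgt => rn; have -> : r = 0%R by apply/eqP; rewrite eq_le rn r0.
rewrite oppr0 expR0 mulr1 diracE; case: n => [|n]; first by rewrite mem_set//= fact0 divr1.
by rewrite memNset// expr0n /= mul0r.
Qed.

Lemma poisson_law_ge0 (R : realType) (r : R) n : (0 <= r)%R -> 0 <= poisson_law r n.
Proof.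
by move=> r0; rewrite poisson_lawE// lee_fin mulr_ge0 ?expR_ge0// divr_ge0// exprn_ge0.
Qed.

Lemma exp_nneseries (R : realType) (x : R) : (0 <= x)%R ->
  \sum_(0 <= n <oo) (x ^+ n / n`!%:R)%:E = (expR x)%:E.
Proof.
move=> x0; rewrite expRE -EFin_lim; last first.
  rewrite /pseries/=; under eq_fun do rewrite mulrC.
  exact: is_cvg_series_exp_coeff.
apply/congr_lim/funext => n/=; rewrite /pseries/= /series/= -sumEFin//.
by under eq_bigr do rewrite mulrC.
Qed.

Lemma poisson_pgf (R : realType) (r s : R) : (0 <= r)%R -> (0 <= s)%R ->
  \sum_(0 <= n <oo) (s ^+ n)%:E * poisson_law r n = (expR (- ((1 - s) * r)))%:E.
Proof.
move=> r0 s0.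
transitivity (\sum_(0 <= n <oo) (expR (- r))%:E * ((s * r) ^+ n / n`!%:R)%:E).
  apply: eq_eseriesr => n _; rewrite poisson_lawE// -!EFinM; congr EFin.
  by rewrite exprMn; ring.
rewrite nneseriesZl; last by move=> n _; rewrite lee_fin divr_ge0// exprn_ge0// mulr_ge0.
rewrite exp_nneseries ?mulr_ge0// -EFinM -expRD; congr (expR _)%:E; ring.
Qed.

Lemma poisson_law_sum (R : realType) (r : R) : (0 <= r)%R ->
  \sum_(0 <= n <oo) poisson_law r n = 1.
Proof.
move=> r0; have := poisson_pgf r0 (@ler01 R); rewrite subrr mul0r oppr0 expR0 => <-.
by apply: eq_eseriesr => n _; rewrite expr1n mul1e.
Qed.

Section PointProcess.
Context (R : realType) (d d' : measure_display) (Omega : measurableType d)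
  (S : measurableType d') (P : probability Omega R)
  (mu : {measure set S -> \bar R}) (p : nat -> Omega -> S).
Hypothesis ppp : poisson_point_process P mu p.

Let mp k : measurable_fun setT (p k). Proof. by have [] := ppp. Qed.

Lemma measurable_point_count C : measurable C ->
  measurable_fun setT (point_count R p C).
Proof.
move=> mC; apply: ge0_emeasurable_sum => [k w _ _|k _]; first by rewrite diracE lee_fin.
apply/measurable_EFinP.
exact: (measurableT_comp (measurable_indic mC) (mp k)).
Qed.

(** The partial counts are integers that increase to [m]. *)
Lemma point_count_seen (C : set S) w (m : nat) : point_count R p C w = m%:R%:E ->
  exists K0, forall K, (K0 <= K)%N -> (\sum_(k < K) (p k w \in C))%N = m.
Proof.
move=> Cm.
have partial K : ((\sum_(k < K) (p k w \in C))%N%:R : R)%:E =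
    \sum_(0 <= k < K) \d_(p k w) C.
  rewrite natr_sum -sumEFin big_mkord; apply: eq_bigr => k _.
  by rewrite diracE.
have ub K : (\sum_(k < K) (p k w \in C) <= m)%N.
  rewrite -(ler_nat R) -lee_fin partial -Cm.
  by apply: nneseries_lim_ge => i _ _; rewrite diracE lee_fin.
have mono K L : (K <= L)%N -> (\sum_(k < K) (p k w \in C) <= \sum_(k < L) (p k w \in C))%N.
  move=> /subnKC <-; rewrite big_split_ord /=.
  by rewrite leq_addr.
have [[K0 hK0]|no] := pselect (exists K0, (m <= \sum_(k < K0) (p k w \in C))%N).
  exists K0 => K KK; apply/eqP; rewrite eqn_leq ub (leq_trans hK0)//.
  exact: mono.
exfalso; case: m Cm ub no => [|m] Cm ub no; first by apply: no; exists 0%N.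
have ub' K : (\sum_(k < K) (p k w \in C) <= m)%N.
  by rewrite leqNgt; apply/negP => h; apply: no; exists K.
have : point_count R p C w <= m%:R%:E.
  apply: lime_le.
    by apply: is_cvg_nneseries => i _ _; rewrite diracE lee_fin.
  by apply: nearW => K; rewrite -partial lee_fin ler_nat.
by rewrite Cm lee_fin ler_nat ltnn.
Qed.

Lemma point_count_finite C : measurable C -> mu C < +oo ->
  P [set w | exists m : nat, point_count R p C w = m%:R%:E] = 1.
Proof.
move=> mC muC; have [_ law _ _] := ppp.
rewrite (_ : [set w | _] = \bigcup_m [set w | point_count R p C w = m%:R%:E]); last first.
  by apply/seteqP; split => w /= [m]; [exists m|move=> _; exists m].
rewrite measure_bigcup//=.
- rewrite -(@poisson_law_sum R (fine (mu C))) ?fine_ge0//.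
  under eq_eseriesl do rewrite in_setT.
  by apply: eq_eseriesr => m _; rewrite law.
- move=> m _; have := measurable_point_count mC measurableT (emeasurable_set1 m%:R%:E).
  by rewrite setTI.
- by move=> i j _ _ [w [/= -> [] /eqP]]; rewrite eqr_nat => /eqP.
Qed.

Lemma measurable_point_count_finite C : measurable C ->
  measurable [set w | exists m : nat, point_count R p C w = m%:R%:E].
Proof.
move=> mC; rewrite (_ : mkset _ = \bigcup_m [set w | point_count R p C w = m%:R%:E]).
  apply: bigcup_measurable => m _.
  by have := measurable_point_count mC measurableT (emeasurable_set1 m%:R%:E); rewrite setTI.
by apply/seteqP; split => w /= [m]; [exists m|move=> _; exists m].
Qed.

Lemma one_minus_simple (n : nat) (c : nat -> R) (D : nat -> set S) (x : S) :
  trivIset setT D ->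
  (1 - \sum_(i < n) c i * \1_(D i) x = \prod_(i < n) (1 - c i) ^+ (x \in D i))%R.
Proof.
move=> tD; elim: n => [|n IH]; first by rewrite !big_ord0 subr0.
rewrite !big_ord_recr /= -IH indicE; case: (boolP (x \in D n)) => [xn|_]; last first.
  by rewrite mulr0 addr0 expr0 mulr1.
rewrite big1 ?add0r ?subr0 ?mul1r ?mulr1// => i _.
rewrite indicE memNset ?mulr0// => xi.
have := tD i n I I; move=> /(_ (ex_intro _ x (conj xi (set_mem xn)))) E.
by have := ltn_ord i; rewrite E ltnn.
Qed.

(** Once [K] is so large that all the points of every [D i] have been seen, the
product is that of the [(1 - c i) ^+ N i], where [N i] is the number of points in
[D i]. The [N i] are independent Poisson variables, whose generating functions are
known; dominated convergence concludes. *)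
Lemma laplace_simple (n : nat) (c : nat -> R) (D : nat -> set S) :
  (forall i, 0 <= c i <= 1)%R -> (forall i, measurable (D i)) -> trivIset setT D ->
  (forall i, mu (D i) < +oo) ->
  \int[P]_w (\prod_(k < K) (1 - \sum_(i < n) c i * \1_(D i) (p k w)))%:E @[K --> \oo] -->
  (expR (- \sum_(i < n) c i * fine (mu (D i))))%:E.
Proof.
move=> c01 mD tD fD; have [_ law _ ind] := ppp.
pose X i := point_count R p (D i).
have mX i : measurable_fun setT (X i) by exact: measurable_point_count.
pose phi i m := ((1 - c i) ^+ m)%R.
have phi0 i m : (0 <= phi i m)%R by rewrite exprn_ge0// subr_ge0; case/andP: (c01 i).
have phi1 i m : (phi i m <= 1)%R.
  by rewrite exprn_ile1//; have /andP[c0 c1] := c01 i; rewrite ?subr_ge0// gerBl.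
have := expectation_at_counts mX (ind D mD tD) phi0 phi1 n.
rewrite [RHS](_ : _ = (expR (- \sum_(i < n) c i * fine (mu (D i))))%:E); last first.
  rewrite -sumrN expR_sum -prodEFin; apply: eq_bigr => i _.
  under eq_eseriesr do rewrite law//.
  rewrite poisson_pgf ?fine_ge0//; last by have /andP[c0 c1] := c01 i; rewrite subr_ge0.
  by rewrite subKr.
move=> <-.
have term01 K w : (0 <= \prod_(k < K) (1 - \sum_(i < n) c i * \1_(D i) (p k w)) <= 1)%R.
  have h k : (0 <= 1 - \sum_(i < n) c i * \1_(D i) (p k w) <= 1)%R.
    rewrite one_minus_simple//; apply/andP; split.
      by apply: prodr_ge0 => i _; exact: phi0.
    by apply: prodr_ile1 => i _; rewrite phi0 phi1.
  rewrite prodr_ge0; last by move=> k _; case/andP: (h k).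
  by rewrite prodr_ile1// => k _; exact: h.
have mterm K : measurable_fun setT
    (fun w => (\prod_(k < K) (1 - \sum_(i < n) c i * \1_(D i) (p k w)))%:E).
  apply/measurable_EFinP; apply: measurable_prod => k _.
  apply: measurable_funB => //; apply: measurable_sum => i.
  apply: measurable_funM => //.
  exact: (measurableT_comp (measurable_indic (mD i)) (mp k)).
have [||||_ _] := @dominated_convergence _ _ _ P setT measurableT
  (fun K w => (\prod_(k < K) (1 - \sum_(i < n) c i * \1_(D i) (p k w)))%:E)
  (fun w => (\prod_(i < n) at_count X phi i w)%:E) (cst 1) mterm; last exact.
- apply/measurable_EFinP; apply: measurable_prod => i _.
  exact: measurable_at_count.
- have : {ae P, forall w, forall i, exists m : nat, X i w = m%:R%:E}.
    apply: ae_foralln => i; apply: ae_of_probability1 (point_count_finite _ _) => //.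
    exact: measurable_point_count_finite.
  apply: filterS => w Xw _; apply: cvg_near_cst.
  have [K0 hK0] : {K0 : nat -> nat & forall i K, (K0 i <= K)%N ->
      at_count X phi i w = ((1 - c i) ^+ (\sum_(k < K) (p k w \in D i))%N)%R}.
    apply: (@choice _ _ (fun i K0 => forall K, (K0 <= K)%N ->
      at_count X phi i w = ((1 - c i) ^+ (\sum_(k < K) (p k w \in D i))%N)%R)) => i.
    have [m Xm] := Xw i; have [K0 hK0] := point_count_seen Xm.
    by exists K0 => K KK; rewrite hK0// (at_countE _ Xm).
  exists (\max_(i < n) K0 i)%N => // K /= KK; congr EFin.
  under eq_bigr do rewrite one_minus_simple//.
  rewrite exchange_big /=; apply: eq_bigr => i _.
  rewrite (hK0 i K); first by rewrite expr_sum.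
  by apply: leq_trans KK; exact: (leq_bigmax (F := fun i : 'I_n => K0 i)).
- exact: finite_measure_integrable_cst.
- apply: aeW => w K _ /=; have /andP[h0 h1] := term01 K w.
  by rewrite lee_fin ger0_norm.
Qed.

Import HBNNSimple.

(** The level set of the value 0 may have infinite mass; only the positive values
enter the expression as a combination of indicators. *)
Lemma laplace_nnsfun (h : {nnsfun S >-> R}) : (forall x, h x <= 1)%R ->
  \int[mu]_x (h x)%:E < +oo ->
  \int[P]_w (\prod_(k < K) (1 - h (p k w)))%:E @[K --> \oo] -->
  (expR (- fine (\int[mu]_x (h x)%:E)))%:E.
Proof.
move=> h1 hfin.
have [s sE] : exists s : seq R, range h = [set` s].
  by apply/finite_seqP; exact: fimfunP.
pose vals := [seq y <- undup s | (0 < y)%R].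
have uvals : uniq vals by rewrite filter_uniq// undup_uniq.
have rangeP y : y \in undup s <-> range h y by rewrite mem_undup sE.
pose c i := if (i < size vals)%N then nth 0%R vals i else 0%R.
pose D i := if (i < size vals)%N then h @^-1` [set nth 0%R vals i] else set0.
have valP i : (i < size vals)%N -> (0 < nth 0%R vals i)%R.
  by move=> /(mem_nth 0%R); rewrite mem_filter => /andP[].
have hE x : h x = (\sum_(i < size vals) c i * \1_(D i) x)%R.
  have [hx0|hx0] := eqVneq (h x) 0%R.
    rewrite big1// => i _; rewrite /D ltn_ord indicE memNset ?mulr0//= hx0 => E.
    by have := valP i (ltn_ord i); rewrite -E ltxx.
  have hxv : h x \in vals.
    by rewrite mem_filter lt_neqAle eq_sym hx0 fun_ge0/=; apply/rangeP; exists x.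
  have iv : (index (h x) vals < size vals)%N by rewrite index_mem.
  rewrite (bigD1 (Ordinal iv))//= /c /D iv nth_index// indicE mem_set// mulr1.
  rewrite big1 ?addr0// => i ii; rewrite ltn_ord indicE memNset ?mulr0//= => E.
  by move/eqP: ii; apply; apply: val_inj => /=; rewrite E index_uniq.
have mD i : measurable (D i).
  rewrite /D; case: ifPn => // _; exact: measurable_funPTI.
have tD : trivIset setT D.
  move=> i j _ _; rewrite /D; case: ifPn => iv; case: ifPn => jv; rewrite ?set0I ?setI0 => -[x]//=.
  by move=> [-> /eqP]; rewrite nth_uniq// => /eqP.
have c01 i : (0 <= c i <= 1)%R.
  rewrite /c; case: ifPn => iv; last by rewrite lexx ler01.
  rewrite (ltW (valP _ iv))/=; have : nth 0%R vals i \in vals by exact: mem_nth.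
  by rewrite mem_filter => /andP[_ /rangeP [x _ <-]].
have intE : \int[mu]_x (h x)%:E = \sum_(i < size vals) (c i)%:E * mu (D i).
  under eq_integral do rewrite hE -sumEFin.
  rewrite ge0_integral_sum//.
  - apply: eq_bigr => i _; under eq_integral do rewrite EFinM.
    rewrite ge0_integralZl//.
    + by rewrite integral_indic// setIT.
    + by apply/measurable_EFinP; exact: measurable_indic.
    + by rewrite lee_fin; case/andP: (c01 i).
  - by move=> i; apply/measurable_EFinP; apply: measurable_funM => //; exact: measurable_indic.
  - by move=> i x _; rewrite lee_fin mulr_ge0//; case/andP: (c01 i).
have fD i : mu (D i) < +oo.
  have [iv|iv] := ltnP i (size vals); last by rewrite /D ltnNge iv measure0.
  move: hfin; rewrite intE (bigD1 (Ordinal iv))//= => /(le_lt_trans _) hlt.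
  have : (c i)%:E * mu (D i) < +oo.
    apply: hlt; rewrite leeDl// sume_ge0// => j _; rewrite mule_ge0// lee_fin.
    by case/andP: (c01 j).
  rewrite [in X in X -> _]ltey => cD; rewrite ltey; apply: contra cD => /eqP ->.
  by rewrite gt0_muley// lte_fin /c iv valP.
under eq_cvg => K.
  under eq_integral do (under eq_bigr do rewrite hE).
  over.
rewrite [X in expR (- X)](_ : _ = (\sum_(i < size vals) c i * fine (mu (D i)))%R).
  exact: laplace_simple.
rewrite intE (_ : bigop _ _ _ = (\sum_(i < size vals) c i * fine (mu (D i)))%:E)//.
rewrite -sumEFin; apply: eq_bigr => i _.
by rewrite EFinM fineK// ge0_fin_numE.
Qed.

(** The expectation decreases with [K] and increases when [u] is replaced by a
smaller function. Simple functions [h n] increasing to [u] therefore bound its limit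
from above by [exp (- mu (h n))], which tends to [exp (- mu u)]. For the lower bound
[K] is fixed first: the expectation at [K] is the limit in [n] of those of the
[h n], each of which is at least [exp (- mu (h n))]. *)
Theorem laplace_functional (u : S -> R) : measurable_fun setT u ->
  (forall x, 0 <= u x <= 1)%R -> \int[mu]_x (u x)%:E < +oo ->
  \int[P]_w (\prod_(k < K) (1 - u (p k w)))%:E @[K --> \oo] -->
  (expR (- fine (\int[mu]_x (u x)%:E)))%:E.
Proof.
move=> mu_ u01 ufin.
have mEu : measurable_fun setT (EFin \o u) by exact/measurable_EFinP.
pose h := nnsfun_approx measurableT mEu.
have u0 x : setT x -> 0 <= (EFin \o u) x by move=> _; rewrite lee_fin; case/andP: (u01 x).
have hcvg x : EFin \o h^~ x @ \oo --> (u x)%:E by exact: cvg_nnsfun_approx.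
have hnd x : nondecreasing_seq (fun n => h n x).
  by move=> m n mn; exact/lefP/nd_nnsfun_approx.
have hu n x : (h n x <= u x)%R.
  rewrite -lee_fin; apply: (cvge_ge _ (hcvg x)).
  by exists n => // m /= nm; rewrite lee_fin; exact: hnd.
have h1 n x : (h n x <= 1)%R by apply: (le_trans (hu n x)); case/andP: (u01 x).
have mh n : measurable_fun setT (fun x => (h n x)%:E) by exact/measurable_EFinP.
have lehu n : \int[mu]_x (h n x)%:E <= \int[mu]_x (u x)%:E.
  apply: ge0_le_integral => //.
  - by move=> x _; rewrite lee_fin.
  - by move=> x _; rewrite lee_fin.
have hfin n : \int[mu]_x (h n x)%:E < +oo by exact: le_lt_trans (lehu n) ufin.
have fin0 n : \int[mu]_x (h n x)%:E \is a fin_num.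
  by rewrite ge0_fin_numE//; apply: integral_ge0 => x _; rewrite lee_fin.
have ufn : \int[mu]_x (u x)%:E \is a fin_num.
  by rewrite ge0_fin_numE//; apply: integral_ge0 => x _; exact: u0.
pose F (v : S -> R) K := \int[P]_w (\prod_(k < K) (1 - v (p k w)))%:E.
have prod01 (v : S -> R) K w : (forall x, 0 <= v x <= 1)%R ->
    (0 <= \prod_(k < K) (1 - v (p k w)) <= 1)%R.
  move=> v01; rewrite prodr_ge0/=; last first.
    by move=> k _; rewrite subr_ge0; case/andP: (v01 (p k w)).
  apply: prodr_ile1 => k _; have /andP[v0 v1] := v01 (p k w).
  by rewrite subr_ge0 v1 gerBl.
have mprod (v : S -> R) K : measurable_fun setT v ->
    measurable_fun setT (fun w => (\prod_(k < K) (1 - v (p k w)))%:E).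
  move=> mv; apply/measurable_EFinP; apply: measurable_prod => k _.
  by apply: measurable_funB => //; exact: (measurableT_comp mv (mp k)).
have h01 n x : (0 <= h n x <= 1)%R by rewrite h1 andbT.
have lim_h n : F (h n) K @[K --> \oo] --> (expR (- fine (\int[mu]_x (h n x)%:E)))%:E.
  exact: laplace_nnsfun.
have F_noninc (v : S -> R) : measurable_fun setT v -> (forall x, 0 <= v x <= 1)%R ->
    nonincreasing_seq (F v).
  move=> mv v01; apply/nonincreasing_seqP => K; apply: ge0_le_integral => //.
  - by move=> w _; rewrite lee_fin; case/andP: (prod01 v K.+1 w v01).
  - exact: mprod.
  - exact: mprod.
  - move=> w _; rewrite lee_fin big_ord_recr /= ler_piMr//.
      by case/andP: (prod01 v K w v01).
    by rewrite gerBl; case/andP: (v01 (p K w)).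
have Fcvg (v : S -> R) : measurable_fun setT v -> (forall x, 0 <= v x <= 1)%R -> cvgn (F v).
  by move=> mv v01; exact/ereal_nonincreasing_is_cvgn/F_noninc.
have mhR n : measurable_fun setT (h n) by [].
have F_le n K : F u K <= F (h n) K.
  apply: ge0_le_integral => //.
  - by move=> w _; rewrite lee_fin; case/andP: (prod01 u K w u01).
  - exact: mprod.
  - exact: mprod.
  - move=> w _; rewrite lee_fin; apply: ler_prod => k _.
    by rewrite subr_ge0 lerD2l lerN2 hu andbT; case/andP: (u01 (p k w)).
have Fh_cvg K : F (h n) K @[n --> \oo] --> F u K.
  apply: (@dominated_cvg _ _ _ P setT measurableT
    (fun n w => (\prod_(k < K) (1 - h n (p k w)))%:E) _ (cst 1)) => //.
  - by move=> n; exact: mprod.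
  - move=> w _; apply: cvg_EFin; first exact: nearW.
    elim: K => [|K IH]; first by under eq_cvg do rewrite /= big_ord0; rewrite big_ord0; exact: cvg_cst.
    under eq_cvg do rewrite /= big_ord_recr /=; rewrite big_ord_recr /=.
    apply: cvgM; first exact: IH.
    by apply: cvgB; [exact: cvg_cst | have /fine_cvgP[] := hcvg (p K w)].
  - exact: finite_measure_integrable_cst.
  - move=> n w _ /=; have /andP[a0 a1] := prod01 (h n) K w (h01 n).
    by rewrite lee_fin ger0_norm.
have lower K : (expR (- fine (\int[mu]_x (u x)%:E)))%:E <= F u K.
  apply: (cvge_ge _ (Fh_cvg K)); apply: nearW => n.
  apply: (@le_trans _ _ (expR (- fine (\int[mu]_x (h n x)%:E)))%:E).
    by rewrite lee_fin ler_expR lerN2 fine_le.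
  apply: (cvge_le _ (lim_h n)); exists K => // L /= KL.
  exact: F_noninc.
have cexp : (expR (- fine (\int[mu]_x (h n x)%:E)))%:E @[n --> \oo] -->
    (expR (- fine (\int[mu]_x (u x)%:E)))%:E.
  apply: cvg_EFin; first exact: nearW.
  apply: continuous_cvg; first exact: continuous_expR.
  apply: cvgN; apply: fine_cvg; rewrite fineK//.
  rewrite (_ : (fun x => (u x)%:E) = (fun x => limn (fun n => (h n x)%:E))); last first.
    by apply/funext => x; apply/esym/cvg_lim => //; exact: hcvg.
  apply: cvg_monotone_convergence => //.
  - by move=> n x _; rewrite lee_fin.
  - by move=> x _ a b ab; rewrite lee_fin; exact: hnd.
suff -> : (expR (- fine (\int[mu]_x (u x)%:E)))%:E = limn (F u) by exact: Fcvg.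
apply/eqP; rewrite eq_le; apply/andP; split.
  by apply: lime_ge; [exact: Fcvg | exact: nearW].
apply: (cvge_ge _ cexp); apply: nearW => n.
rewrite -(cvg_lim _ (lim_h n))//; apply: lee_lim; [exact: Fcvg| |exact: nearW].
by apply: Fcvg.
Qed.

End PointProcess.

(** * Placing finitely many factors at distinct points *)

Definition rem_at (T : Type) (s : seq T) (j : nat) : seq T := take j s ++ drop j.+1 s.

Lemma size_rem_at (T : Type) (s : seq T) j : (j < size s)%N -> size (rem_at s j) = (size s).-1.
Proof.
move=> js; rewrite size_cat size_takel ?size_drop//; last exact: ltnW.
by rewrite -[in RHS](subnKC js).
Qed.

Lemma map_rem_at (T U : Type) (f : T -> U) s j : map f (rem_at s j) = rem_at (map f s) j.
Proof. by rewrite /rem_at map_cat map_take map_drop. Qed.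

Lemma nth_rem_at (T : Type) (x0 : T) s j k : (j < size s)%N ->
  nth x0 (rem_at s j) k = nth x0 s (if (k < j)%N then k else k.+1).
Proof.
move=> js; rewrite nth_cat size_takel ?(ltnW js)//; case: ltnP => kj; first by rewrite nth_take.
by rewrite nth_drop addSn subnKC.
Qed.

Definition fam_del (J : eqType) (T : Type) (fam : J -> seq T) i j : J -> seq T :=
  fun i' => if i' == i then rem_at (fam i') j else fam i'.

Definition fam_add (J : eqType) (T : Type) (fam : J -> seq T) i (f : T) : J -> seq T :=
  fun i' => if i' == i then f :: fam i' else fam i'.

Lemma del_add0 (J : eqType) (T : Type) (fam : J -> seq T) i (f : T) :
  fam_del (fam_add fam i f) i 0 = fam.
Proof.
by apply/funext => i'; rewrite /fam_del /fam_add; case: eqP => // _; rewrite /rem_at take0 /= drop0.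
Qed.

Lemma del_addS (J : eqType) (T : Type) (fam : J -> seq T) i (f : T) j :
  fam_del (fam_add fam i f) i j.+1 = fam_add (fam_del fam i j) i f.
Proof. by apply/funext => i'; rewrite /fam_del /fam_add; case: eqP. Qed.

Lemma del_add_neq (J : eqType) (T : Type) (fam : J -> seq T) i i0 (f : T) j : i != i0 ->
  fam_del (fam_add fam i0 f) i j = fam_add (fam_del fam i j) i0 f.
Proof.
move=> ii; apply/funext => i'; rewrite /fam_del /fam_add.
by case: (eqVneq i' i) => [->|]; rewrite ?(negbTE ii).
Qed.

Section Placements.
Context (R : realType) (S : Type) (J : eqType) (I : seq J).
Hypothesis uI : uniq I.
Implicit Types (g f : S -> R) (fam : J -> seq (S -> R)) (x : nat -> S).

Notation zero := (fun=> 0%R : R).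

Definition family_all (T : Type) (x0 : T) (Q : T -> Prop) (fam : J -> seq T) :=
  forall i j, i \in I -> (j < size (fam i))%N -> Q (nth x0 (fam i) j).

Lemma family_all_del (T : Type) (x0 : T) (Q : T -> Prop) (fam : J -> seq T) i j :
  (j < size (fam i))%N -> family_all x0 Q fam -> family_all x0 Q (fam_del fam i j).
Proof.
move=> js h i' j' iI; rewrite /fam_del; case: eqP => [ii|_]; last exact: h.
move: iI; rewrite {}ii => iI; rewrite size_rem_at// nth_rem_at// => j's.
apply: h => //; case: (ltnP j' j) => jj; first exact: ltn_trans jj js.
by case: (size _) js j's.
Qed.

(** The sum, over all ways of assigning to the factors [nth zero (fam i) j], for
[i] in [I], different points among the first [K], of the product of the factors at
their points and of [g] at the remaining ones. The recursion chooses what the last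
point receives. *)
Fixpoint placements x g fam (K : nat) : R :=
  if K is K'.+1 then
    (g (x K') * placements x g fam K' +
     \sum_(i <- I) \sum_(j < size (fam i))
        nth zero (fam i) j (x K') * placements x g (fam_del fam i j) K')%R
  else ((all (fun i => nilp (fam i)) I)%:R)%R.

Definition nonneg f := forall s, (0 <= f s)%R.

Lemma placements_ge0 x g fam K : nonneg g -> family_all zero nonneg fam ->
  (0 <= placements x g fam K)%R.
Proof.
move=> g0; elim: K fam => [|K IH] fam h /=; first by case: all.
rewrite addr_ge0 ?mulr_ge0 ?IH//.
rewrite big_seq sumr_ge0// => i iI; rewrite sumr_ge0// => j _.
rewrite mulr_ge0//; first exact: h.
by apply: IH; exact: family_all_del.
Qed.

Lemma le_placements x g g' fam K : nonneg g -> (forall s, g s <= g' s)%R ->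
  family_all zero nonneg fam -> (placements x g fam K <= placements x g' fam K)%R.
Proof.
move=> g0 gg'; elim: K fam => [|K IH] fam h //=; apply: lerD.
  by apply: ler_pM => //; [exact: placements_ge0|exact: IH].
rewrite big_seq [leRHS]big_seq ler_sum// => i iI; rewrite ler_sum// => j _.
rewrite ler_wpM2l//; first exact: h.
by apply: IH; exact: family_all_del.
Qed.

Definition total_size (T : Type) (fam : J -> seq T) : nat := \sum_(i <- I) size (fam i).

Lemma total_size_del (T : Type) (fam : J -> seq T) i j : i \in I -> (j < size (fam i))%N ->
  (total_size (fam_del fam i j)).+1 = total_size fam.
Proof.
move=> iI js; rewrite /total_size !(bigD1_seq i)//= {1}/fam_del eqxx size_rem_at//.
rewrite -addSn prednK ?(leq_ltn_trans _ js)//; congr (_ + _)%N.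
by apply: eq_bigr => i' ii; rewrite /fam_del (negbTE ii).
Qed.

(** Each point contributes [g], at most 1, or one of at most [n] factors, which are
bounded by [C]. *)
Lemma placements_bound x g fam K n (C : R) : (0 <= C)%R -> nonneg g -> (forall s, g s <= 1)%R ->
  family_all zero (fun f => forall s, 0 <= f s <= C)%R fam ->
  (total_size fam <= n)%N -> (placements x g fam K <= (1 + C * n%:R) ^+ K)%R.
Proof.
move=> C0 g0 g1; elim: K fam => [|K IH] fam h hn /=.
  by rewrite expr0; case: all.
have B0 : (0 <= (1 + C * n%:R) ^+ K)%R by rewrite exprn_ge0// addr_ge0// mulr_ge0.
have h' : family_all zero nonneg fam.
  by move=> i j iI js s; case/andP: (h i j iI js s).
rewrite exprS mulrDl mul1r; apply: lerD.
  rewrite -[leRHS]mul1r; apply: ler_pM => //; [exact: placements_ge0|exact: IH].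
apply: (@le_trans _ _ (\sum_(i <- I) \sum_(j < size (fam i)) C * (1 + C * n%:R) ^+ K)%R).
  rewrite big_seq [leRHS]big_seq ler_sum// => i iI; rewrite ler_sum// => j _.
  have /andP[f0 f1] := h i j iI (ltn_ord j) (x K).
  apply: ler_pM => //; first by apply: placements_ge0 => //; exact: family_all_del.
  apply: IH; first exact: family_all_del.
  by apply: leq_trans hn; rewrite -(@total_size_del _ fam i j).
have -> : (\sum_(i <- I) \sum_(j < size (fam i)) C * (1 + C * n%:R) ^+ K =
    C * (1 + C * n%:R) ^+ K * (total_size fam)%:R)%R.
  rewrite /total_size natr_sum mulr_sumr; apply: eq_bigr => i _.
  by rewrite sumr_const card_ord [RHS]mulr_natr.
by rewrite mulrAC ler_wpM2r// ler_wpM2l// ler_nat.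
Qed.

Lemma placements_add x g f i0 fam K : i0 \in I ->
  placements x g (fam_add fam i0 f) K.+1 =
  (g (x K) * placements x g (fam_add fam i0 f) K + f (x K) * placements x g fam K +
   \sum_(i <- I) \sum_(j < size (fam i))
     nth zero (fam i) j (x K) * placements x g (fam_add (fam_del fam i j) i0 f) K)%R.
Proof.
move=> i0I; rewrite [LHS]/= -addrA; congr (_ + _)%R.
rewrite !(bigD1_seq i0)//= addrA; congr (_ + _)%R.
  have -> : fam_add fam i0 f i0 = f :: fam i0 by rewrite /fam_add eqxx.
  rewrite big_ord_recl /= del_add0; congr (_ + _)%R.
  by apply: eq_bigr => j _; rewrite del_addS.
apply: eq_bigr => i ii; have -> : fam_add fam i0 f i = fam i by rewrite /fam_add (negbTE ii).
by apply: eq_bigr => j _; rewrite del_add_neq.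
Qed.

Section Perturbation.
Variables (x : nat -> S) (g f : S -> R) (i0 : J) (t e : R).
Hypotheses (i0I : i0 \in I) (g0 : nonneg g) (f0 : nonneg f).
Hypotheses (t0 : (0 <= t)%R) (te : (t <= e)%R) (e0 : (0 < e)%R).

Let gt s := (g s + t * f s)%R.
Let ge s := (g s + e * f s)%R.

Let gt0 : nonneg gt. Proof. by move=> s; rewrite addr_ge0// mulr_ge0. Qed.

Let ge0 : nonneg ge. Proof. by move=> s; rewrite addr_ge0// mulr_ge0// ltW. Qed.

Let gt_le_ge s : (gt s <= ge s)%R.
Proof. by rewrite lerD2l ler_wpM2r. Qed.

(** As a function of [t], the placement sum of [g + t f] is a polynomial with
nonnegative coefficients, and [t ^+ k <= t / e * e ^+ k] for [k >= 1]: the terms of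
positive degree are compared with their values at [e]. The proof follows the
recursion of [placements] and never writes the polynomial. *)
Lemma placements_increment fam K : family_all zero nonneg fam ->
  (0 <= placements x gt fam K - placements x g fam K <= t / e * placements x ge fam K)%R.
Proof.
have r0 : (0 <= t / e)%R by rewrite divr_ge0// ltW.
elim: K fam => [|K IH] fam h.
  by rewrite /= subrr lexx/= mulr_ge0//; case: all.
have -> : (placements x gt fam K.+1 - placements x g fam K.+1 =
  g (x K) * (placements x gt fam K - placements x g fam K) +
  t * f (x K) * placements x gt fam K +
  \sum_(i <- I) \sum_(j < size (fam i)) nth zero (fam i) j (x K) *
     (placements x gt (fam_del fam i j) K - placements x g (fam_del fam i j) K))%R.
  have -> : (\sum_(i <- I) \sum_(j < size (fam i)) nth zero (fam i) j (x K) *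
     (placements x gt (fam_del fam i j) K - placements x g (fam_del fam i j) K) =
     \sum_(i <- I) \sum_(j < size (fam i)) nth zero (fam i) j (x K) *
     placements x gt (fam_del fam i j) K - \sum_(i <- I) \sum_(j < size (fam i)) nth zero (fam i) j (x K) *
     placements x g (fam_del fam i j) K)%R.
    rewrite -sumrB; apply: eq_bigr => i _; rewrite -sumrB; apply: eq_bigr => j _.
    by rewrite mulrBr.
  by rewrite /= /gt; ring.
have /andP[a1 a2] := IH fam h.
have pt := placements_ge0 x K gt0 h; have pe := placements_ge0 x K ge0 h.
have le_pt : (placements x gt fam K <= placements x ge fam K)%R by exact: le_placements.
apply/andP; split.
  rewrite addr_ge0 ?addr_ge0 ?mulr_ge0//.
  rewrite big_seq sumr_ge0// => i iI; rewrite sumr_ge0// => j _; rewrite mulr_ge0//.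
    exact: h.
  by have /andP[] := IH _ (family_all_del (ltn_ord j) h).
rewrite /= [leRHS]mulrDr; apply: lerD.
  rewrite {1}/ge; have -> : (t / e * ((g (x K) + e * f (x K)) * placements x ge fam K) =
    g (x K) * (t / e * placements x ge fam K) + t * f (x K) * placements x ge fam K)%R.
    by field; rewrite gt_eqF.
  by apply: lerD; rewrite ler_wpM2l// ?mulr_ge0.
rewrite mulr_sumr big_seq [leRHS]big_seq ler_sum// => i iI.
rewrite mulr_sumr ler_sum// => j _; rewrite mulrCA ler_wpM2l//; first exact: h.
by have /andP[] := IH _ (family_all_del (ltn_ord j) h).
Qed.

(** The coefficient of degree 1 of that polynomial is the placement sum with the
additional factor [f]; the terms of degree at least 2 are compared with their values
at [e]. *)
Lemma placements_expansion fam K : family_all zero nonneg fam ->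
  (0 <= placements x gt fam K - placements x g fam K
        - t * placements x g (fam_add fam i0 f) K <= (t / e) ^+ 2 * placements x ge fam K)%R.
Proof.
have r0 : (0 <= t / e)%R by rewrite divr_ge0// ltW.
elim: K fam => [|K IH] fam h.
  rewrite [placements x g (fam_add _ _ _) _]/= (_ : all _ _ = false) ?mulr0.
    by rewrite /= !subrr lexx/= mulr_ge0 ?exprn_ge0//; case: all.
  by apply/negbTE/allPn; exists i0 => //; rewrite /fam_add eqxx.
have -> : (placements x gt fam K.+1 - placements x g fam K.+1
      - t * placements x g (fam_add fam i0 f) K.+1 =
  g (x K) * (placements x gt fam K - placements x g fam K
      - t * placements x g (fam_add fam i0 f) K) +
  t * f (x K) * (placements x gt fam K - placements x g fam K) +
  \sum_(i <- I) \sum_(j < size (fam i)) nth zero (fam i) j (x K) *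
     (placements x gt (fam_del fam i j) K - placements x g (fam_del fam i j) K
      - t * placements x g (fam_add (fam_del fam i j) i0 f) K))%R.
  rewrite placements_add//.
  have -> : (\sum_(i <- I) \sum_(j < size (fam i)) nth zero (fam i) j (x K) *
     (placements x gt (fam_del fam i j) K - placements x g (fam_del fam i j) K
      - t * placements x g (fam_add (fam_del fam i j) i0 f) K) =
     \sum_(i <- I) \sum_(j < size (fam i)) nth zero (fam i) j (x K) *
     placements x gt (fam_del fam i j) K - \sum_(i <- I) \sum_(j < size (fam i)) nth zero (fam i) j (x K) *
     placements x g (fam_del fam i j) K - t * \sum_(i <- I) \sum_(j < size (fam i)) nth zero (fam i) j (x K) *
     placements x g (fam_add (fam_del fam i j) i0 f) K)%R.
    rewrite mulr_sumr -!sumrB; apply: eq_bigr => i _.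
    rewrite mulr_sumr -!sumrB; apply: eq_bigr => j _.
    by ring.
  by rewrite /= /gt; ring.
have /andP[a1 a2] := IH fam h.
have /andP[b1 b2] := placements_increment K h.
have pe := placements_ge0 x K ge0 h.
apply/andP; split.
  rewrite addr_ge0 ?addr_ge0 ?mulr_ge0//.
  rewrite big_seq sumr_ge0// => i iI; rewrite sumr_ge0// => j _; rewrite mulr_ge0//.
    exact: h.
  by have /andP[] := IH _ (family_all_del (ltn_ord j) h).
rewrite /= [leRHS]mulrDr; apply: lerD.
  rewrite {1}/ge; have -> : ((t / e) ^+ 2 * ((g (x K) + e * f (x K)) * placements x ge fam K) =
    g (x K) * ((t / e) ^+ 2 * placements x ge fam K) +
    t * f (x K) * (t / e * placements x ge fam K))%R.
    by field; rewrite gt_eqF.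
  by apply: lerD; rewrite ler_wpM2l// ?mulr_ge0.
rewrite mulr_sumr big_seq [leRHS]big_seq ler_sum// => i iI.
rewrite mulr_sumr ler_sum// => j _; rewrite mulrCA ler_wpM2l//; first exact: h.
by have /andP[] := IH _ (family_all_del (ltn_ord j) h).
Qed.

End Perturbation.

End Placements.

Lemma measurable_sum_in (R : realType) d (T : measurableType d) (J : eqType) (s : seq J)
    (h : J -> T -> R) : (forall i, i \in s -> measurable_fun setT (h i)) ->
  measurable_fun setT (fun x => \sum_(i <- s) h i x)%R.
Proof.
move=> mh; rewrite (_ : (fun x => _) = fun x => (\sum_(i <- s) (if i \in s then h i else cst 0) x)%R).
  by apply: measurable_sum => i; case: ifPn => // /mh.
by apply/funext => x; rewrite big_seq [RHS]big_seq; apply: eq_bigr => i ->.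
Qed.

Lemma measurable_placements (R : realType) (d d' : measure_display)
    (Omega : measurableType d) (S : measurableType d') (p : nat -> Omega -> S)
    (J : eqType) (I : seq J) (g : S -> R) (fam : J -> seq (S -> R)) K :
  (forall k, measurable_fun setT (p k)) -> measurable_fun setT g ->
  family_all I (fun=> 0%R : R) (fun f : S -> R => measurable_fun setT f) fam ->
  measurable_fun setT (fun w => placements I (p ^~ w) g fam K).
Proof.
move=> mp mg; elim: K fam => [|K IH] fam mfam /=; first exact: measurable_cst.
apply: measurable_funD.
  apply: measurable_funM; first exact: (measurableT_comp mg (mp K)).
  exact: IH.
apply: measurable_sum_in => i iI; apply: measurable_sum => j.
apply: measurable_funM.
  exact: (measurableT_comp (mfam i j iI (ltn_ord j)) (mp K)).
by apply: IH; exact: family_all_del.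
Qed.

(** * Product densities of a Poisson point process *)

Lemma expR_le_quadratic (R : realType) (x : R) : (0 <= x)%R -> (x <= 2^-1)%R ->
  (expR x <= 1 + x + 2 * x ^+ 2)%R.
Proof.
move=> x0 x2.
have h1 : (1 - x <= expR (- x))%R by exact: expR_ge1Dx.
have h2 : (expR (- x) * expR x = 1)%R by rewrite -expRD addNr expR0.
have e0 := expR_ge0 x.
have h3 : ((1 - x) * expR x <= 1)%R by rewrite -[leRHS]h2 ler_wpM2r.
have h4 : (1 <= (1 - x) * (1 + x + 2 * x ^+ 2))%R by nra.
have h5 : (0 < 1 - x)%R by lra.
by rewrite -(ler_pM2l h5) (le_trans h3).
Qed.

(** Up to an error that is quadratic in [t] uniformly in [K], [b K] is the
derivative at 0 of [a ^~ K]. Limit and derivative may thus be exchanged, and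
[alpha * m] is the derivative at 0 of the limit. *)
Lemma derivative_squeeze (R : realType) (a : R -> nat -> R) (b : nat -> R) (alpha m e : R) :
  (0 < e)%R -> (0 <= m)%R -> (0 <= alpha)%R ->
  (forall t, (0 <= t <= e)%R -> a t K @[K --> \oo] --> (alpha * expR (t * m))%R) ->
  (forall t K, (0 < t <= e)%R ->
     (0 <= a t K - a 0 K - t * b K <= (t / e) ^+ 2 * a e K)%R) ->
  b K @[K --> \oo] --> (alpha * m)%R.
Proof.
move=> e0 m0 al0 ha hb; apply/cvgrPdist_le => eps eps0.
pose E := (alpha * expR (e * m) + 1)%R.
have E0 : (0 < E)%R by rewrite ltr_wpDl// mulr_ge0// expR_ge0.
pose Q := (2 * alpha * m ^+ 2 + E / e ^+ 2 + 1)%R.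
have Ee0 : (0 < E / e ^+ 2)%R by rewrite divr_gt0// exprn_gt0.
have Q0 : (0 < Q)%R.
  have : (0 <= 2 * alpha * m ^+ 2)%R by rewrite !mulr_ge0// exprn_ge0.
  by rewrite /Q; lra.
(* [t] is small enough for the quadratic errors in [t], of total coefficient at
   most [Q], to be at most half of [eps * t]. *)
pose t := Num.min e (Num.min (2 * (m + 1))^-1 (eps / (2 * Q)))%R.
have t0 : (0 < t)%R.
  by rewrite /t !lt_min e0 invr_gt0 divr_gt0//= mulr_gt0// ltr_wpDl.
have te : (t <= e)%R by rewrite /t ge_min lexx.
have tm : (t * m <= 2^-1)%R.
  have : (t <= (2 * (m + 1))^-1)%R by rewrite /t !ge_min lexx !orbT.
  move=> /(ler_wpM2r m0) /le_trans; apply.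
  by rewrite ler_pdivrMl ?mulr_gt0 ?ltr_wpDl//; lra.
have tQ : (t * Q <= eps / 2)%R.
  have : (t <= eps / (2 * Q))%R by rewrite /t !ge_min lexx !orbT.
  move=> /(ler_wpM2r (ltW Q0)) /le_trans; apply.
  by rewrite le_eqVlt; apply/orP; left; apply/eqP; field; rewrite gt_eqF.
pose eta := (t * eps / 4)%R.
have eta0 : (0 < eta)%R by rewrite /eta divr_gt0// mulr_gt0.
have tin : (0 <= t <= e)%R by rewrite ltW.
have zin : (0 <= (0 : R) <= e)%R by rewrite lexx ltW.
have ein : (0 <= e <= e)%R by rewrite lexx ltW.
have /cvgrPdist_le /(_ _ eta0) nt := ha t tin.
have /cvgrPdist_le /(_ _ eta0) n0 := ha 0%R zin.
have /cvgrPdist_le /(_ _ ltr01) ne := ha e ein.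
have tm0 : (0 <= t * m)%R by rewrite mulr_ge0// ltW.
have up := expR_le_quadratic tm0 tm.
have lo : (1 + t * m <= expR (t * m))%R by exact: expR_ge1Dx.
near=> K.
have : (`|alpha * expR (t * m) - a t K| <= eta)%R by near: K.
have : (`|alpha * expR (0 * m) - a 0 K| <= eta)%R by near: K.
have : (`|alpha * expR (e * m) - a e K| <= 1)%R by near: K.
rewrite mul0r expR0 mulr1 !ler_distl => /andP[ae _] /andP[b1 b2] /andP[c1 c2].
have /andP[d1 d2] := hb t K (introT andP (conj t0 te)).
have aeE : (a e K <= E)%R by rewrite /E; lra.
have r0 : (0 <= (t / e) ^+ 2)%R by rewrite exprn_ge0// divr_ge0// ltW.
have d3 : ((t / e) ^+ 2 * a e K <= t * (t * (E / e ^+ 2)))%R.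
  rewrite (_ : (t * (t * (E / e ^+ 2)))%R = ((t / e) ^+ 2 * E)%R); last by field; rewrite gt_eqF.
  by rewrite ler_wpM2l.
have tQ' : (t * (2 * alpha * m ^+ 2) + t * (E / e ^+ 2) + t <= eps / 2)%R.
  by move: tQ; rewrite /Q !mulrDr mulr1.
have x1 : (0 <= t * (2 * alpha * m ^+ 2))%R by rewrite !mulr_ge0// ?exprn_ge0// ltW.
have x2 : (0 <= t * (E / e ^+ 2))%R by rewrite mulr_ge0// ltW.
have y1 : (t * (t * (2 * alpha * m ^+ 2)) <= t * (eps / 2))%R by rewrite ler_pM2l//; lra.
have y2 : (t * (t * (E / e ^+ 2)) <= t * (eps / 2))%R by rewrite ler_pM2l//; lra.
have aup : (alpha * expR (t * m) <= alpha * (1 + t * m + 2 * (t * m) ^+ 2))%R by rewrite ler_wpM2l.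
have alo : (alpha * (1 + t * m) <= alpha * expR (t * m))%R by rewrite ler_wpM2l.
rewrite -(ler_pM2l t0) -[X in _ && X](ler_pM2l t0).
rewrite /eta in b1 b2 c1 c2 *; apply/andP; split; nra.
Unshelve. all: by end_near. Qed.

Section PlacementLimit.
Context (R : realType) (d d' : measure_display) (Omega : measurableType d)
  (S : measurableType d') (P : probability Omega R)
  (mu : {measure set S -> \bar R}) (p : nat -> Omega -> S).
Hypothesis ppp : poisson_point_process P mu p.
Context (J : eqType) (I : seq J) (uI : uniq I).
Implicit Types (g f : S -> R) (fam : J -> seq (S -> R)).

Let mp k : measurable_fun setT (p k). Proof. by have [] := ppp. Qed.

Notation zero := (fun=> 0%R : R).
Notation mfun := (fun f : S -> R => measurable_fun setT f).

Definition mean f : R := fine (\int[mu]_x (f x)%:E).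

Definition placement_limit g fam : R :=
  ((\prod_(i <- I) \prod_(j < size (fam i)) mean (nth zero (fam i) j)) *
   expR (- mean (fun x => 1 - g x)))%R.

Lemma placement_limit_add g f i fam : i \in I ->
  placement_limit g (fam_add fam i f) = (placement_limit g fam * mean f)%R.
Proof.
move=> iI; rewrite /placement_limit mulrAC; congr (_ * _)%R.
rewrite !(bigD1_seq i)//=; have -> : fam_add fam i f i = f :: fam i by rewrite /fam_add eqxx.
rewrite big_ord_recl /= -!mulrA mulrC -!mulrA; congr (_ * _)%R.
congr (_ * _)%R; apply: eq_bigr => i' ii.
by have -> : fam_add fam i f i' = fam i' by rewrite /fam_add (negbTE ii).
Qed.

(** The bound by [1 - g] leaves room for [g + t f] to stay below 1 when [t] is small;
it also makes the factors integrable. *)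
Definition dominated g (C : R) fam :=
  family_all I zero (fun f => measurable_fun setT f /\
    forall s, (0 <= f s <= C * (1 - g s))%R) fam.

(** Induction on the number of factors. Without factors, the placement sum is the
product of [g] over the points, and this is the Laplace functional of [1 - g]. A
factor [f] is obtained from the statement for [g + t f] and one factor less, by
differentiating at [t = 0]: the limit then is multiplied by the mean of [f]. *)
Theorem cvg_placements g (C : R) fam : (0 <= C)%R ->
  measurable_fun setT g -> (forall s, 0 <= g s <= 1)%R ->
  \int[mu]_x (1 - g x)%:E < +oo -> dominated g C fam ->
  fine (\int[P]_w (placements I (p ^~ w) g fam K)%:E) @[K --> \oo] -->
    placement_limit g fam.
Proof.
have [n] := ubnP (total_size I fam).
elim: n => // n IHn in g C fam *; rewrite ltnS => sz C0 mg g01 gfin dfam.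
have p1g x : (0 <= 1 - g x <= 1)%R by have /andP[a b] := g01 x; rewrite subr_ge0 b gerBl.
have [all0|] := boolP (all (fun i => nilp (fam i)) I).
  have nil0 i : i \in I -> fam i = [::] by move=> /(allP all0) /nilP.
  have placeE K w : placements I (p ^~ w) g fam K = (\prod_(k < K) (1 - (1 - g (p k w))))%R.
    elim: K => [|K IH] /=; first by rewrite all0 big_ord0.
    rewrite big_ord_recr /= IH subKr mulrC.
    rewrite [X in (_ + X)%R]big_seq [X in (_ + X)%R]big1 ?addr0// => i iI.
    by rewrite nil0// big_ord0.
  rewrite /placement_limit big_seq big1 ?mul1r; last by move=> i /nil0 ->; rewrite big_ord0.
  apply: fine_cvg; under eq_cvg do under eq_integral do rewrite placeE.
  apply: (@laplace_functional _ _ _ _ _ P mu p ppp (fun x => 1 - g x)%R) => //.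
  exact: measurable_funB.
move=> /allPn[i0 i0I].
case fE : (fam i0) => [//|f fs] _.
pose fam' i := if i == i0 then fs else fam i.
have famE : fam = fam_add fam' i0 f.
  by apply/funext => i; rewrite /fam_add /fam'; case: eqP => [->|].
have sz' : (total_size I fam' < n)%N.
  suff -> : (total_size I fam').+1 = total_size I fam by [].
  rewrite famE /total_size !(bigD1_seq i0)//= -addSn; congr (_ + _)%N.
    by rewrite /fam_add eqxx.
  by apply: eq_bigr => i ii; rewrite /fam_add (negbTE ii).
have dfam' : dominated g C fam'.
  move=> i j iI; rewrite /fam'; case: eqP => [_|_] js; last exact: dfam.
  by have := dfam i0 j.+1 i0I; rewrite fE; exact.
have [mf fC] : measurable_fun setT f /\ forall s, (0 <= f s <= C * (1 - g s))%R.
  by have := dfam i0 0%N i0I; rewrite fE; exact.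
have f0 : nonneg f by move=> s; case/andP: (fC s).
have g0 : nonneg g by move=> s; case/andP: (g01 s).
have m1g : measurable_fun setT (fun x => (1 - g x)%:E).
  by apply/measurable_EFinP; exact: measurable_funB.
have ffin : \int[mu]_x (f x)%:E < +oo.
  apply: (@le_lt_trans _ _ (\int[mu]_x (C%:E * (1 - g x)%:E))).
    apply: ge0_le_integral => //.
    - by move=> x _; rewrite lee_fin.
    - exact/measurable_EFinP.
    - exact: measurable_funeM.
    - by move=> x _; rewrite -EFinM lee_fin; case/andP: (fC x).
  rewrite ge0_integralZl//.
  - by rewrite lte_mul_pinfty.
  - by move=> x _; rewrite lee_fin; case/andP: (p1g x).
(* With this bound on [t] the factor costs at most half of the room left by [g], so
   that the remaining factors are dominated with [2 * C] in place of [C]. *)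
pose e := ((2 * (C + 1))^-1)%R.
have C10 : (0 < 2 * (C + 1))%R by lra.
have e0 : (0 < e)%R by rewrite /e invr_gt0.
have eC : (e * C <= 2^-1)%R.
  by rewrite /e ler_pdivrMl//; lra.
pose gt (t : R) s := (g s + t * f s)%R.
have half t s : (0 <= t <= e)%R -> (t * f s <= 2^-1 * (1 - g s))%R.
  move=> /andP[t0 te]; have /andP[_ fc] := fC s.
  apply: (@le_trans _ _ (e * (C * (1 - g s))))%R; first by apply: ler_pM.
  by rewrite mulrA ler_wpM2r//; case/andP: (p1g s).
have gt01 t s : (0 <= t <= e)%R -> (0 <= gt t s <= 1)%R.
  move=> te; have := half t s te; have /andP[t0 _] := te; have /andP[a b] := p1g s.
  rewrite /gt addr_ge0 ?mulr_ge0//= => ?; lra.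
have mgt t : measurable_fun setT (gt t).
  by apply: measurable_funD => //; exact: measurable_funM.
have dgt t : (0 <= t <= e)%R -> dominated (gt t) (2 * C) fam'.
  move=> te i j iI js; have [mij hij] := dfam' i j iI js; split => // s.
  have /andP[-> /= h] := hij s; apply: (le_trans h); have := half t s te.
  rewrite /gt => hh; rewrite -mulrA mulrCA ler_wpM2l//; lra.
have mgt1 t : measurable_fun setT (fun x => (1 - gt t x)%:E).
  by apply/measurable_EFinP; exact: measurable_funB.
have split_mean t : (0 <= t <= e)%R ->
    \int[mu]_x (1 - g x)%:E = \int[mu]_x (1 - gt t x)%:E + t%:E * \int[mu]_x (f x)%:E.
  move=> te; have /andP[t0 _] := te.
  rewrite -ge0_integralZl//; last 2 first.
  - exact/measurable_EFinP.
  - by move=> x _; rewrite lee_fin.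
  rewrite -ge0_integralD//.
  - by apply: eq_integral => x _; rewrite -EFinM -EFinD /gt; congr EFin; ring.
  - by move=> x _; rewrite lee_fin subr_ge0; case/andP: (gt01 t x te).
  - by move=> x _; rewrite -EFinM lee_fin mulr_ge0.
  - by apply: measurable_funeM; exact/measurable_EFinP.
have gtfin t : (0 <= t <= e)%R -> \int[mu]_x (1 - gt t x)%:E < +oo.
  move=> te; have /andP[t0 _] := te; apply: le_lt_trans gfin; rewrite (split_mean t te) leeDl//.
  by rewrite mule_ge0 ?lee_fin// integral_ge0// => x _; rewrite lee_fin.
have int_gt0 t : (0 <= t <= e)%R -> 0 <= \int[mu]_x (1 - gt t x)%:E.
  by move=> te; apply: integral_ge0 => x _; rewrite lee_fin subr_ge0; case/andP: (gt01 t x te).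
have int_f0 : 0 <= \int[mu]_x (f x)%:E by apply: integral_ge0 => x _; rewrite lee_fin.
have meanE t : (0 <= t <= e)%R ->
    mean (fun x => 1 - g x)%R = (mean (fun x => 1 - gt t x) + t * mean f)%R.
  move=> te; rewrite /mean (split_mean t te) fineD ?fineM//.
  - by rewrite ge0_fin_numE.
  - by rewrite ge0_fin_numE; [exact: gtfin|exact: int_gt0].
  - by rewrite fin_numM// ge0_fin_numE.
have limE t : (0 <= t <= e)%R ->
    placement_limit (gt t) fam' = (placement_limit g fam' * expR (t * mean f))%R.
  by move=> te; rewrite /placement_limit (meanE t te) -!mulrA -expRD; congr (_ * expR _)%R; ring.
have nn' : family_all I zero (@nonneg R S) fam'.
  by move=> i j iI js s; have [_ /(_ s) /andP[]] := dfam' i j iI js.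
have nn : family_all I zero (@nonneg R S) fam.
  by move=> i j iI js s; have [_ /(_ s) /andP[]] := dfam i j iI js.
have mm' : family_all I zero mfun fam' by move=> i j iI js; have [] := dfam' i j iI js.
have mm : family_all I zero mfun fam by move=> i j iI js; have [] := dfam i j iI js.
have bounded_int (h : S -> R) fm K : measurable_fun setT h -> (forall s, 0 <= h s <= 1)%R ->
    family_all I zero mfun fm -> family_all I zero (fun f => forall s, 0 <= f s <= C)%R fm ->
    P.-integrable setT (EFin \o (fun w => placements I (p ^~ w) h fm K)).
  move=> mh h01 mfm bfm.
  have h0 : nonneg h by move=> s; case/andP: (h01 s).
  have h1 s : (h s <= 1)%R by case/andP: (h01 s).
  have nfm : family_all I zero (@nonneg R S) fm by move=> i j iI js s; case/andP: (bfm i j iI js s).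
  apply: measurable_bounded_integrable => //.
  - by apply: (@le_lt_trans _ _ 1); [exact: probability_le1|exact: ltry].
  - by apply: measurable_placements; [exact: mp| |].
  - exists ((1 + C * (total_size I fm)%:R) ^+ K)%R; split; first exact: num_real.
    move=> M /ltW hM w _ /=; rewrite ger0_norm; last exact: placements_ge0.
    by apply: le_trans hM; exact: placements_bound.
have bfam : family_all I zero (fun f => forall s, 0 <= f s <= C)%R fam.
  move=> i j iI js s; have [_ /(_ s) /andP[-> /= h]] := dfam i j iI js.
  by apply: (le_trans h); rewrite ler_piMr//; case/andP: (p1g s).
have bfam' : family_all I zero (fun f => forall s, 0 <= f s <= C)%R fam'.
  move=> i j iI js s; have [_ /(_ s) /andP[-> /= h]] := dfam' i j iI js.
  by apply: (le_trans h); rewrite ler_piMr//; case/andP: (p1g s).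
rewrite famE placement_limit_add//.
apply: (@derivative_squeeze _ (fun t K => \int[P]_(w in setT) placements I (p ^~ w) (gt t) fam' K)%R _ _ _ e).
- exact: e0.
- exact: fine_ge0.
- rewrite /placement_limit mulr_ge0 ?expR_ge0// big_seq prodr_ge0// => i iI.
  rewrite prodr_ge0// => j _; rewrite fine_ge0// integral_ge0// => x _.
  by rewrite lee_fin; exact: nn'.
- move=> t te; rewrite -limE//; apply: (IHn (gt t) (2 * C)%R) => //.
  + by rewrite mulr_ge0.
  + by move=> s; exact: gt01.
  + exact: gtfin.
  + exact: dgt.
- move=> t K /andP[t0 te].
  have tin : (0 <= t <= e)%R by rewrite ltW.
  have ein : (0 <= e <= e)%R by rewrite lexx ltW.
  have g0E : gt 0%R = g by apply/funext => s; rewrite /gt mul0r addr0.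
  rewrite g0E -famE.
  have i1 := bounded_int (gt t) fam' K (mgt t) (fun s => gt01 t s tin) mm' bfam'.
  have i2 := bounded_int g fam' K mg g01 mm' bfam'.
  have i3 := bounded_int g fam K mg g01 mm bfam.
  have i4 := bounded_int (gt e) fam' K (mgt e) (fun s => gt01 e s ein) mm' bfam'.
  have := fun w => @placements_expansion _ _ _ I uI (p ^~ w) g f i0 t e i0I g0 f0 (ltW t0) te e0 fam' K nn'.
  rewrite -famE => hw.
  rewrite -/(Rintegral _ _ _).
  have E1 : (\int[P]_(w in setT) (placements I (p ^~ w) (gt t) fam' K -
      placements I (p ^~ w) g fam' K - t * placements I (p ^~ w) g fam K) =
    \int[P]_(w in setT) placements I (p ^~ w) (gt t) fam' K -
    \int[P]_(w in setT) placements I (p ^~ w) g fam' K -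
    t * \int[P]_(w in setT) placements I (p ^~ w) g fam K)%R.
    rewrite RintegralB//; last 2 first.
    - by have := integrableB measurableT i1 i2; apply: eq_integrable.
    - by have := integrableZl measurableT t i3; apply: eq_integrable.
    by rewrite RintegralB// RintegralZl.
  have E2 : (\int[P]_(w in setT) ((t / e) ^+ 2 * placements I (p ^~ w) (gt e) fam' K) =
     (t / e) ^+ 2 * \int[P]_(w in setT) placements I (p ^~ w) (gt e) fam' K)%R.
    by rewrite RintegralZl.
  rewrite -E1 -E2; apply/andP; split.
    by apply: Rintegral_ge0 => w _; case/andP: (hw w).
  apply: le_Rintegral => //.
  + have h1 := integrableB measurableT i1 i2.
    have h2 := integrableZl measurableT t i3.
    by have := integrableB measurableT h1 h2; apply: eq_integrable.
  + by have := integrableZl measurableT ((t / e) ^+ 2)%R i4; apply: eq_integrable.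
  + by move=> w _; case/andP: (hw w).
Qed.

End PlacementLimit.

(** * Listing the points of each class in a random order *)

Definition insert (T : Type) (v : nat) (k : T) (l : seq T) := take v l ++ k :: drop v l.

Lemma size_insert (T : Type) v (k : T) l : size (insert v k l) = (size l).+1.
Proof. by rewrite size_cat /= addnS -size_cat cat_take_drop. Qed.

Lemma nth_insert (T : Type) (x0 : T) v k l t : (v <= size l)%N ->
  nth x0 (insert v k l) t =
    if (t < v)%N then nth x0 l t else if t == v then k else nth x0 l t.-1.
Proof.
move=> vl; rewrite nth_cat size_takel//; case: ltngtP => [tv|vt|->].
- by rewrite nth_take.
- case: t vt => // t; rewrite ltnS => vt.
  by rewrite subSn//= nth_drop subnKC.
- by rewrite subnn.
Qed.

Section Arrangement.
Context (R : realType) (d d' : measure_display) (W : measurableType d)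
  (S : measurableType d') (P : probability W R) (p : nat -> W -> S)
  (J : choiceType) (L : J -> nat -> set W) (V : nat * nat -> W -> nat) (pi : J -> S -> R).
Hypothesis mp : forall k, measurable_fun setT (p k).
Hypothesis mL : forall i k, measurable (L i k).
Hypothesis L_inj : forall i i' k w, L i k w -> L i' k w -> i = i'.
Hypothesis mV : forall c v, measurable [set w | V c w = v].
Hypothesis VP : forall c w, (V c w <= c.2)%N.
Hypothesis mpi : forall i, measurable_fun setT (pi i).
Hypothesis pi_ge0 : forall i s, (0 <= pi i s)%R.
Hypothesis pi_sum : forall I s, uniq I -> (\sum_(i <- I) pi i s <= 1)%R.

Definition atoms : set (set W) := <<s \bigcup_k events_of (p k) >>.

Definition future (s : seq (nat * J)) (u : seq (nat * nat * nat)) : set W :=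
  [set w | (forall x, x \in s -> L x.2 x.1 w) /\ (forall y, y \in u -> V y.1 w = y.2)].

Definition future_weight (s : seq (nat * J)) (u : seq (nat * nat * nat)) (w : W) : R :=
  ((\prod_(x <- s) pi x.2 (p x.1 w)) * \prod_(y <- u) y.1.2.+1%:R^-1)%R.

(* Given the points, the classes of different points are independent, a point at [s]
   belonging to class [i] with probability [pi i s]; the positions are independent of
   points and classes and of each other, [V (k, m)] being uniform on {0, ..., m}. *)
Hypothesis conditional_law : forall E s u, atoms E ->
  uniq (map fst s) -> uniq (map fst u) -> (forall y, y \in u -> (y.2 <= y.1.2)%N) ->
  P (E `&` future s u) = \int[P]_(w in E) (future_weight s u w)%:E.

(** The points of class [i] among the first [K]. The enumeration of the process may
depend on the points, for instance by listing them in increasing order, so that the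
points of a class need not be exchangeable in their order of appearance. Inserting
each new point at a uniform position makes their order uniform. *)
Fixpoint arrange (i : J) (K : nat) (w : W) : seq nat :=
  if K is K'.+1 then
    let l := arrange i K' w in
    if pselect (L i K' w) then insert (V (K', size l) w) K' l else l
  else [::].

Lemma measurable_arrange i K l : measurable [set w | arrange i K w = l].
Proof.
elim: K l => [|K IH] l.
  exact: (@measurable_prop _ _ ([::] = l)).
pose A l' := (L i K `&` [set w | insert (V (K, size l') w) K l' = l]) `|`
  (~` L i K `&` [set w | l' = l]).
rewrite (_ : mkset _ = [set w | A (arrange i K w) w]).
  apply: (measurable_glue (f := arrange i K)) => // l'; apply: measurableU.
    apply: measurableI => //.
    apply: (@measurable_glue _ _ nat (V (K, size l')) (fun v => [set w | insert v K l' = l])) => // v.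
    exact: measurable_prop.
  apply: measurableI; first exact: measurableC.
  exact: measurable_prop.
apply/seteqP; split => w /=; rewrite /A /=; case: pselect => /= Lw.
- by left.
- by right.
- by move=> [[]|[]].
- by move=> [[]|[]].
Qed.

Definition matches i (C : seq (set S)) K w :=
  size (arrange i K w) = size C /\
  forall j, (j < size C)%N -> nth set0 C j (p (nth 0%N (arrange i K w) j) w).

Lemma measurable_matches i C K : (forall j, measurable (nth set0 C j)) ->
  measurable (matches i C K).
Proof. by move=> mC; apply: measurable_listed => // l; exact: measurable_arrange. Qed.

Lemma matches_skip i C K w : ~ L i K w -> matches i C K.+1 w <-> matches i C K w.
Proof. by move=> nL; rewrite /matches /=; case: pselect. Qed.

(** The last point sits at some place [j] of the list; deleting both leaves a list
that matches the pattern without its entry [j]. *)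
Lemma matches_step i C K w : L i K w ->
  matches i C K.+1 w <-> exists2 j, (j < size C)%N &
    [/\ V (K, (size C).-1) w = j, nth set0 C j (p K w) & matches i (rem_at C j) K w].
Proof.
move=> Lw; rewrite /matches /=; case: pselect => // Lw'; set l := arrange i K w.
have vl := VP (K, size l) w; rewrite /= in vl.
split => [[sz h]|[j jC [Vj Cj [sz h]]]].
  rewrite size_insert in sz; have jC : (V (K, size l) w < size C)%N by rewrite -sz ltnS.
  exists (V (K, size l) w) => //; split.
  - by rewrite -sz.
  - by have := h _ jC; rewrite nth_insert// ltnn eqxx.
  - rewrite size_rem_at// -sz; split => // t tl; rewrite nth_rem_at//.
    have := h (if (t < V (K, size l) w)%N then t else t.+1).
    rewrite nth_insert//; case: (ltnP t) => tv.
      by rewrite tv; apply; rewrite (ltn_trans tv).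
    have -> : (t.+1 < V (K, size l) w)%N = false by rewrite ltnNge (leqW tv).
    have -> : (t.+1 == V (K, size l) w) = false by rewrite gtn_eqF ?ltnS.
    apply.
    by rewrite -sz ltnS.
rewrite size_rem_at// in sz h; rewrite -sz in Vj.
have szC : (size l).+1 = size C by rewrite sz prednK// (leq_ltn_trans _ jC).
rewrite size_insert; split => // t tC; rewrite nth_insert//.
rewrite Vj; case: ltngtP => [tj|jt|->//].
- have := h t; rewrite nth_rem_at// tj; apply.
  by rewrite -sz (leq_trans tj)// -ltnS szC.
- case: t tC jt => // t tC; rewrite ltnS => jt /=.
  have := h t; rewrite nth_rem_at//; have -> : (t < j)%N = false by rewrite ltnNge jt.
  apply.
  by rewrite -sz -ltnS szC.
Qed.

Section Law.
Variables (I : seq J).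
Hypothesis uI : uniq I.

Definition matches_all (B : J -> seq (set S)) K : set W :=
  [set w | forall i, i \in I -> matches i (B i) K w].

Definition other_weight (s : S) : R := (1 - \sum_(i <- I) pi i s)%R.

Definition pattern_family (B : J -> seq (set S)) : J -> seq (S -> R) :=
  fun i => [seq (fun s => pi i s * \1_C s)%R | C <- B i].

(** The conditional probability, given the points, that the lists match the pattern
after [K] points: the [size (B i)] entries of class [i] are taken by different points
of class [i] in the prescribed sets, the other points belong to no class of [I], and
all orders within a list are equally likely. *)
Definition pattern_weight (B : J -> seq (set S)) K w : R :=
  (placements I (p ^~ w) other_weight (pattern_family B) K /
   \prod_(i <- I) (size (B i))`!%:R)%R.

Definition measurable_pattern (B : J -> seq (set S)) :=
  forall i j, measurable (nth set0 (B i) j).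

Lemma measurable_pattern_del B i j : (j < size (B i))%N ->
  measurable_pattern B -> measurable_pattern (fam_del B i j).
Proof.
move=> ji mB i' j'; rewrite /fam_del; case: eqP => [->|_]; last exact: mB.
by rewrite nth_rem_at//; case: ifP.
Qed.

Lemma measurable_matches_all B K : measurable_pattern B -> measurable (matches_all B K).
Proof.
by move=> mB; apply: measurable_forall_in => i; exact: measurable_matches.
Qed.

Lemma other_weight01 s : (0 <= other_weight s <= 1)%R.
Proof.
by rewrite /other_weight subr_ge0 pi_sum// gerBl sumr_ge0.
Qed.

Lemma measurable_other_weight : measurable_fun setT other_weight.
Proof. by apply: measurable_funB => //; exact: measurable_sum. Qed.

Lemma pattern_familyE B i j s : (j < size (B i))%N ->
  nth (fun=> 0%R) (pattern_family B i) j s = (pi i s * \1_(nth set0 (B i) j) s)%R.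
Proof. by move=> ji; rewrite (nth_map set0). Qed.

Lemma pattern_family_del B i j :
  pattern_family (fam_del B i j) = fam_del (pattern_family B) i j.
Proof.
apply/funext => i'; rewrite /pattern_family /fam_del; case: eqP => // _.
by rewrite map_rem_at.
Qed.

Lemma pattern_weight_ge0 B K w : (0 <= pattern_weight B K w)%R.
Proof.
rewrite divr_ge0 ?prodr_ge0//; apply: placements_ge0 => //.
  by move=> s; case/andP: (other_weight01 s).
move=> i j iI; rewrite size_map => ji s.
by rewrite pattern_familyE// mulr_ge0.
Qed.

(** The recursion of [placements] for the last point. The probability that this
point belongs to no class of [I] is a difference; the terms are moved so that the
identity contains sums only, as it will be compared with one of probabilities. *)
Lemma pattern_weightS B K w :
  (pattern_weight B K.+1 w + \sum_(i <- I) pi i (p K w) * pattern_weight B K w =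
   pattern_weight B K w +
   \sum_(i <- I) \sum_(j < size (B i)) pi i (p K w) * \1_(nth set0 (B i) j) (p K w) *
     (size (B i))%:R^-1 * pattern_weight (fam_del B i j) K w)%R.
Proof.
have -> : (\sum_(i <- I) \sum_(j < size (B i)) pi i (p K w) * \1_(nth set0 (B i) j) (p K w) *
     (size (B i))%:R^-1 * pattern_weight (fam_del B i j) K w =
  (\sum_(i <- I) \sum_(j < size (pattern_family B i))
     nth (fun=> 0) (pattern_family B i) j (p K w) *
     placements I (p ^~ w) other_weight (fam_del (pattern_family B) i j) K) /
     \prod_(i <- I) (size (B i))`!%:R)%R.
  rewrite mulr_suml; apply: eq_big_seq => i iI.
  rewrite size_map mulr_suml; apply: eq_bigr => j _.
  rewrite pattern_familyE// /pattern_weight pattern_family_del -!mulrA; congr (_ * (_ * _))%R.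
  rewrite mulrCA; congr (_ * _)%R.
  rewrite !(bigD1_seq i)//= invfM mulrA invfM; congr (_ * _)%R; last first.
    by congr (_^-1)%R; apply: eq_bigr => i' ii; rewrite /fam_del (negbTE ii).
  rewrite -invfM -natrM; congr (_%:R^-1)%R.
  rewrite /fam_del eqxx size_rem_at//.
  by rewrite -[in RHS](ltn_predK (ltn_ord j)) factS (ltn_predK (ltn_ord j)).
rewrite -mulr_suml {1}/pattern_weight [placements _ _ _ _ _.+1]/= mulrDl addrAC; congr (_ + _)%R.
rewrite -mulrA -/(pattern_weight B K w) -mulrDl /other_weight subrK mul1r.
by [].
Qed.

Lemma measurable_pattern_weight B K : measurable_pattern B ->
  measurable_fun setT (pattern_weight B K).
Proof.
move=> mB; apply: measurable_funM => //; apply: measurable_placements => //.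
  exact: measurable_other_weight.
move=> i j iI; rewrite size_map => ji.
rewrite (_ : nth _ _ _ = fun s => pi i s * \1_(nth set0 (B i) j) s)%R.
  by apply: measurable_funM => //; exact: measurable_indic.
by apply/funext => s; exact: pattern_familyE.
Qed.

Lemma future_weight_ge0 s u w : (0 <= future_weight s u w)%R.
Proof. by rewrite mulr_ge0// prodr_ge0. Qed.

Lemma measurable_future_weight s u : measurable_fun setT (future_weight s u).
Proof.
apply: measurable_funM => //; apply: measurable_prod => x _.
exact: (measurableT_comp (mpi x.2) (mp x.1)).
Qed.

Lemma measurable_future s u : measurable (future s u).
Proof.
apply: measurableI; first by apply: (@measurable_forall_in _ _ _ s (fun x => L x.2 x.1)) => x.
exact: (@measurable_forall_in _ _ _ u (fun y => [set w | V y.1 w = y.2])).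
Qed.

Lemma atoms_measurable E : atoms E -> measurable E.
Proof.
apply: smallest_sub; first exact: sigma_algebra_measurable.
by move=> _ [k _ [C mC <-]]; exact: mp.
Qed.

Lemma atoms_setI_point E k C : atoms E -> measurable C -> atoms (E `&` (p k @^-1` C)).
Proof.
move=> aE mC.
apply: (@measurableI _ (g_sigma_algebraType (\bigcup_k events_of (p k)))) => //.
by apply: sub_sigma_algebra; exists k => //; exists C; rewrite ?setTI.
Qed.

Lemma measure_label_partition K (A : set W) : measurable A ->
  P A = P (A `&` [set w | forall i, i \in I -> ~ L i K w]) + \sum_(i <- I) P (A `&` L i K).
Proof.
move=> mA; elim: I uI => [_|i I' IH] /=.
  rewrite big_nil adde0; congr (P _); apply/seteqP; split => w; first by split.
  by case.
move=> /andP[iI' uI']; rewrite big_cons (IH uI') addeA; congr (_ + _).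
have mN : measurable [set w | forall i, i \in I' -> ~ L i K w].
  by apply: (@measurable_forall_in _ _ _ I' (fun i => ~` L i K)) => ?; exact: measurableC.
rewrite -measureU.
- congr (P _); apply/seteqP; split => w.
    move=> [Aw nL]; have [Lw|nLw] := pselect (L i K w); [by right|left].
    by split => // i'; rewrite inE => /predU1P[->|/nL].
  move=> [[Aw nL]|[Aw Lw]]; split => //.
    by move=> i' i'I; apply: nL; rewrite inE i'I orbT.
  move=> i' i'I L'w; have ii := L_inj Lw L'w; by rewrite ii i'I in iI'.
- apply: measurableI => //; rewrite (_ : mkset _ = ~` L i K `&` [set w | forall i, i \in I' -> ~ L i K w]).
    by apply: measurableI => //; exact: measurableC.
  apply/seteqP; split => w /= h.
    by split => [|i' i'I]; apply: h; rewrite inE ?eqxx ?i'I ?orbT.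
  by move=> i'; rewrite inE => /predU1P[->|]; [exact: h.1|exact: h.2].
- exact: measurableI.
- by apply/seteqP; split => // w [[_ nL] [_]]; apply: nL; rewrite inE eqxx.
Qed.

Lemma matches_all_step B K i w : i \in I -> L i K w ->
  matches_all B K.+1 w <-> exists2 j, (j < size (B i))%N &
    [/\ V (K, (size (B i)).-1) w = j, nth set0 (B i) j (p K w) &
        matches_all (fam_del B i j) K w].
Proof.
move=> iI Lw; split => [h|[j ji [Vj Bj h]] i' i'I].
  have /(matches_step _ Lw)[j ji [Vj Bj mj]] := h i iI.
  exists j => //; split => // i' i'I; rewrite /fam_del; case: eqP => [->//|ne].
  have nL : ~ L i' K w by move=> L'w; apply: ne; exact: L_inj L'w Lw.
  by apply: (proj1 (@matches_skip i' (B i') K w nL)); exact: h.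
have := h i' i'I; rewrite /fam_del; case: eqP => [->|ne] hi.
  by apply/(matches_step _ Lw); exists j.
have nL : ~ L i' K w by move=> L'w; apply: ne; exact: L_inj L'w Lw.
exact: (proj2 (@matches_skip i' (B i') K w nL)).
Qed.

(** Induction on [K], for all patterns at once and with arbitrary conditions on the
classes and positions of the points from [K] on, which become available one by one.
When point [K] is revealed, it belongs to a class [i] of [I] and is inserted at some
place [j], or the lists do not change. The event of the second case is the same for
[K] and [K + 1], so that it cancels when both probabilities are split by the class
of point [K]; the conditional law then is only needed for events that prescribe a
class. *)
Theorem arrangement_law K : forall B E s u, measurable_pattern B -> atoms E ->
  uniq (map fst s) -> uniq (map fst u) -> (forall y, y \in u -> (y.2 <= y.1.2)%N) ->
  (forall x, x \in s -> (K <= x.1)%N) -> (forall y, y \in u -> (K <= y.1.1)%N) ->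
  P (E `&` future s u `&` matches_all B K) =
  \int[P]_(w in E) (future_weight s u w * pattern_weight B K w)%:E.
Proof.
elim: K => [|K IH] B E s u mB aE us uu hu sK uK.
  have [all0|] := boolP (all (fun i => nilp (B i)) I).
    rewrite (_ : matches_all B 0 = setT) ?setIT; last first.
      apply/seteqP; split => // w _ i iI; have /nilP -> := allP all0 i iI.
      by split.
    rewrite conditional_law//; apply: eq_integral => w _.
    rewrite /pattern_weight /= (_ : all _ _ = true).
      rewrite big_seq big1 ?divr1 ?mulr1// => i /(allP all0) /nilP ->.
      by rewrite fact0.
    by rewrite -[RHS]all0; apply: eq_all => i; rewrite /nilp size_map.
  move=> nall; have /allPn[i iI ni] := nall.
  rewrite (_ : _ `&` _ = set0) ?measure0; last first.
    apply/seteqP; split => // w [_ /(_ i iI)[]] /= /esym sz _.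
    by move: ni; rewrite /nilp sz.
  apply/esym/integral0_eq => w _; rewrite /pattern_weight /= (_ : all _ _ = false) ?mul0r ?mulr0//.
  apply/negbTE; apply: contra nall; rewrite (eq_all (a2 := fun i => nilp (B i)))// => i'.
  by rewrite /nilp size_map.
have mE := atoms_measurable aE.
have mF : measurable (E `&` future s u) by apply: measurableI => //; exact: measurable_future.
set F := E `&` future s u in mF *.
have mM K' B' : measurable_pattern B' -> measurable (matches_all B' K').
  exact: measurable_matches_all.
have uKs i : uniq (map fst ((K, i) :: s)).
  by rewrite /= us andbT; apply/negP => /mapP[x /sK h /esym xK]; rewrite xK ltnn in h.
have sKs i x : x \in (K, i) :: s -> (K <= x.1)%N.
  by rewrite inE => /predU1P[->//|/sK /ltnW].
have uK' y : y \in u -> (K <= y.1.1)%N by move=> /uK /ltnW.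
have hw0 s' u' B' K' w : (0 <= future_weight s' u' w * pattern_weight B' K' w)%R.
  by rewrite mulr_ge0// ?future_weight_ge0 ?pattern_weight_ge0.
have mw s' u' B' K' : measurable_pattern B' ->
    measurable_fun E (fun w => (future_weight s' u' w * pattern_weight B' K' w)%:E).
  move=> mB'; apply: measurable_funTS; apply/measurable_EFinP; apply: measurable_funM.
    exact: measurable_future_weight.
  exact: measurable_pattern_weight.
have labelled i : P (F `&` matches_all B K `&` L i K) =
    \int[P]_(w in E) (future_weight ((K, i) :: s) u w * pattern_weight B K w)%:E.
  rewrite -(IH B E ((K, i) :: s) u mB aE (uKs i) uu hu (sKs i) uK'); congr (P _); apply/seteqP; split => w.
    move=> [[[Ew [hs hv]] Mw] Lw]; split => //; split => //; split => // x.
    by rewrite inE => /predU1P[->//|]; exact: hs.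
  move=> [[Ew [hs hv]] Mw]; split; last by have := hs (K, i); rewrite inE eqxx => /(_ isT).
  by split => //; split => //; split => // x xs; apply: hs; rewrite inE xs orbT.
pose uj i j := ((K, (size (B i)).-1), j) :: u.
have inserted i : i \in I -> P (F `&` matches_all B K.+1 `&` L i K) =
    \sum_(j < size (B i)) \int[P]_(w in E)
      ((\1_(nth set0 (B i) j) (p K w))%:E *
       (future_weight ((K, i) :: s) (uj i j) w * pattern_weight (fam_del B i j) K w)%:E).
  move=> iI.
  pose A j := E `&` (p K @^-1` nth set0 (B i) j) `&` future ((K, i) :: s) (uj i j) `&`
    matches_all (fam_del B i j) K.
  have mA (j : 'I_(size (B i))) : measurable (A j).
    apply: measurableI; last by apply: mM; exact: measurable_pattern_del.
    apply: measurableI; last exact: measurable_future.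
    by apply: atoms_measurable; exact: atoms_setI_point.
  rewrite (_ : _ `&` L i K = \big[setU/set0]_(j < size (B i)) A j); last first.
    rewrite -bigcup_mkord; apply/seteqP; split => w.
      move=> [[[Ew [hs hv]] Mw] Lw].
      have /(matches_all_step _ iI Lw) [j ji [Vj Bj h]] := Mw.
      exists j => //; split => //; split => //; split => // [x|y].
        by rewrite inE => /predU1P[->//|]; exact: hs.
      by rewrite inE => /predU1P[->//|]; exact: hv.
    move=> [j /= ji [[[Ew Bj] [hs hv]] h]].
    have Lw : L i K w by have := hs (K, i); rewrite inE eqxx => /(_ isT).
    split => //; split.
      split => //; split => [x xs|y yu]; first by apply: hs; rewrite inE xs orbT.
      by apply: hv; rewrite inE yu orbT.
    apply/(matches_all_step _ iI Lw); exists j => //; split => //.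
    by have := hv (K, (size (B i)).-1, j); rewrite inE eqxx => /(_ isT).
  rewrite measure_bigsetU_ord//; last first.
    move=> j j' _ _ [w [[[_ [_ h]] _] [[_ [_ h']] _]]]; apply: val_inj => /=.
    have := h (K, (size (B i)).-1, val j); rewrite inE eqxx => /(_ isT) /= <-.
    by have := h' (K, (size (B i)).-1, val j'); rewrite inE eqxx => /(_ isT) /= <-.
  apply: eq_bigr => j _.
  apply: (etrans (IH (fam_del B i j) (E `&` (p K @^-1` nth set0 (B i) j))
    ((K, i) :: s) (uj i j) _ _ _ _ _ _ _)).
  - exact: measurable_pattern_del.
  - exact: atoms_setI_point.
  - exact: uKs.
  - rewrite /= uu andbT; apply/negP => /mapP[y /uK h /esym yK].
    by rewrite yK ltnn in h.
  - move=> y; rewrite inE => /predU1P[->/=|]; last exact: hu.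
    by rewrite -ltnS (ltn_predK (ltn_ord j)).
  - exact: sKs.
  - by move=> y; rewrite inE => /predU1P[->//|]; exact: uK'.
  - rewrite integral_mkcondr; apply: eq_integral => w _; rewrite patchE.
    rewrite indicE; have -> : (w \in p K @^-1` nth set0 (B i) j) = (p K w \in nth set0 (B i) j).
      by apply/idP/idP => /set_mem h; apply/mem_set.
    by case: ifP => _; rewrite ?mul1e ?mul0e.
have none : F `&` matches_all B K.+1 `&` [set w | forall i, i \in I -> ~ L i K w] =
    F `&` matches_all B K `&` [set w | forall i, i \in I -> ~ L i K w].
  by apply/seteqP; split => w [[Fw h] nL]; split => //; split => // i iI;
    have sk := @matches_skip i (B i) K w (nL i iI); apply/sk; exact: h.
have E1 := @measure_label_partition K _ (measurableI _ _ mF (mM K.+1 B mB)).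
have E2 := @measure_label_partition K _ (measurableI _ _ mF (mM K B mB)).
rewrite none in E1.
have labfin : \sum_(i <- I) P (F `&` matches_all B K `&` L i K) \is a fin_num.
  rewrite sum_fin_num; apply/allP => x /mapP[i _ ->]; apply: fin_num_measure.
  by apply: measurableI => //; apply: measurableI => //; exact: mM.
have E3 : P (F `&` matches_all B K.+1) + \sum_(i <- I) P (F `&` matches_all B K `&` L i K) =
    P (F `&` matches_all B K) + \sum_(i <- I) P (F `&` matches_all B K.+1 `&` L i K).
  by rewrite E1 E2 -!addeA; congr (_ + _); rewrite addeC.
have cancel x y : x + \sum_(i <- I) P (F `&` matches_all B K `&` L i K) =
    y + \sum_(i <- I) P (F `&` matches_all B K `&` L i K) -> x = y.
  by move=> /(congr1 (fun z => z - \sum_(i <- I) P (F `&` matches_all B K `&` L i K)));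
    rewrite !addeK.
apply: cancel; rewrite E3 (IH B E s u mB aE us uu hu (fun x xs => ltnW (sK x xs)) uK').
rewrite (eq_big_seq _ inserted); under [in RHS]eq_bigr do rewrite labelled.
pose G i j w := (\1_(nth set0 (B i) j) (p K w))%:E *
  (future_weight ((K, i) :: s) (uj i j) w * pattern_weight (fam_del B i j) K w)%:E.
have G0 i j w : 0 <= G i j w by rewrite mule_ge0 ?lee_fin.
have mG i (j : 'I_(size (B i))) : measurable_fun E (G i j).
  apply: emeasurable_funM; last by apply: mw; exact: measurable_pattern_del.
  apply: measurable_funTS; apply/measurable_EFinP.
  exact: (measurableT_comp (measurable_indic (mB i j)) (mp K)).
have SG i : \sum_(j < size (B i)) \int[P]_(w in E) G i j w =
    \int[P]_(w in E) \sum_(j < size (B i)) G i j w.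
  by rewrite ge0_integral_sum.
rewrite [X in _ + X = _](eq_bigr _ (fun i _ => SG i)).
rewrite -ge0_integral_sum//; last 2 first.
- by move=> i; exact: emeasurable_sum.
- by move=> i w _; rewrite sume_ge0.
rewrite -ge0_integral_sum//; last 2 first.
- by move=> i; exact: mw.
- by move=> i w _; rewrite lee_fin.
rewrite -ge0_integralD//; last 4 first.
- by move=> w _; rewrite lee_fin.
- exact: mw.
- by move=> w _; rewrite sume_ge0// => i _; rewrite sume_ge0.
- by apply: emeasurable_sum => i; exact: emeasurable_sum.
rewrite -ge0_integralD//; last 4 first.
- by move=> w _; rewrite lee_fin.
- exact: mw.
- by move=> w _; rewrite sume_ge0// => i _; rewrite lee_fin.
- by apply: emeasurable_sum => i; exact: mw.
apply: eq_integral => w _.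
have fwL i : future_weight ((K, i) :: s) u w = (pi i (p K w) * future_weight s u w)%R.
  by rewrite /future_weight big_cons mulrA.
have fwU i (j : 'I_(size (B i))) : future_weight ((K, i) :: s) (uj i j) w =
    (pi i (p K w) * future_weight s u w * (size (B i))%:R^-1)%R.
  rewrite /future_weight !big_cons /= (ltn_predK (ltn_ord j)).
  by rewrite -!mulrA; congr (_ * (_ * _))%R; rewrite mulrC.
have := congr1 (fun r => future_weight s u w * r)%R (pattern_weightS B K w).
rewrite /= !mulrDr => /esym EQ.
rewrite /G; under eq_bigr do under eq_bigr do rewrite -EFinM.
under eq_bigr do rewrite sumEFin.
rewrite !sumEFin -!EFinD; congr EFin.
transitivity (future_weight s u w * pattern_weight B K w +
 future_weight s u w *
 (\sum_(i <- I) \sum_(j < size (B i)) pi i (p K w) * \1_(nth set0 (B i) j) (p K w) /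
      (size (B i))%:R * pattern_weight (fam_del B i j) K w))%R.
  congr (_ + _)%R; rewrite mulr_sumr; apply: eq_bigr => i _.
  by rewrite mulr_sumr; apply: eq_bigr => j _; rewrite fwU; ring.
rewrite EQ; congr (_ + _)%R; rewrite mulr_sumr; apply: eq_bigr => i _.
by rewrite fwL; ring.
Qed.

End Law.
End Arrangement.

(** * The complete list of a class *)

Section FinalArrangement.
Context (R : realType) (d d' : measure_display) (W : measurableType d)
  (S : measurableType d') (P : probability W R) (mu : {measure set S -> \bar R})
  (p : nat -> W -> S)
  (J : countType) (L : J -> nat -> set W) (V : nat * nat -> W -> nat) (pi : J -> S -> R).
Hypothesis ppp : poisson_point_process P mu p.
Hypothesis mL : forall i k, measurable (L i k).
Hypothesis L_inj : forall i i' k w, L i k w -> L i' k w -> i = i'.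
Hypothesis mV : forall c v, measurable [set w | V c w = v].
Hypothesis VP : forall c w, (V c w <= c.2)%N.
Hypothesis mpi : forall i, measurable_fun setT (pi i).
Hypothesis pi_ge0 : forall i s, (0 <= pi i s)%R.
Hypothesis pi_sum : forall I s, uniq I -> (\sum_(i <- I) pi i s <= 1)%R.
Hypothesis pi_fin : forall i, \int[mu]_s (pi i s)%:E < +oo.
Hypothesis conditional_law : forall E s u, atoms p E ->
  uniq (map fst s) -> uniq (map fst u) -> (forall y, y \in u -> (y.2 <= y.1.2)%N) ->
  P (E `&` future L V s u) = \int[P]_(w in E) (future_weight p pi s u w)%:E.

Let mp k : measurable_fun setT (p k). Proof. by have [] := ppp. Qed.

Local Notation arrange := (arrange L V).
Local Notation matches_all := (matches_all p L V).

Definition class_mean i (C : set S) : R := mean mu (fun s => pi i s * \1_C s)%R.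

Definition arrangement_limit (I : seq J) (B : J -> seq (set S)) : R :=
  (\prod_(i <- I) ((\prod_(j < size (B i)) class_mean i (nth set0 (B i) j)) /
     (size (B i))`!%:R * expR (- class_mean i setT)))%R.

(** The limit of the placement sums, for the factors [pi i] restricted to the sets of
the pattern and [g] the probability of being in no class of [I]. *)
Lemma cvg_matches_all (I : seq J) (B : J -> seq (set S)) : uniq I -> measurable_pattern B ->
  fine (P (matches_all I B K)) @[K --> \oo] --> arrangement_limit I B.
Proof.
move=> uI mB.
have E K : P (matches_all I B K) = \int[P]_w (pattern_weight p pi I B K w)%:E.
  have := @arrangement_law _ _ _ _ _ P p J L V pi mp mL L_inj mV VP mpi pi_ge0 pi_sum
    conditional_law I uI K B setT [::] [::] mB.
  rewrite (_ : future L V [::] [::] = setT); last by apply/seteqP; split.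
  rewrite !setTI => -> //; last exact: (@measurableT _ (g_sigma_algebraType (\bigcup_k events_of (p k)))).
  by apply: eq_integral => w _; rewrite /future_weight !big_nil !mul1r.
set g := other_weight pi I; set fam := pattern_family pi B.
have g01 s : (0 <= g s <= 1)%R by exact: other_weight01.
have mg : measurable_fun setT g by exact: measurable_other_weight.
have int1g : \int[mu]_s (1 - g s)%:E = \sum_(i <- I) \int[mu]_s (pi i s)%:E.
  rewrite -ge0_integral_sum//.
  - by apply: eq_integral => s _; rewrite /g /other_weight subKr sumEFin.
  - by move=> i; exact/measurable_EFinP.
  - by move=> i s _; rewrite lee_fin.
have fin1g : \int[mu]_s (1 - g s)%:E < +oo.
  by rewrite int1g; apply: lte_sum_pinfty => i _.
have dom : dominated I g 1 fam.
  move=> i j iI; rewrite size_map => ji; split.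
    rewrite (_ : nth _ _ _ = fun s => pi i s * \1_(nth set0 (B i) j) s)%R.
      by apply: measurable_funM => //; exact: measurable_indic.
    by apply/funext => s; exact: pattern_familyE.
  move=> s; rewrite pattern_familyE// mulr_ge0//= mul1r /g /other_weight subKr.
  apply: (@le_trans _ _ (pi i s)); first by rewrite ler_piMr// indicE; case: (_ \in _).
  by rewrite (bigD1_seq i)//= lerDl sumr_ge0.
have h := @cvg_placements _ _ _ _ _ P mu p ppp J I uI g 1%R fam ler01 mg g01 fin1g dom.
have limE : arrangement_limit I B = (placement_limit mu I g fam / \prod_(i <- I) (size (B i))`!%:R)%R.
  rewrite /arrangement_limit /placement_limit !big_split /= -expR_sum sumrN prodfV.
  rewrite mulrAC; congr (_ * expR _ / _)%R.
    apply: eq_bigr => i _; rewrite size_map; apply: eq_bigr => j _.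
    by rewrite /class_mean; congr (mean _ _); apply/funext => s; rewrite pattern_familyE.
  congr (- _)%R; rewrite /mean int1g.
  have -> : (\sum_(i <- I) class_mean i setT)%R = (\sum_(i <- I) fine (\int[mu]_s (pi i s)%:E))%R.
    apply: eq_bigr => i _; rewrite /class_mean /mean; congr fine.
    by apply: eq_integral => s _; rewrite indicT mulr1.
  rewrite [in RHS](eq_bigr (fun i => (fine (\int[mu]_s (pi i s)%:E))%:E)).
    by rewrite sumEFin.
  move=> i _; rewrite fineK// ge0_fin_numE//.
  by apply: integral_ge0 => s _; rewrite lee_fin.
rewrite limE.
have E' K : fine (P (matches_all I B K)) =
    (fine (\int[P]_w (placements I (p ^~ w) g fam K)%:E) / \prod_(i <- I) (size (B i))`!%:R)%R.
  set c := (\prod_(i <- I) _)%R; set X := \int[P]_w _.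
  have c0 : (0 < c^-1)%R by rewrite invr_gt0 prodr_gt0// => i _; rewrite ltr0n fact_gt0.
  have pl0 w : (0 <= placements I (p ^~ w) g fam K)%R.
    apply: placements_ge0; first by move=> s; case/andP: (g01 s).
    by move=> i j iI ji s; have [_ /(_ s) /andP[]] := dom i j iI ji.
  have PX : P (matches_all I B K) = c^-1%:E * X.
    rewrite E /X -ge0_integralZl//.
    - by apply: eq_integral => w _; rewrite /pattern_weight -EFinM mulrC.
    - apply/measurable_EFinP; apply: measurable_placements => //.
      by move=> i j iI ji; have [] := dom i j iI ji.
    - by move=> w _; rewrite lee_fin.
    - by rewrite lee_fin ltW.
  have X0 : 0 <= X by apply: integral_ge0 => w _; rewrite lee_fin.
  have Xfin : X \is a fin_num.
    rewrite ge0_fin_numE// ltey; apply/negP => /eqP Xoo.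
    have : P (matches_all I B K) \is a fin_num.
      by apply: fin_num_measure; exact: measurable_matches_all.
    by rewrite PX Xoo gt0_muley.
  by rewrite PX fineM// mulrC.
under eq_cvg do rewrite E'.
by apply: cvgM => //; exact: cvg_cst.
Qed.

Definition settled i K : set W := [set w | forall k, (K <= k)%N -> ~ L i k w].

(** When the class is infinite, which has probability 0, the empty list is a default
value. *)
Definition final i w : seq nat :=
  if pselect (exists K, settled i K w) is left ex then arrange i (projT1 (cid ex)) w
  else [::].

Lemma arrange_settled i K M w : settled i K w -> (K <= M)%N -> arrange i M w = arrange i K w.
Proof.
move=> sK; elim: M => [|M IH]; first by rewrite leqn0 => /eqP ->.
rewrite leq_eqVlt => /predU1P[->//|]; rewrite ltnS => KM /=.
by case: pselect => [LM|nLM]; [have := sK M KM LM|exact: IH].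
Qed.

Lemma finalE i K w : settled i K w -> final i w = arrange i K w.
Proof.
move=> sK; rewrite /final; case: pselect => [ex|[]]; last by exists K.
case: cid => K' /= sK'.
by have [KK|/ltnW KK] := leqP K K'; [rewrite (arrange_settled sK KK)|rewrite (arrange_settled sK' KK)].
Qed.

Lemma measurable_settled i K : measurable (settled i K).
Proof.
rewrite (_ : settled i K = \bigcap_(k in [set k | (K <= k)%N]) ~` L i k).
  by apply: bigcap_measurableType => k _; exact: measurableC.
by apply/seteqP; split.
Qed.

Lemma measurable_final i l : measurable [set w | final i w = l].
Proof.
pose U := \bigcup_K settled i K.
have mU : measurable U by apply: bigcup_measurable => K _; exact: measurable_settled.
rewrite (_ : mkset _ = (\bigcup_K (settled i K `&` [set w | arrange i K w = l])) `|`
  (~` U `&` [set w | [::] = l])).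
  apply: measurableU.
    apply: bigcup_measurable => K _; apply: measurableI; first exact: measurable_settled.
    exact: measurable_arrange.
  apply: measurableI; first exact: measurableC.
  exact: measurable_prop.
apply/seteqP; split => w /=.
  have [[K _ sK]|nU] := pselect (U w).
    by move=> fl; left; exists K => //; split => //=; rewrite -(finalE sK).
  move=> fl; right; split => //; rewrite -fl /final; case: pselect => // -[K sK].
  by exfalso; apply: nU; exists K.
move=> [[K _ [sK /= <-]]|[nU <-]]; first exact: finalE.
by rewrite /final; case: pselect => // -[K sK]; exfalso; apply: nU; exists K.
Qed.

Lemma settled_of_bounded i n w : (forall K, (size (arrange i K w) <= n)%N) ->
  exists K, settled i K w.
Proof.
move=> hn; apply: contrapT => /forallNP no.
have big m : exists K, (m <= size (arrange i K w))%N.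
  elim: m => [|m [K hK]]; first by exists 0%N.
  have /existsNP[k /not_implyP[Kk /contrapT Lk]] := no K.
  exists k.+1 => /=; case: pselect => // Lk'; rewrite size_insert ltnS.
  apply: leq_trans hK _; elim: k Kk {Lk Lk'} => [|k IH]; first by rewrite leqn0 => /eqP ->.
  rewrite leq_eqVlt => /predU1P[->//|]; rewrite ltnS => /IH /leq_trans; apply.
  by rewrite /=; case: pselect => // Lk'; rewrite size_insert.
by have [K] := big n.+1; rewrite ltnNge hn.
Qed.

Lemma class_mean_ge0 i C : (0 <= class_mean i C)%R.
Proof. by apply: fine_ge0; apply: integral_ge0 => s _; rewrite lee_fin mulr_ge0. Qed.

(** The sizes of the lists converge in law to a Poisson variable. As the Poisson law
has total mass 1, no mass escapes to infinity and the sizes are almost surely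
bounded. *)
Lemma settled_ae i : {ae P, forall w, exists K, settled i K w}.
Proof.
set M := class_mean i setT.
have M0 : (0 <= M)%R by exact: class_mean_ge0.
pose pois l : R := (M ^+ l / l`!%:R * expR (- M))%R.
pose count l K := [set w | size (arrange i K w) = l].
have countE l K : count l K = matches_all [:: i] (fun=> nseq l setT) K.
  apply/seteqP; split => w /=.
    move=> sz j; rewrite inE => /eqP ->; rewrite /matches size_nseq; split => // k kl.
    by rewrite nth_nseq kl.
  by move=> /(_ i); rewrite inE eqxx => /(_ isT) []; rewrite size_nseq.
have mnseq l : @measurable_pattern _ S J (fun=> nseq l setT).
  by move=> i' j; rewrite nth_nseq; case: ifP.
have mcount l K : measurable (count l K).
  by rewrite countE; exact: measurable_matches_all.
have cvg_count l : fine (P (count l K)) @[K --> \oo] --> pois l.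
  under eq_cvg do rewrite countE.
  rewrite (_ : pois l = arrangement_limit [:: i] (fun=> nseq l setT)).
    exact: cvg_matches_all.
  rewrite /arrangement_limit big_seq1 size_nseq; congr (_ / _ * _)%R.
  transitivity (\prod_(j < l) M)%R; first by rewrite prodr_const card_ord.
  apply: eq_bigr => j _.
  by rewrite nth_nseq ltn_ord.
pose D n K := [set w | (size (arrange i K w) <= n)%N].
have DE n K : D n K = \big[setU/set0]_(l < n.+1) count l K.
  rewrite -(bigcup_mkord n.+1 (fun l => count l K)); apply/seteqP; split => w /=.
    by move=> sz; exists (size (arrange i K w)).
  by move=> [l /= ln]; rewrite /count /D /= => ->; rewrite -ltnS.
have mD n K : measurable (D n K) by rewrite DE; exact: bigsetU_measurable.
have cvg_D n : fine (P (D n K)) @[K --> \oo] --> (\sum_(l < n.+1) pois l)%R.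
  have -> : (fun K => fine (P (D n K))) = (fun K => \sum_(l < n.+1) fine (P (count l K)))%R.
    apply/funext => K; rewrite DE (@measure_bigsetU _ _ _ P (fun l => count l K))//; last first.
      by move=> l l' _ _ [w [/= sl sl']]; rewrite -sl -sl'.
    by rewrite -sum_fine// => l _; exact: fin_num_measure.
  elim: n.+1 => [|m IH].
    by under eq_cvg do rewrite big_ord0; rewrite big_ord0; exact: cvg_cst.
  under eq_cvg do rewrite big_ord_recr /=; rewrite big_ord_recr /=.
  by apply: cvgD; [exact: IH|exact: cvg_count].
pose S0 := \bigcup_K settled i K.
have mS0 : measurable S0 by apply: bigcup_measurable => K _; exact: measurable_settled.
have S0n n : (\sum_(l < n.+1) pois l)%:E <= P S0.
  have niD : nonincreasing_seq (D n).
    apply/nonincreasing_seqP => K; apply/subsetPset => w /=; rewrite /D /=.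
    by case: pselect => // Lw; rewrite size_insert => /ltnW.
  have mcap : measurable (\bigcap_K D n K) by exact: bigcapT_measurable.
  have /fine_cvg cP : P (D n K) @[K --> \oo] --> (fine (P (\bigcap_K D n K)))%:E.
    rewrite fineK ?fin_num_measure//; apply: nonincreasing_cvg_mu => //.
    by apply: (le_lt_trans (probability_le1 _ _)) => //; exact: ltry.
  have -> : (\sum_(l < n.+1) pois l)%R = fine (P (\bigcap_K D n K)).
    exact: (cvg_unique (@Rhausdorff R) (cvg_D n) cP).
  rewrite fineK ?fin_num_measure//; apply: le_measure; rewrite ?inE// => w hw.
  have [K sK] := @settled_of_bounded i n w (fun K => hw K I).
  by exists K.
have P1 : P S0 = 1.
  apply/eqP; rewrite eq_le probability_le1//= -(poisson_law_sum M0).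
  apply: lime_le.
    by apply: is_cvg_nneseries => n _ _; exact: poisson_law_ge0.
  apply: nearW => n; apply: le_trans (S0n n).
  rewrite big_mkord (eq_bigr (fun l : 'I_n => (pois l)%:E)); last first.
    by move=> l _; rewrite poisson_lawE.
  rewrite sumEFin lee_fin big_ord_recr /= lerDl /pois.
  by rewrite mulr_ge0 ?expR_ge0// divr_ge0// exprn_ge0.
have := ae_of_probability1 mS0 P1; apply: filterS => w [K _ sK].
by exists K.
Qed.

Lemma settled_all_ae : {ae P, forall w, forall i, exists K, settled i K w}.
Proof.
have : {ae P, forall w, forall n, if unpickle n is Some i then exists K, settled i K w else True}.
  apply: ae_foralln => n; case: unpickle => [i|]; first exact: settled_ae.
  exact: aeW.
by apply: filterS => w h i; have := h (pickle i); rewrite pickleK.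
Qed.

Definition final_matches (I : seq J) (B : J -> seq (set S)) : set W :=
  [set w | forall i, i \in I -> size (final i w) = size (B i) /\
    forall j, (j < size (B i))%N -> nth set0 (B i) j (p (nth 0%N (final i w) j) w)].

Lemma measurable_final_matches I B : measurable_pattern B -> measurable (final_matches I B).
Proof.
move=> mB.
apply: measurable_forall_in => i; apply: measurable_listed => // l; exact: measurable_final.
Qed.

(** On the events [T K], which increase to an event of probability 1, the complete
lists are those after [K] points, so that [cvg_matches_all] applies. *)
Theorem final_law I B : uniq I -> measurable_pattern B ->
  P (final_matches I B) = (arrangement_limit I B)%:E.
Proof.
move=> uI mB; set A := final_matches I B.
have mA : measurable A by exact: measurable_final_matches.
pose T K := [set w | forall i, i \in I -> settled i K w].
have mT K : measurable (T K).
  by apply: measurable_forall_in => i; exact: measurable_settled.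
have ndT : nondecreasing_seq T.
  apply/nondecreasing_seqP => K; apply/subsetPset => w TK i iI k Kk.
  by apply: TK => //; exact: ltnW.
have mAK K : measurable (matches_all I B K) by exact: measurable_matches_all.
have AT K : A `&` T K = matches_all I B K `&` T K.
  apply/seteqP; split => w [h TK]; split => // i iI; have := h i iI.
    by rewrite (finalE (TK i iI)).
  by rewrite /matches -(finalE (TK i iI)).
pose U := \bigcup_K T K.
have mU : measurable U by apply: bigcup_measurable.
have PU : P (~` U) = 0.
  apply: measure_negligible; first exact: measurableC.
  apply: negligibleS settled_all_ae => w nU /= h; apply: nU.
  have [K0 hK0] : {K0 : J -> nat & forall i, settled i (K0 i) w}.
    by apply: (@choice _ _ (fun i K => settled i K w)).
  exists (\max_(i <- I) K0 i)%N => // i iI k Kk.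
  by apply: (hK0 i); apply: leq_trans Kk; exact: (@leq_bigmax_seq _ I xpredT K0 i).
have PU1 : P U = 1.
  by have := probability_setC P (measurableC mU); rewrite setCK PU sube0.
have PAU : P (A `&` U) = P A.
  apply/eqP; rewrite eq_le; apply/andP; split; first by apply: le_measure; rewrite ?inE//; exact: measurableI.
  rewrite -[leRHS]adde0 -PU; apply: le_trans (measureU2 _ _ _); [|exact: measurableI|exact: measurableC].
  apply: le_measure; rewrite ?inE//; first by apply: measurableU; [exact: measurableI|exact: measurableC].
  by move=> w Aw; have [Uw|nUw] := pselect (U w); [left|right].
have fin X : measurable X -> P X \is a fin_num by move=> mX; exact: fin_num_measure.
have cT : fine (P (T K)) @[K --> \oo] --> (1%R : R).
  apply: fine_cvg; rewrite -PU1; exact: nondecreasing_cvg_mu.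
have cA : fine (P (A `&` T K)) @[K --> \oo] --> fine (P A).
  apply: fine_cvg; rewrite fineK ?fin// -PAU /U setI_bigcupr.
  apply: nondecreasing_cvg_mu.
  - by move=> K; exact: measurableI.
  - by apply: bigcup_measurable => K _; exact: measurableI.
  - by move=> K M KM; apply/subsetPset; apply: setIS; apply/subsetPset/ndT.
have cM := cvg_matches_all uI mB.
rewrite -(fineK (fin _ mA)); congr EFin; apply: (cvg_unique (@Rhausdorff R) _ cM).
have cH : (fine (P (A `&` T K)) + (1 - fine (P (T K))))%R @[K --> \oo] --> fine (P A).
  rewrite -[X in _ --> X]addr0 -(subrr (1%R : R)); apply: cvgD => //.
  by apply: cvgB => //; exact: cvg_cst.
apply: (squeeze_cvgr _ cA cH); apply: nearW => K; apply/andP; split.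
  apply: fine_le; rewrite ?fin//; first exact: measurableI.
  apply: le_measure; [by rewrite inE; exact: measurableI|by rewrite inE|].
  by rewrite AT => w [].
have -> : (1 - fine (P (T K)) = fine (P (~` T K)))%R.
  by rewrite probability_setC// fineB// fin.
have f1 := fin _ (mAK K); have f2 := fin _ (measurableI _ _ mA (mT K)).
have f3 := fin _ (measurableC (mT K)).
rewrite -fineD//; apply: fine_le => //; first by rewrite fin_numD f2 f3.
rewrite AT; apply: le_trans (measureU2 _ _ _); [|exact: measurableI|exact: measurableC].
apply: le_measure; [by rewrite inE| |].
  by rewrite inE; apply: measurableU; [exact: measurableI|exact: measurableC].
by move=> w Aw; have [Uw|nUw] := pselect (T K w); [left|right].
Qed.

End FinalArrangement.

(** * Measures with a density, image measures and random positions *)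

Lemma density_measure (R : realType) d (T : measurableType d) (mu : {measure set T -> \bar R})
    (f : T -> R) : measurable_fun setT f -> (forall x, 0 <= f x)%R ->
  exists nu : {measure set T -> \bar R},
    forall C, measurable C -> nu C = \int[mu]_(x in C) (f x)%:E.
Proof.
move=> mf f0; pose m (C : set T) := \int[mu]_(x in C) (f x)%:E.
have m0 : m set0 = 0 by exact: integral_set0.
have mge0 C : 0 <= m C by apply: integral_ge0 => x _; rewrite lee_fin.
have msig : semi_sigma_additive m.
  move=> F mF tF mUF; rewrite /m ge0_integral_bigcup//.
  - apply: is_cvg_ereal_nneg_natsum => n _; exact: mge0.
  - by apply: measurable_funTS; exact/measurable_EFinP.
  - by move=> x _; rewrite lee_fin.
pose nu : {measure set T -> \bar R} := HB.pack m (isMeasure.Build _ _ _ m m0 mge0 msig).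
by exists nu.
Qed.

Import HBNNSimple.

Lemma integral_density (R : realType) d (T : measurableType d)
    (mu nu : {measure set T -> \bar R}) (f g : T -> R) :
  measurable_fun setT f -> (forall x, 0 <= f x)%R ->
  (forall C, measurable C -> nu C = \int[mu]_(x in C) (f x)%:E) ->
  measurable_fun setT g -> (forall x, 0 <= g x)%R ->
  \int[nu]_x (g x)%:E = \int[mu]_x (g x * f x)%:E.
Proof.
move=> mf f0 nuE mg g0.
have mEg : measurable_fun setT (EFin \o g) by exact/measurable_EFinP.
pose h : {nnsfun T >-> R}^nat := nnsfun_approx measurableT mEg.
have hcvg x : (h n x)%:E @[n --> \oo] --> (g x)%:E.
  by apply: cvg_nnsfun_approx => // y _; rewrite lee_fin.
have hnd x : nondecreasing_seq (fun n => h n x).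
  by move=> m n mn; exact/lefP/nd_nnsfun_approx.
have simple n : \int[nu]_x (h n x)%:E = \int[mu]_x (h n x * f x)%:E.
  have fr : finite_set (range (h n)) by exact: fimfunP.
  rewrite integral_nnsfun// patch_setT sintegralE.
  transitivity (\int[mu]_x \sum_(y \in range (h n))
      (y%:E * (\1_(h n @^-1` [set y]) x * f x)%:E)).
    rewrite ge0_integral_fsum//; last 2 first.
    - move=> y; apply: measurable_funeM; apply/measurable_EFinP.
      exact: measurable_funM.
    - move=> y x _; have [xy|xy] := pselect ((h n @^-1` [set y]) x).
        by rewrite mule_ge0// lee_fin ?mulr_ge0// -[y]xy.
      by rewrite indicE memNset// mul0r mule0.
    apply: eq_fsbigr => y /set_mem [x _ hxy].
    rewrite ge0_integralZl//; last 3 first.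
    - by apply/measurable_EFinP; apply: measurable_funM.
    - by move=> z _; rewrite lee_fin mulr_ge0.
    - by rewrite lee_fin -hxy.
    rewrite nuE; last exact: measurable_funPTI.
    rewrite [X in _ * X]integral_mkcond; congr (_ * _); apply: eq_integral => z _.
    by rewrite patchE indicE; case: ifP => _; rewrite ?mul1r ?mul0r.
  apply: eq_integral => x _.
  rewrite fsbig_finite//= (eq_bigr (fun y => (y * \1_(h n @^-1` [set y]) x * f x)%:E)); last first.
    by move=> y _; rewrite -EFinM mulrA.
  rewrite sumEFin -mulr_suml; congr (_ * _)%:E.
  by rewrite [in RHS](fimfunE (h n) x) fsbig_finite.
have c1 : \int[nu]_x (h n x)%:E @[n --> \oo] --> \int[nu]_x (g x)%:E.
  rewrite (_ : (fun x => (g x)%:E) = (fun x => limn (fun n => (h n x)%:E))); last first.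
    by apply/funext => x; apply/esym/cvg_lim => //; exact: hcvg.
  apply: cvg_monotone_convergence => //.
  - by move=> n; exact/measurable_EFinP.
  - by move=> n x _; rewrite lee_fin.
  - by move=> x _ a b ab; rewrite lee_fin; exact: hnd.
have c2 : \int[mu]_x (h n x * f x)%:E @[n --> \oo] --> \int[mu]_x (g x * f x)%:E.
  rewrite (_ : (fun x => (g x * f x)%:E) = (fun x => limn (fun n => (h n x * f x)%:E))); last first.
    apply/funext => x; apply/esym/cvg_lim => //; apply: cvg_EFin; first exact: nearW.
    apply: cvgM; last exact: cvg_cst.
    by have /fine_cvgP[] := hcvg x.
  apply: cvg_monotone_convergence => //.
  - by move=> n; apply/measurable_EFinP; exact: measurable_funM.
  - by move=> n x _; rewrite lee_fin mulr_ge0.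
  - by move=> x _ a b ab; rewrite lee_fin ler_wpM2r//; exact: hnd.
rewrite -(cvg_lim _ c1)// -(cvg_lim _ c2)//.
by congr (limn _); apply/funext => n; exact: simple.
Qed.

Lemma mnormalizeE (R : realType) d (T : measurableType d) (mu : {measure set T -> \bar R})
    (P : probability T R) C : mu setT != 0 -> mu setT < +oo ->
  mnormalize mu P C = mu C * (fine (mu setT))^-1%:E.
Proof. by move=> m0 mfin; rewrite /mnormalize ifN// negb_or m0 lt_eqF. Qed.

(** The bound on the positions holds everywhere and not only almost surely, because
they are remainders of independent variables modulo [c.2.+1]. *)
Theorem uniform_positions (R : realType) :
  exists (d : measure_display) (Q : measurableType d) (PQ : probability Q R)
    (V : nat * nat -> Q -> nat),
    [/\ forall c v, measurable [set q | V c q = v],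
        forall c q, (V c q <= c.2)%N &
        forall u : seq (nat * nat * nat), uniq (map fst u) ->
          (forall y, y \in u -> (y.2 <= y.1.2)%N) ->
          PQ [set q | forall y, y \in u -> V y.1 q = y.2] =
            (\prod_(y <- u) y.1.2.+1%:R^-1)%:E].
Proof.
have unif (m : nat) : exists U : probability nat R,
    forall j, (j <= m)%N -> U [set z | (z %% m.+1 = j)%N] = (m.+1%:R^-1)%:E.
  pose mu : {measure set nat -> \bar R} := msum (fun j : nat => \d_j) m.+1.
  have muE A : mu A = \sum_(n < m.+1) \d_(nat_of_ord n) A by [].
  have muT : mu setT = m.+1%:R%:E.
    rewrite muE (eq_bigr (fun=> 1%:E)); last by move=> j _; rewrite diracT.
    by rewrite sumEFin sumr_const card_ord.
  exists (mnormalize mu (dirac 0%N)) => j jm.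
  have muT0 : mu setT != 0 by rewrite muT eqe pnatr_eq0.
  have muTfin : mu setT < +oo by rewrite muT ltry.
  transitivity (mu [set z | (z %% m.+1)%N = j] * (fine (mu setT))^-1%:E).
    exact: mnormalizeE.
  rewrite muT -[RHS]mul1e; congr (_ * _).
  rewrite muE (bigD1 (inord j))//= big1 ?adde0.
    by rewrite diracE mem_set//= inordK// modn_small.
  move=> i ij; rewrite diracE memNset//= => E; move/eqP: ij; apply.
  by apply: val_inj; rewrite /= inordK// -E modn_small.
pose U (c : nat * nat) := sval (cid (unif c.2)).
have UP c j : (j <= c.2)%N -> U c [set z | (z %% c.2.+1 = j)%N] = (c.2.+1%:R^-1)%:E.
  by rewrite /U; case: cid => u h; exact: h.
have [d [Q [PQ [Z [mZ hZ]]]]] := countable_product U.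
exists d, Q, PQ, (fun c q => Z c q %% c.2.+1)%N; split.
- move=> c v; have := mZ c measurableT [set z | (z %% c.2.+1 = v)%N].
  by rewrite setTI; apply.
- by move=> c q; rewrite -ltnS ltn_mod.
- move=> u uu hu.
  pose v c := nth 0%N (map snd u) (index c (map fst u)).
  have vE y : y \in u -> v y.1 = y.2.
    exact: nth_index_fst.
  have := hZ (map fst u) (fun c => [set z | (z %% c.2.+1 = v c)%N]) uu (fun=> I).
  rewrite big_map => E.
  transitivity (\prod_(y <- u) U y.1 [set z | (z %% y.1.2.+1)%N = v y.1]).
    rewrite -E; congr (PQ _); apply/seteqP; split => q /= h.
      by move=> c /mapP[y yu ->]; rewrite vE//; exact: h.
    by move=> y yu; rewrite -(vE y yu); apply: h; exact: map_f.
  rewrite -prodEFin; apply: eq_big_seq => y yu.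
  by rewrite UP// vE//; exact: hu.
Qed.

Section Lifting.
Context (R : realType) (d d1 d' : measure_display) (W : measurableType d)
  (Omega : measurableType d1) (S : measurableType d')
  (PW : probability W R) (P : probability Omega R) (f : W -> Omega).
Hypothesis mf : measurable_fun setT f.
Hypothesis Pf : forall E, measurable E -> PW (f @^-1` E) = P E.

Lemma lift_poisson_point_process (mu : set S -> \bar R) (p : nat -> Omega -> S) :
  poisson_point_process P mu p -> poisson_point_process PW mu (fun k => p k \o f).
Proof.
move=> [mp law1 law2 ind].
have mcount C m : measurable C -> measurable [set w | point_count R p C w = m].
  move=> mC; rewrite -[X in measurable X]setTI.
  have : measurable_fun setT (point_count R p C).
    apply: ge0_emeasurable_sum => [k w _ _|k _]; first by rewrite diracE lee_fin.
    apply/measurable_EFinP; exact: (measurableT_comp (measurable_indic mC) (mp k)).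
  by move=> /(_ measurableT _ (emeasurable_set1 m)).
split.
- by move=> k; exact: (measurableT_comp (mp k) mf).
- move=> C mC Cfin n; rewrite -law1// -Pf//; exact: mcount.
- by move=> C mC Cinf; rewrite -(law2 C mC Cinf) -Pf//; exact: mcount.
- move=> C mC tC s F us hF.
  have {}hF i : i \in s -> exists2 B, measurable B & F i = f @^-1` (point_count R p (C i) @^-1` B).
    by move=> /hF [_ [B mB <-]]; exists B => //; rewrite setTI.
  pose B i := if pselect (i \in s) is left h then sval (cid2 (hF i h)) else setT.
  have FB i : i \in s -> F i = f @^-1` (point_count R p (C i) @^-1` B i).
    by move=> h; rewrite /B; case: pselect => // h'; case: cid2.
  have mB i : measurable (B i).
    by rewrite /B; case: pselect => // h'; case: cid2.
  have mFB i : measurable (point_count R p (C i) @^-1` B i).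
    rewrite -[X in measurable X]setTI.
    have : measurable_fun setT (point_count R p (C i)).
      apply: ge0_emeasurable_sum => [k w _ _|k _]; first by rewrite diracE lee_fin.
      apply/measurable_EFinP; exact: (measurableT_comp (measurable_indic (mC i)) (mp k)).
    by move=> /(_ measurableT _ (mB i)).
  have -> : \big[setI/setT]_(i <- s) F i =
      f @^-1` (\big[setI/setT]_(i <- s) (point_count R p (C i) @^-1` B i)).
    rewrite -!bigcap_seq preimage_bigcap; apply: eq_bigcapr => i /= i_s.
    exact: FB.
  rewrite Pf; last by apply: bigsetI_measurable => i _.
  rewrite (ind C mC tC s _ us); last first.
    by move=> i i_s; split => //; exists (B i); rewrite ?setTI.
  by apply: eq_big_seq => i i_s; rewrite FB// Pf.
Qed.

Lemma atoms_lift (p : nat -> Omega -> S) E : atoms (fun k => p k \o f) E ->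
  exists2 E0, atoms p E0 & E = f @^-1` E0.
Proof.
suff : atoms (fun k => p k \o f) `<=` preimage_set_system setT f (atoms p).
  by move=> h /h [E0 aE0 <-]; exists E0; rewrite ?setTI.
apply: smallest_sub.
  apply: sigma_algebra_preimage.
  exact: smallest_sigma_algebra.
move=> _ [k _ [C mC <-]]; exists (p k @^-1` C); last by rewrite !setTI.
by apply: sub_sigma_algebra; exists k => //; exists C; rewrite ?setTI.
Qed.

Lemma integral_lift E (g : Omega -> \bar R) : measurable E -> measurable_fun setT g ->
  (forall w, 0 <= g w) -> \int[PW]_(w in f @^-1` E) g (f w) = \int[P]_(w in E) g w.
Proof.
move=> mE mg g0.
have mgE : measurable_fun E g by exact: measurable_funTS.
have g0E : {in E, forall y, 0 <= g y} by move=> y _.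
rewrite -[LHS](ge0_integral_pushforward mf PW mE mgE g0E).
apply: eq_measure_integral => A mA _; exact: Pf.
Qed.

End Lifting.

(** Restricted to the strip above [C], the product measure projects to [m2 C] times
[m1]. Since [m1] need not be sigma-finite, the theorem of Fubini is replaced by this
change of variables. *)
Lemma integral_rectangle (R : realType) d1 d2 (T1 : measurableType d1) (T2 : measurableType d2)
    (m1 : {measure set T1 -> \bar R}) (m2 : probability T2 R) (f : T1 -> R) (A : set T1) (C : set T2) :
  measurable_fun setT f -> (forall x, 0 <= f x)%R -> measurable A -> measurable C ->
  \int[m1 \x m2]_z (f z.1 * \1_(A `*` C) z)%:E = (\int[m1]_(x in A) (f x)%:E) * m2 C.
Proof.
move=> mf f0 mA mC.
have mAC (D : set T1) : measurable D -> measurable (D `*` C) by move=> mD; exact: measurableX.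
have mfst : measurable_fun setT (fst : T1 * T2 -> T1) by exact: measurable_fst.
have mTC := mAC _ measurableT.
have [rho rhoE] := @density_measure R _ _ (m1 \x m2) (\1_(setT `*` C)) (measurable_indic mTC)
  (fun=> ltac:(by rewrite indicE ler0n)).
pose fA x := (f x * \1_A x)%R.
have fA0 x : (0 <= fA x)%R by rewrite mulr_ge0.
have mfA : measurable_fun setT fA by apply: measurable_funM => //; exact: measurable_indic.
transitivity (\int[m1 \x m2]_z (fA z.1 * \1_(setT `*` C) z)%:E).
  apply: eq_integral => -[x y] _; rewrite /fA -mulrA !indicE -natrM mulnb; congr (_ * _%:R)%:E.
  by rewrite !in_setX in_setT.
rewrite -(integral_density (nu := rho) (f := \1_(setT `*` C)) (g := fA \o fst))//; last 2 first.
- exact: measurableT_comp.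
- by move=> x; exact: fA0.
have Cfin : (fine (m2 C) >= 0)%R by rewrite fine_ge0.
transitivity (\int[pushforward rho fst]_x (fA x)%:E).
  rewrite (ge0_integral_pushforward mfst)//; first exact/measurable_EFinP.
  by move=> x _; rewrite lee_fin.
transitivity (\int[mscale (NngNum Cfin) m1]_x (fA x)%:E).
  apply: eq_measure_integral => D mD _; transitivity (rho (fst @^-1` D)); first by [].
  rewrite rhoE; last first.
    by rewrite -[X in measurable X]setTI; exact: mfst.
  rewrite integral_indic//; last by rewrite -[X in measurable X]setTI; exact: mfst.
  have -> : (setT `*` C) `&` fst @^-1` D = D `*` C.
    by apply/seteqP; split => -[x y] /=; tauto.
  transitivity (m1 D * m2 C); first exact: product_measure1E.
  transitivity ((fine (m2 C))%:E * m1 D); last by [].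
  by rewrite muleC fineK// fin_num_measure.
rewrite ge0_integral_mscale//; last 2 first.
- exact/measurable_EFinP.
- by move=> x _; rewrite lee_fin.
rewrite /= fineK ?fin_num_measure// muleC; congr (_ * _).
rewrite [RHS]integral_mkcond; apply: eq_integral => x _.
by rewrite patchE /fA indicE; case: ifP => _; rewrite ?mulr1 ?mulr0.
Qed.

(** * Sums over points regrouped by class *)

Section PermArrange.
Context d (W : measurableType d) (J : choiceType) (L : J -> nat -> set W) (V : nat * nat -> W -> nat).

Lemma perm_insert (v k : nat) l : perm_eq (insert v k l) (k :: l).
Proof. by rewrite /insert perm_catC /= perm_cons perm_catC cat_take_drop. Qed.

Lemma perm_arrange i K w : perm_eq (arrange L V i K w) [seq k <- iota 0 K | `[< L i k w >]].
Proof.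
elim: K => // K IH; rewrite -(addn1 K) iotaD filter_cat add0n addn1 /=; case: pselect => Lw.
  rewrite asboolT//; apply: (perm_trans (perm_insert _ _ _)).
  by rewrite perm_sym perm_catC /= perm_cons perm_sym.
by rewrite asboolF// cats0.
Qed.

End PermArrange.

Section SumOverClasses.
Context (R : realType) d (W : measurableType d) (L : nat * nat -> nat -> set W) (V : nat * nat -> W -> nat).
Variables (w : W) (F : nat -> \bar R).
Hypothesis F0 : forall k, 0 <= F k.

Lemma sum_over_class i K : settled L i K w ->
  \sum_(0 <= k <oo) (if `[< L i k w >] then F k else 0) =
  \sum_(0 <= j < size (final L V i w)) F (nth 0%N (final L V i w) j).
Proof.
move=> sK; rewrite (finalE V sK).
rewrite -(big_nth 0%N xpredT F) (perm_big _ (perm_arrange L V i K w)) big_filter -/(index_iota 0 K).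
rewrite (nneseries_split 0 K)// ?add0n; last by move=> k _; case: ifP.
rewrite eseries0 ?adde0; last by move=> k Kk _; rewrite asboolF//; exact: sK.
by rewrite -big_mkcond /index_iota subn0.
Qed.

Lemma sum_over_classes : (forall i i' k, L i k w -> L i' k w -> i = i') ->
  (forall i, exists K, settled L i K w) -> (forall k, exists i, L i k w) ->
  \sum_(0 <= k <oo) F k =
  \sum_(0 <= a <oo) \sum_(0 <= b <oo) \sum_(0 <= j < size (final L V (a, b) w))
    F (nth 0%N (final L V (a, b) w) j).
Proof.
move=> inj sett lab.
pose G k a b := if `[< L (a, b) k w >] then F k else 0.
have G0 k a b : 0 <= G k a b by rewrite /G; case: ifP.
have -> : \sum_(0 <= k <oo) F k = \sum_(0 <= k <oo) \sum_(0 <= a <oo) \sum_(0 <= b <oo) G k a b.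
  apply: eq_eseriesr => k _; have [[a b] Lab] := lab k.
  rewrite (nneseries_single (n := a)); last 2 first.
  - move=> a' a'a; apply: eseries0 => b' _ _; rewrite /G asboolF// => L'.
    by move/eqP: a'a; apply; case: (inj _ _ _ L' Lab).
  - by apply: nneseries_ge0.
  rewrite (nneseries_single (n := b))//; first by rewrite /G asboolT.
  move=> b' b'b; rewrite /G asboolF// => L'.
  by move/eqP: b'b; apply; case: (inj _ _ _ L' Lab).
rewrite (@nneseries_interchange _ (fun k a => \sum_(0 <= b <oo) G k a b)); last first.
  by move=> k a; apply: nneseries_ge0 => b _ _.
apply: eq_eseriesr => a _; rewrite nneseries_interchange//.
apply: eq_eseriesr => b _; have [K sK] := sett (a, b).
exact: sum_over_class sK.
Qed.

End SumOverClasses.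

(** * Labelling a point by its first nonzero mark *)

Lemma big_uniq_subset (T : Type) (x : T) (op : Monoid.com_law x) (I : eqType) (s g : seq I) (F : I -> T) :
  uniq s -> uniq g -> {subset s <= g} ->
  \big[op/x]_(i <- g) F i = op (\big[op/x]_(i <- s) F i) (\big[op/x]_(i <- g | i \notin s) F i).
Proof.
move=> us ug sg; rewrite (bigID (mem s)) /=; congr (op _ _).
rewrite -big_filter; apply: perm_big; apply: uniq_perm => //; first exact: filter_uniq.
by move=> i; rewrite mem_filter; have [/sg ->|//] := boolP (i \in s).
Qed.

Section Labels.
Context (R : realType) (d d' : measure_display) (Omega : measurableType d)
  (S : measurableType d') (P : probability Omega R) (p : nat -> Omega -> S)
  (q : nat -> S -> R) (x : nat -> nat -> Omega -> nat).
Hypothesis mp : forall k, measurable_fun setT (p k).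
Hypothesis mx : forall n k, measurable_fun setT (x n k).
Hypothesis mq : forall v, measurable_fun setT (q v).
(* [x n k] is the mark of point [k] in round [n]. Given the points, the marks are
   independent and those of a point at [s] have the law [q ^~ s]. *)
Hypothesis q_ge0 : forall v s, (0 <= q v s)%R.
Hypothesis q_sum : forall s, \sum_(0 <= v <oo) (q v s)%:E = 1.
Hypothesis marks : forall (s : seq (nat * nat)) (a : nat * nat -> nat) E,
  uniq s -> atoms p E ->
  P (E `&` [set w | forall i, i \in s -> x i.1 i.2 w = a i]) =
    \int[P]_(w in E) (\prod_(i <- s) q (a i) (p i.2 w))%:E.

(** Both components are shifted by 1: point [k] has label [(a, b)] when its first
nonzero mark appears in round [a], rounds being counted from 0, and equals [b + 1].
This is the class [m = a + 1], [x = b + 1] of the size-biased representation. *)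
Definition label (i : nat * nat) (k : nat) : set Omega :=
  [set w | (forall n, (n < i.1)%N -> x n k w = 0%N) /\ x i.1 k w = i.2.+1].

Definition label_weight (i : nat * nat) (s : S) : R := (q 0%N s ^+ i.1 * q i.2.+1 s)%R.

Lemma label_inj i i' k w : label i k w -> label i' k w -> i = i'.
Proof.
case: i i' => [a b] [a' b'] [/= h e] [/= h' e']; case: (ltngtP a a') => aa.
- by rewrite h' in e.
- by rewrite h in e'.
- by subst a'; rewrite e in e'; case: e' => ->.
Qed.

Lemma measurable_mark n k v : measurable [set w | x n k w = v].
Proof. by have := mx n k measurableT (Y := [set v]); rewrite setTI; apply. Qed.

Lemma measurable_label i k : measurable (label i k).
Proof.
apply: measurableI; last exact: measurable_mark.
exact: (@measurable_forall_below _ _ _ (fun n => [set w | x n k w = 0%N])) (fun=> measurable_mark _ _ _).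
Qed.

Lemma measurable_label_weight i : measurable_fun setT (label_weight i).
Proof. by apply: measurable_funM => //; apply: measurable_funX. Qed.

Lemma label_weight_ge0 i s : (0 <= label_weight i s)%R.
Proof. by rewrite mulr_ge0// exprn_ge0. Qed.

Lemma partial_sum_le1 N s : (\sum_(v < N) q v s <= 1)%R.
Proof.
rewrite -lee_fin -sumEFin -(q_sum s) -(big_mkord xpredT (fun v => (q v s)%:E)).
by apply: nneseries_lim_ge => v _; rewrite lee_fin.
Qed.

(** Bounding [I] by a square, a geometric sum times [1 - q 0 s] remains. *)
Lemma label_weight_sum I s : uniq I -> (\sum_(i <- I) label_weight i s <= 1)%R.
Proof.
move=> uI.
have [N IN] : exists N, forall i, i \in I -> (i.1 < N)%N /\ (i.2 < N)%N.
  exists (\max_(i <- I) maxn i.1 i.2).+1 => i iI; have := @leq_bigmax_seq _ I xpredT (fun i => maxn i.1 i.2) i iI isT.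
  by rewrite geq_max => /andP[h1 h2]; rewrite !ltnS.
pose g := [seq (a, b) | a <- iota 0 N, b <- iota 0 N].
have ug : uniq g by apply: allpairs_uniq; rewrite ?iota_uniq// => -[? ?] [? ?] _ _ /=.
have Ig : {subset I <= g}.
  by move=> -[a b] /IN[/= aN bN]; apply/allpairsP; exists (a, b); rewrite !mem_iota.
apply: (@le_trans _ _ (\sum_(i <- g) label_weight i s)%R).
  rewrite (big_uniq_subset _ _ uI ug Ig) lerDl; apply: sumr_ge0 => i _.
  exact: label_weight_ge0.
have -> : (\sum_(i <- g) label_weight i s =
    (\sum_(0 <= a < N) q 0%N s ^+ a) * \sum_(0 <= b < N) q b.+1 s)%R.
  rewrite big_allpairs_dep mulr_suml /index_iota subn0.
  by apply: eq_bigr => a _; rewrite mulr_sumr.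
have q1 : (0 <= \sum_(0 <= b < N) q b.+1 s <= 1 - q 0%N s)%R.
  rewrite sumr_ge0//= lerBrDl -[leLHS](big_nat_recl N 0 (fun v => q v s))// big_mkord.
  exact: partial_sum_le1.
apply: (@le_trans _ _ ((\sum_(0 <= a < N) q 0%N s ^+ a) * (1 - q 0%N s))%R).
  apply: ler_wpM2l; last by case/andP: q1.
  by apply: sumr_ge0 => a _; rewrite exprn_ge0.
rewrite mulrC -opprB mulNr big_mkord -subrX1 opprB.
by rewrite gerBl exprn_ge0.
Qed.

(** A label is a condition on finitely many marks; the labels of different points
concern different marks. *)
Lemma label_law (s : seq (nat * (nat * nat))) E : uniq (map fst s) -> atoms p E ->
  P (E `&` [set w | forall y, y \in s -> label y.2 y.1 w]) =
    \int[P]_(w in E) (\prod_(y <- s) label_weight y.2 (p y.1 w))%:E.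
Proof.
move=> us aE.
pose cl k := nth (0%N, 0%N) (map snd s) (index k (map fst s)).
have clE y : y \in s -> cl y.1 = y.2.
  exact: nth_index_fst.
pose a (c : nat * nat) := if (c.1 < (cl c.2).1)%N then 0%N else (cl c.2).2.+1.
pose t := [seq (n, y.1) | y <- s, n <- iota 0 y.2.1.+1].
have ut : uniq t.
  apply: allpairs_uniq_dep; first exact: map_uniq us.
    by move=> y ys; exact: iota_uniq.
  move=> [y n] [y' n'] /allpairsPdep[y1 [n1 [y1s _ e1]]] /allpairsPdep[y2 [n2 [y2s _ e2]]] /= [nn kk].
  have ey := congr1 (@tag _ _) e1; have ey' := congr1 (@tag _ _) e2; rewrite /= in ey ey'.
  suff -> : y = y' by rewrite nn.
  case: y y' kk ey ey' {e1 e2} => [k c] [k' c'] /= <- h h'; congr (_, _).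
  by rewrite -h in y1s; rewrite -h' in y2s; rewrite -(clE _ y1s : cl k = c) -(clE _ y2s : cl k = c').
have -> : [set w | forall y, y \in s -> label y.2 y.1 w] =
    [set w | forall i, i \in t -> x i.1 i.2 w = a i].
  apply/seteqP; split => w /= h.
    move=> i /allpairsPdep[y [n [ys]]]; rewrite mem_iota /= add0n ltnS => ny -> /=.
    have [h1 h2] := h y ys; rewrite /a /= clE//; case: ltnP => ny'; first exact: h1.
    by rewrite -h2; congr (x _ _ _); apply/eqP; rewrite eqn_leq ny.
  move=> y ys; split => [n ny|].
    have := h (n, y.1); rewrite /a /= clE// ny; apply.
    by apply/allpairsPdep; exists y, n; split => //; rewrite mem_iota add0n ltnS (ltnW ny).
  have := h (y.2.1, y.1); rewrite /a /= clE// ltnn; apply.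
  by apply/allpairsPdep; exists y, y.2.1; rewrite mem_iota /= ltnSn.
rewrite marks//; apply: eq_integral => w _; congr EFin.
rewrite big_allpairs_dep; apply: eq_big_seq => y ys.
transitivity (\prod_(0 <= n < y.2.1.+1) q (a (n, y.1)) (p y.1 w))%R.
  by rewrite /index_iota subn0.
rewrite big_nat_recr//= /label_weight; congr (_ * _)%R.
  rewrite big_nat (eq_bigr (fun=> q 0%N (p y.1 w))); last first.
    by move=> n /andP[_ ny]; rewrite /a /= clE// ny.
  by rewrite -big_nat prodr_const_nat subn0.
by rewrite /a /= clE// ltnn.
Qed.

Hypothesis q0_lt1 : forall k w, (q 0%N (p k w) < 1)%R.

(** A point without label has mark 0 in the first [N] rounds for every [N]; this has
probability the mean of [q 0 (p k) ^+ N], which tends to 0. *)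
Lemma labelled_ae : {ae P, forall w, forall k, exists i, label i k w}.
Proof.
apply: ae_foralln => k.
pose U := \bigcap_n [set w | x n k w = 0%N].
have mU : measurable U by apply: bigcap_measurableType => n _; exact: measurable_mark.
suff PU : P U = 0.
  exists U; split => // w /= nl n _ /=; apply: contrapT => xn; apply: nl.
  have ex : exists n, x n k w != 0%N by exists n; apply/eqP.
  have [m xm mmin] := ex_minnP ex.
  exists (m, (x m k w).-1); split => [j jm|] /=; last by rewrite prednK// lt0n.
  apply/eqP; apply: contraTT jm => xj; rewrite -leqNgt; exact: mmin.
have bound N : P U <= \int[P]_w (q 0%N (p k w) ^+ N)%:E.
  have uN : uniq [seq (n, k) | n <- iota 0 N].
    by rewrite map_inj_uniq ?iota_uniq// => ? ? [].
  have aT : atoms p setT.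
    exact: (@measurableT _ (g_sigma_algebraType (\bigcup_k events_of (p k)))).
  have -> : \int[P]_w (q 0%N (p k w) ^+ N)%:E =
      P [set w | forall i, i \in [seq (n, k) | n <- iota 0 N] -> x i.1 i.2 w = 0%N].
    have := marks (fun=> 0%N) uN aT; rewrite setTI => ->.
    by apply: eq_integral => w _; rewrite big_map /= big_const_seq count_predT size_iota iter_mulr_1.
  apply: le_measure; rewrite ?inE//.
    by apply: measurable_forall_in => i; exact: measurable_mark.
  by move=> w Uw _ /mapP[n _ ->] /=; exact: Uw.
apply/eqP; rewrite eq_le measure_ge0 andbT.
have lim : \int[P]_w (q 0%N (p k w) ^+ N)%:E @[N --> \oo] --> (0 : \bar R).
  rewrite -[X in _ --> X](integral0 P setT).
  have := @dominated_convergence _ _ _ P setT measurableT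
    (fun N w => (q 0%N (p k w) ^+ N)%:E) (cst 0) (cst 1).
  move=> /(_ _)[]//.
  - move=> N; apply/measurable_EFinP; apply: measurable_funX.
    exact: measurableT_comp.
  - apply: aeW => w _; apply: cvg_EFin; first exact: nearW.
    by apply: cvg_expr; rewrite ger0_norm.
  - exact: finite_measure_integrable_cst.
  - apply: aeW => w N _; rewrite /= ger0_norm ?exprn_ge0// lee_fin.
    by rewrite exprn_ile1// ltW.
by apply: (cvge_ge _ lim); apply: nearW => N; exact: bound.
Qed.

End Labels.

(** * Class lists of the marked points *)

Lemma product_probability_fst (R : realType) d1 d2 (T1 : measurableType d1) (T2 : measurableType d2)
    (P1 : probability T1 R) (P2 : probability T2 R) E : measurable E ->
  (P1 \x P2) (fst @^-1` E) = P1 E.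
Proof.
move=> mE; rewrite (_ : fst @^-1` E = E `*` setT); last by apply/seteqP; split => -[a b] /=; tauto.
transitivity (P1 E * P2 setT); first exact: product_measure1E.
by rewrite probability_setT mule1.
Qed.

Section ClassLists.
Context (R : realType) (d d' d2 : measure_display) (Omega : measurableType d)
  (S : measurableType d') (Q : measurableType d2) (P : probability Omega R)
  (PQ : probability Q R) (mu : {measure set S -> \bar R}) (p : nat -> Omega -> S)
  (q : nat -> S -> R) (x : nat -> nat -> Omega -> nat) (V : nat * nat -> Q -> nat).
Hypothesis ppp : poisson_point_process P mu p.
Hypothesis mx : forall n k, measurable_fun setT (x n k).
Hypothesis mq : forall v, measurable_fun setT (q v).
Hypothesis q_ge0 : forall v s, (0 <= q v s)%R.
Hypothesis q_sum : forall s, \sum_(0 <= v <oo) (q v s)%:E = 1.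
Hypothesis marks : forall (s : seq (nat * nat)) (a : nat * nat -> nat) E,
  uniq s -> atoms p E ->
  P (E `&` [set w | forall i, i \in s -> x i.1 i.2 w = a i]) =
    \int[P]_(w in E) (\prod_(i <- s) q (a i) (p i.2 w))%:E.
Hypothesis q0_lt1 : forall k w, (q 0%N (p k w) < 1)%R.
Hypothesis pi_fin : forall i, \int[mu]_s (label_weight q i s)%:E < +oo.
Hypothesis mV : forall c v, measurable [set w | V c w = v].
Hypothesis VP : forall c w, (V c w <= c.2)%N.
Hypothesis V_uniform : forall u : seq (nat * nat * nat), uniq (map fst u) ->
  (forall y, y \in u -> (y.2 <= y.1.2)%N) ->
  PQ [set w | forall y, y \in u -> V y.1 w = y.2] = (\prod_(y <- u) y.1.2.+1%:R^-1)%:E.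

Local Notation W := (Omega * Q)%type.
Local Notation PW := (P \x PQ).

Let mp k : measurable_fun setT (p k). Proof. by have [] := ppp. Qed.

Let mfst : measurable_fun setT (fst : W -> Omega). Proof. exact: measurable_fst. Qed.

Definition lifted_label (i : nat * nat) k : set W := fst @^-1` label x i k.
Definition lifted_position c (w : W) : nat := V c w.2.

Lemma measurable_lifted_label i k : measurable (lifted_label i k).
Proof. by rewrite -[X in measurable X]setTI; apply: mfst => //; exact: measurable_label. Qed.

Lemma lifted_label_inj i i' k w : lifted_label i k w -> lifted_label i' k w -> i = i'.
Proof. exact: label_inj. Qed.

Lemma measurable_lifted_position c v : measurable [set w | lifted_position c w = v].
Proof.
have msnd : measurable_fun setT (snd : W -> Q) by exact: measurable_snd.
by have := msnd measurableT _ (mV c v); rewrite setTI.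
Qed.

Lemma lifted_conditional_law E s u : atoms (fun k => p k \o fst : W -> S) E ->
  uniq (map fst s) -> uniq (map fst u) -> (forall y, y \in u -> (y.2 <= y.1.2)%N) ->
  PW (E `&` future lifted_label lifted_position s u) =
    \int[PW]_(w in E) (future_weight (fun k => p k \o fst : W -> S) (label_weight q) s u w)%:E.
Proof.
move=> /atoms_lift[E0 aE0 ->] us uu hu.
have mE0 : measurable E0.
  move: E0 aE0; apply: smallest_sub; first exact: sigma_algebra_measurable.
  by move=> _ [k _ [C mC <-]]; exact: mp.
set A := [set w | forall y, y \in s -> label x y.2 y.1 w].
set B := [set w | forall y, y \in u -> V y.1 w = y.2].
have mA : measurable A.
  by apply: measurable_forall_in => y; exact: measurable_label.
have mB : measurable B.
  exact: (@measurable_forall_in _ _ _ u (fun y => [set w | V y.1 w = y.2])).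
have -> : fst @^-1` E0 `&` future lifted_label lifted_position s u = (E0 `&` A) `*` B.
  apply/seteqP; split => -[w v] /=; first by move=> [? [? ?]].
  by move=> [[? ?] ?].
transitivity (P (E0 `&` A) * PQ B).
  by apply: product_measure1E => //; exact: measurableI.
rewrite (label_law marks)// V_uniform//.
set c := (\prod_(y <- u) _)%R.
have c0 : (0 <= c)%R by apply: prodr_ge0 => y _; rewrite invr_ge0.
have pr0 w : (0 <= \prod_(y <- s) label_weight q y.2 (p y.1 w))%R.
  by apply: prodr_ge0 => y _; exact: label_weight_ge0.
have mpr : measurable_fun setT (fun w => \prod_(y <- s) label_weight q y.2 (p y.1 w))%R.
  apply: measurable_prod => y _.
  by apply: measurableT_comp => //; exact: measurable_label_weight.
rewrite (integral_lift (P := P) mfst _ (g := fun w => (\prod_(y <- s) label_weight q y.2 (p y.1 w) * c)%:E))//.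
- under [RHS]eq_integral do rewrite EFinM.
  rewrite ge0_integralZr//; last by move=> w _; rewrite lee_fin.
  by apply: measurable_funTS; exact/measurable_EFinP.
- by move=> D mD; exact: product_probability_fst.
- by apply/measurable_EFinP; apply: measurable_funM.
- by move=> w; rewrite lee_fin mulr_ge0.
Qed.

Lemma lifted_ppp : poisson_point_process PW mu (fun k => p k \o fst : W -> S).
Proof.
apply: lift_poisson_point_process ppp => // E mE; exact: product_probability_fst.
Qed.

Definition class_list i w := final lifted_label lifted_position i w.

Local Notation class_mean := (class_mean mu (label_weight q)).

Lemma measurable_class_list i l : measurable [set w | class_list i w = l].
Proof.
apply: measurable_final => //; [exact: measurable_lifted_label|exact: measurable_lifted_position].
Qed.

Lemma class_list_law (I : seq (nat * nat)) (B : nat * nat -> seq (set S)) :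
  uniq I -> measurable_pattern B ->
  PW [set w | forall i, i \in I -> size (class_list i w) = size (B i) /\
    forall j, (j < size (B i))%N -> nth set0 (B i) j (p (nth 0%N (class_list i w) j) w.1)] =
  (arrangement_limit mu (label_weight q) I B)%:E.
Proof.
move=> uI mB.
apply: (final_law (mu := mu) (L := lifted_label) (V := lifted_position) (pi := label_weight q) lifted_ppp) => //.
- exact: measurable_lifted_label.
- exact: lifted_label_inj.
- exact: measurable_lifted_position.
- by move=> c w; exact: VP.
- exact: measurable_label_weight.
- exact: label_weight_ge0.
- by move=> I' s; exact: label_weight_sum.
- exact: lifted_conditional_law.
Qed.

Lemma class_list_sum : {ae PW, forall w, forall F : nat -> \bar R, (forall k, 0 <= F k) ->
  \sum_(0 <= k <oo) F k = \sum_(0 <= a <oo) \sum_(0 <= b <oo)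
    \sum_(0 <= j < size (class_list (a, b) w)) F (nth 0%N (class_list (a, b) w) j)}.
Proof.
have sett : {ae PW, forall w, forall i, exists K, settled lifted_label i K w}.
  apply: (settled_all_ae (mu := mu) (V := lifted_position) lifted_ppp (pi := label_weight q)) => //.
  - exact: measurable_lifted_label.
  - exact: lifted_label_inj.
  - exact: measurable_lifted_position.
  - by move=> c w; exact: VP.
  - exact: measurable_label_weight.
  - exact: label_weight_ge0.
  - by move=> I' s; exact: label_weight_sum.
  - exact: lifted_conditional_law.
have lab : {ae PW, forall w, forall k, exists i, lifted_label i k w}.
  have [N [mN PN sub]] := labelled_ae mp mx mq q_ge0 marks q0_lt1.
  exists (fst @^-1` N); split.
  - by rewrite -[X in measurable X]setTI; exact: mfst.
  - by rewrite -PN; exact: product_probability_fst.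
  - by move=> w h; apply: sub => h'; apply: h.
apply: filterS2 sett lab => w sw lw F F0.
by apply: sum_over_classes => // i i' k; exact: lifted_label_inj.
Qed.

End ClassLists.

(** * Completing the lists to infinite sequences *)

Lemma law_of_nat (R : realType) d (W : measurableType d) (P : probability W R)
    (X : W -> nat) (E : set W) (c : \bar R) : (forall n, measurable [set w | X w = n]) ->
  measurable E -> c \is a fin_num -> 0 <= c ->
  (forall n, P ([set w | X w = n] `&` E) = P [set w | X w = n] * c) ->
  forall D : set nat, P (X @^-1` D `&` E) = P (X @^-1` D) * c.
Proof.
move=> mX mE cfin c0 h D.
have split (F : set W) : X @^-1` D `&` F = \bigcup_(n in D) ([set w | X w = n] `&` F).
  by apply/seteqP; split => w /=; [move=> [Dw Fw]; exists (X w)|move=> [n Dn [/= Xn Fw]]; rewrite Xn].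
have disj (F : set W) : trivIset D (fun n => [set w | X w = n] `&` F).
  by move=> m n _ _ [w [[<- _] [<- _]]].
have -> : X @^-1` D = X @^-1` D `&` setT by rewrite setIT.
rewrite -setIA setTI !split !measure_bigcup//; last 2 first.
- by move=> n _; exact: measurableI.
- by move=> n _; exact: measurableI.
rewrite -(fineK cfin) muleC -nneseriesZl; last by move=> n _.
apply: eq_eseriesr => n _; rewrite setIT fineK//.
by rewrite -[RHS]muleC; exact: h.
Qed.

Section Fillers.
Context (R : realType) (d d' d1 : measure_display) (W : measurableType d)
  (S : measurableType d') (Q : measurableType d1) (P : probability W R) (PQ : probability Q R)
  (J : countType) (p : nat -> W -> S) (cl : J -> W -> seq nat)
  (M : J -> R) (H : J -> probability S R) (Z : J * nat -> Q -> S).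
Hypothesis mp : forall k, measurable_fun setT (p k).
Hypothesis mcl : forall i l, measurable [set w | cl i w = l].
Hypothesis M0 : forall i, (0 <= M i)%R.
Hypothesis list_law : forall (I : seq J) (B : J -> seq (set S)), uniq I -> measurable_pattern B ->
  P [set w | forall i, i \in I -> size (cl i w) = size (B i) /\
    forall j, (j < size (B i))%N -> nth set0 (B i) j (p (nth 0%N (cl i w) j) w)] =
  (\prod_(i <- I) ((\prod_(j < size (B i)) (M i * fine (H i (nth set0 (B i) j)))) /
     (size (B i))`!%:R * expR (- M i)))%:E.
Hypothesis mZ : forall c, measurable_fun setT (Z c).
Hypothesis Z_law : forall (s : seq (J * nat)) (B : J * nat -> set S), uniq s ->
  (forall c, measurable (B c)) ->
  PQ [set w | forall c, c \in s -> B c (Z c w)] = \prod_(c <- s) H c.1 (B c).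

Definition class_count i (w : W * Q) : nat := size (cl i w.1).

(** The points of the list, continued by fillers that have the law of a point of the
class. With them the values are defined for all [j], and they are independent of the
count. *)
Definition class_value (c : J * nat) (w : W * Q) : S :=
  if (c.2 < size (cl c.1 w.1))%N then p (nth 0%N (cl c.1 w.1) c.2) w.1 else Z c w.2.

Local Notation PW := (P \x PQ).

Let measurable_list i l : measurable [set w : W * Q | cl i w.1 = l].
Proof.
have mfst : measurable_fun setT (fst : W * Q -> W) by exact: measurable_fst.
by have := mfst measurableT _ (mcl i l); rewrite setTI.
Qed.

Lemma measurable_class_count i n : measurable [set w | class_count i w = n].
Proof.
apply: (@measurable_glue _ _ (seq nat) (fun w : W * Q => cl i w.1) (fun l => [set w | size l = n])) => // l.
exact: measurable_prop.
Qed.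

Lemma measurable_class_value c : measurable_fun setT (class_value c).
Proof.
move=> _ B mB; rewrite setTI.
pose A l := [set w : W * Q |
  B (if (c.2 < size l)%N then p (nth 0%N l c.2) w.1 else Z c w.2)].
apply: (@measurable_glue _ _ (seq nat) (fun w : W * Q => cl c.1 w.1) A) => // l.
rewrite /A; case: (c.2 < size l)%N.
  by have := measurableT_comp (mp (nth 0%N l c.2)) (@measurable_fst _ _ W Q) measurableT mB;
    rewrite setTI.
by have := measurableT_comp (mZ c) (@measurable_snd _ _ W Q) measurableT mB; rewrite setTI.
Qed.

Let measurable_values i N (B : nat -> set S) : (forall j, measurable (B j)) ->
  measurable [set w | forall j, (j < N)%N -> B j (class_value (i, j) w)].
Proof.
move=> mB; apply: (@measurable_forall_below _ _ _ (fun j => class_value (i, j) @^-1` B j)) => j.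
by rewrite -[X in measurable X]setTI; exact: measurable_class_value.
Qed.

Let split_product (f : nat -> R) n N :
  (\prod_(j < N) f j = (\prod_(j < n) (if (j < N)%N then f j else 1)) * \prod_(j <- iota n (N - n)) f j)%R.
Proof.
have [nN|Nn] := leqP n N.
  rewrite -(big_mkord xpredT f) (big_cat_nat (n := n))//= /index_iota; congr (_ * _)%R.
  rewrite -/(index_iota 0 n) big_mkord; apply: eq_bigr => j _.
  by rewrite (leq_trans (ltn_ord j) nN).
rewrite (_ : N - n = 0)%N ?big_nil ?mulr1; last by apply/eqP; rewrite subn_eq0 ltnW.
rewrite -big_mkcond/= -(big_mkord xpredT f) -(big_mkord (fun j => j < N)%N f).
by rewrite (big_nat_widen 0 N n)// ltnW.
Qed.

(** When the counts are fixed to [n], the first [n i] values of class [i] are the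
points of its list and the others are fillers, so that the event is a rectangle. *)
Lemma count_value_law (I : seq J) (n : J -> nat) N (B : J -> nat -> set S) : uniq I ->
  (forall i j, measurable (B i j)) ->
  PW [set w | forall i, i \in I -> class_count i w = n i /\
    forall j, (j < N)%N -> B i j (class_value (i, j) w)] =
  \prod_(i <- I) (poisson_law (M i) (n i) * \prod_(j < N) H i (B i j)).
Proof.
move=> uI mB.
pose B' i := mkseq (fun j => if (j < N)%N then B i j else setT) (n i).
have mB' : measurable_pattern B'.
  move=> i j; have [jn|jn] := ltnP j (n i); last by rewrite nth_default ?size_mkseq.
  by rewrite nth_mkseq//; case: ifP.
pose s := [seq (i, j) | i <- I, j <- iota (n i) (N - n i)].
have us : uniq s.
  apply: allpairs_uniq_dep => //; first by move=> i _; exact: iota_uniq.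
  by move=> [i j] [i' j'] _ _ /= [-> ->].
pose BZ (c : J * nat) := B c.1 c.2.
set E1 := [set w | forall i, i \in I -> size (cl i w) = size (B' i) /\
    forall j, (j < size (B' i))%N -> nth set0 (B' i) j (p (nth 0%N (cl i w) j) w)].
set E2 := [set w | forall c, c \in s -> BZ c (Z c w)].
have -> : [set w | forall i, i \in I -> class_count i w = n i /\
    forall j, (j < N)%N -> B i j (class_value (i, j) w)] = E1 `*` E2.
  apply/seteqP; split => -[w v] /=.
    move=> h; split.
      move=> i iI; have [sz hB] := h i iI; rewrite size_mkseq; split => // j jn.
      rewrite nth_mkseq//; case: ltnP => // jN; have := hB j jN.
      by rewrite /class_value /= -/(class_count i (w, v)) sz jn.
    move=> _ /allpairsPdep[i [j [iI jr ->]]]; rewrite /BZ /=.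
    move: jr; rewrite mem_iota => /andP[nj jN].
    have [sz hB] := h i iI; have := hB j.
    have sz' : size (cl i w) = n i by [].
    rewrite /class_value /= sz' (ltnNge j (n i)) nj /=; apply.
    by have := leq_ltn_trans nj jN; rewrite -[X in (X < _)%N]addn0 ltn_add2l subn_gt0 => /ltnW /subnKC {1}<-.
  move=> [h1 h2] i iI; have [sz hB] := h1 i iI; rewrite size_mkseq in sz hB; split => // j jN.
  rewrite /class_value /= sz; case: ltnP => [jn|nj].
    by have := hB j jn; rewrite nth_mkseq// jN.
  apply: (h2 (i, j)); apply/allpairsPdep; exists i, j; split => //.
  by rewrite mem_iota nj subnKC// (leq_trans nj (ltnW jN)).
have mE1 : measurable E1.
  by apply: measurable_forall_in => i; exact: measurable_listed.
have mE2 : measurable E2.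
  apply: (@measurable_forall_in _ _ _ s (fun c => Z c @^-1` BZ c)) => c.
  by rewrite -[X in measurable X]setTI; apply: mZ => //; exact: mB.
transitivity (P E1 * PQ E2); first exact: product_measure1E.
rewrite list_law// Z_law//; last by move=> c; exact: mB.
have HE i C : measurable C -> H i C = (fine (H i C))%:E by move=> mC; rewrite fineK// fin_num_measure.
rewrite (eq_bigr (fun c : J * nat => (fine (H c.1 (BZ c)))%:E)); last by move=> c _; exact: HE (mB _ _).
rewrite prodEFin -EFinM big_allpairs_dep -big_split/=.
rewrite (eq_bigr (fun i => (poisson_law (M i) (n i) * \prod_(j < N) H i (B i j)))) => [|i _].
  rewrite -prodEFin; apply: eq_bigr => i _.
  rewrite poisson_lawE// (eq_bigr (fun j : 'I_N => (fine (H i (B i j)))%:E)); last first.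
    by move=> j _; exact: HE (mB _ _).
  rewrite prodEFin -EFinM (split_product (fun j => fine (H i (B i j))) (n i)) size_mkseq.
  rewrite big_split/= prodr_const card_ord; congr EFin.
  rewrite [X in (_ * X / _ * _ * _)%R](_ : _ = (\prod_(j < n i) (if (j < N)%N then fine (H i (B i j)) else 1))%R).
    by ring.
  apply: eq_bigr => j _; rewrite nth_mkseq//; case: ifP => // _.
  by rewrite probability_setT.
by [].
Qed.

Lemma class_count_law i n : PW [set w | class_count i w = n] = poisson_law (M i) n.
Proof.
have := @count_value_law [:: i] (fun=> n) 0%N (fun _ _ => setT) isT (fun _ _ => measurableT).
rewrite big_seq1 big_ord0 mule1 => <-; congr (PW _); apply/seteqP; split => w /=.
  by move=> h i'; rewrite inE => /eqP ->; split.
by move=> h; have [] := h i (mem_head _ _).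
Qed.

(** Fixed values of the counts are replaced by sets of values one class at a time, by
countable additivity; [I2] consists of the classes whose count is still fixed. *)
Lemma count_value_events (I : seq J) (D : J -> set nat) N (B : J -> nat -> set S) : uniq I ->
  (forall i j, measurable (B i j)) ->
  PW [set w | forall i, i \in I -> D i (class_count i w) /\
    forall j, (j < N)%N -> B i j (class_value (i, j) w)] =
  \prod_(i <- I) (PW (class_count i @^-1` D i) * \prod_(j < N) H i (B i j)).
Proof.
move=> uI mB; rewrite -(cats0 I) in uI *.
have : forall i, i \in [::] -> exists n, D i = [set n] by [].
move: [::] uI => I2; elim/last_ind: I I2 D => [|I i IH] I2 D uI single.
  rewrite cat0s in uI *.
  pose n i := if pselect (i \in I2) is left h then sval (cid (single i h)) else 0%N.
  have nE i : i \in I2 -> D i = [set n i].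
    by move=> h; rewrite /n; case: pselect => // h'; case: cid.
  rewrite (eq_big_seq (fun i => poisson_law (M i) (n i) * \prod_(j < N) H i (B i j))).
    rewrite -count_value_law//; congr (PW _); apply/seteqP; split => w h i iI.
      by have [+ ?] := h i iI; rewrite nE.
    by have [+ ?] := h i iI; rewrite nE.
  by move=> i iI; rewrite nE// class_count_law.
rewrite cat_rcons in uI *.
have mD i0 (D0 : set nat) : measurable [set w | D0 (class_count i0 w)].
  rewrite (_ : mkset _ = \bigcup_(n in D0) [set w | class_count i0 w = n]).
    by apply: bigcup_measurable => n _; exact: measurable_class_count.
  by apply/seteqP; split => w /=; [exists (class_count i0 w)|move=> [n Dn /= Xn]; rewrite Xn].
pose I' := I ++ I2.
have uiI : uniq (i :: I') by rewrite -(perm_uniq (permEl (perm_catCA I [:: i] I2))).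
pose E := [set w | (forall i', i' \in I' -> D i' (class_count i' w) /\
    forall j, (j < N)%N -> B i' j (class_value (i', j) w)) /\
    forall j, (j < N)%N -> B i j (class_value (i, j) w)].
have setE (D0 : set nat) : [set w | forall i', i' \in I ++ i :: I2 ->
      (if i' == i then D0 else D i') (class_count i' w) /\
      forall j, (j < N)%N -> B i' j (class_value (i', j) w)] =
    class_count i @^-1` D0 `&` E.
  have memE i' : (i' \in I ++ i :: I2) = (i' == i) || (i' \in I').
    by rewrite !mem_cat inE orbCA.
  have nI : i \notin I' by case/andP: uiI.
  apply/seteqP; split => w /=.
    move=> h; have [|Di Bi] := h i; first by rewrite memE eqxx.
    rewrite eqxx in Di.
    split => //; split => // i' i'I; have := h i'; rewrite memE i'I orbT => /(_ isT).
    by rewrite (negbTE (_ : i' != i))//; apply: contraNneq nI => <-.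
  move=> [Di [hI Bi]] i'; rewrite memE; case: eqVneq => [->//|_ /= i'I]; exact: hI.
have mE : measurable E.
  apply: measurableI; last exact: measurable_values.
  apply: (@measurable_forall_in _ _ _ I' (fun i' => [set w | D i' (class_count i' w)] `&`
      [set w | forall j, (j < N)%N -> B i' j (class_value (i', j) w)])) => i'.
  by apply: measurableI => //; exact: measurable_values.
pose c := (\prod_(j < N) H i (B i j)) *
  \prod_(i' <- I') (PW (class_count i' @^-1` D i') * \prod_(j < N) H i' (B i' j)).
have formula (D0 : set nat) :
    \prod_(i' <- I ++ i :: I2) (PW (class_count i' @^-1` (if i' == i then D0 else D i')) *
      \prod_(j < N) H i' (B i' j)) = PW (class_count i @^-1` D0) * c.
  rewrite (perm_big _ (permEl (perm_catCA I [:: i] I2))) /= big_cons eqxx /c muleA; congr (_ * _).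
  apply: eq_big_seq => i' i'I; rewrite (negbTE (_ : i' != i))//.
  by apply: contraTneq i'I => ->; case/andP: uiI.
have -> : [set w | forall i', i' \in I ++ i :: I2 -> D i' (class_count i' w) /\
      forall j, (j < N)%N -> B i' j (class_value (i', j) w)] = class_count i @^-1` D i `&` E.
  rewrite -setE; congr mkset; apply/funext => w; apply/propext; split => h i' i'I.
    by have := h i' i'I; case: eqVneq => // ->.
  by have := h i' i'I; case: eqVneq => // ->.
transitivity (PW (class_count i @^-1` D i) * c); last first.
  by rewrite -formula; apply: eq_bigr => i' _; case: eqVneq => // ->.
have Hfin i' : (\prod_(j < N) H i' (B i' j)) \is a fin_num.
  by apply: prode_fin_num => j _; rewrite fin_num_measure.
apply: law_of_nat => //.
- exact: measurable_class_count.
- apply: fin_numM => //; apply: prode_fin_num => i' _; apply: fin_numM => //.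
  pose PW' : probability (W * Q)%type R := PW.
  exact: (fin_num_measure PW' _ (mD i' (D i'))).
- by rewrite /c mule_ge0//; apply: prode_ge0 => // i' _; rewrite mule_ge0//; exact: prode_ge0.
move=> n.
have := IH (i :: I2) (fun i' => if i' == i then [set n] else D i') uI.
rewrite setE formula; apply => i'; rewrite inE; case: eqVneq => [_ _|_ /=]; first by exists n.
exact: single.
Qed.

Lemma class_value_law c C : measurable C -> PW (class_value c @^-1` C) = H c.1 C.
Proof.
case: c => i j mC.
have := @count_value_events [:: i] (fun=> setT) j.+1 (fun _ j' => if j' == j then C else setT) isT.
move=> /(_ (fun _ j' => ltac:(by case: ifP))).
rewrite big_seq1 preimage_setT probability_setT mul1e (bigD1 ord_max)//= eqxx big1 ?mule1; last first.
  move=> j' jj'; rewrite (negbTE (_ : val j' != j)) ?probability_setT//.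
move=> <-; congr (PW _); apply/seteqP; split => w /=.
  move=> Cw i'; rewrite inE => /eqP ->; split => // j' _; by case: eqVneq => // ->.
move=> h; have [_ /(_ j (ltnSn j))] := h i (mem_head _ _); by rewrite eqxx.
Qed.

End Fillers.

(** * Conjugacy of the prior *)

Lemma innerDl (R : realType) (r : nat) (u v w : 'rV[R]_r) :
  inner (u + v)%R w = (inner u w + inner v w)%R.
Proof. by rewrite /inner -big_split; apply: eq_bigr => i _; rewrite mxE mulrDl. Qed.

Lemma innerMnl (R : realType) (r n : nat) (u w : 'rV[R]_r) :
  inner (u *+ n)%R w = (inner u w *+ n)%R.
Proof.
elim: n => [|n IH]; last by rewrite !mulrS innerDl IH.
by rewrite !mulr0n /inner big1// => i _; rewrite mxE mul0r.
Qed.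

Lemma innerC (R : realType) (r : nat) (u w : 'rV[R]_r) : inner u w = inner w u.
Proof. by rewrite /inner; apply: eq_bigr => i _; rewrite mulrC. Qed.

Section Conjugacy.
Variables (R : realType) (T : set (measurableTypeR R)) (r : nat) (kappa : nat -> R)
  (eta : R -> 'rV[R]_r) (phi : nat -> 'rV[R]_r) (A : R -> R)
  (gamma : R) (xi : 'rV[R]_r) (lambda : R)
  (nu : {measure set (measurableTypeR R) -> \bar R}).
Hypothesis T_measurable : measurable T.
Hypothesis kappa_ge0 : forall x, (0 <= kappa x)%R.
Hypothesis kappa_nondegenerate : exists x, (0 < x)%N /\ (0 < kappa x)%R.
Hypothesis eta_measurable : forall i, measurable_fun T (fun t : measurableTypeR R => eta t 0%R i).
Hypothesis A_measurable : measurable_fun T (A : measurableTypeR R -> R).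
Hypothesis h_pmf : forall t : R, T t ->
  \sum_(0 <= x <oo) (expfam_pmf kappa eta phi A x t)%:E = 1.
Hypothesis gamma_gt0 : (0 < gamma)%R.
Hypothesis nu_conj : forall S : set (measurableTypeR R), measurable S ->
  nu S = \int[@lebesgue_measure R]_(t in S `&` T) (gamma * conj_kernel eta A xi lambda t)%:E.
Hypothesis nu_infinite : nu setT = +oo.
Hypothesis nu_h_finite : \sum_(1 <= x <oo)
  \int[nu]_(t in T) (expfam_pmf kappa eta phi A x t)%:E < +oo.

Local Notation leb := (@lebesgue_measure R).
Local Notation h := (expfam_pmf kappa eta phi A).
Local Notation kernel := (conj_kernel eta A).

Lemma measurable_inner u : measurable_fun T (fun t : measurableTypeR R => inner u (eta t)).
Proof. by apply: measurable_sum => i; apply: measurable_funM => //; exact: measurable_cst. Qed.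

Lemma measurable_kernel u l : measurable_fun T (kernel u l : measurableTypeR R -> R).
Proof.
apply: measurableT_comp => //; apply: measurable_funD; first exact: measurable_inner.
by apply: measurable_funM; [exact: measurable_cst|exact: measurableT_comp].
Qed.

Lemma kernel_ge0 u l t : (0 <= kernel u l t)%R. Proof. exact: expR_ge0. Qed.

Lemma measurable_pmf x : measurable_fun T (h x : measurableTypeR R -> R).
Proof.
apply: measurable_funM; first exact: measurable_cst.
apply: measurableT_comp => //; apply: measurable_funB => //.
by under eq_fun do rewrite innerC; exact: measurable_inner.
Qed.

Lemma pmf_ge0 x t : (0 <= h x t)%R.
Proof. by rewrite mulr_ge0 ?expR_ge0. Qed.

(** Outside [T] the formula for the probability mass function need not define one; the
Dirac mass at 0 makes it a measurable probability kernel on the whole line. *)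
Definition total_pmf (x : nat) (t : measurableTypeR R) : R :=
  if t \in T then h x t else (x == 0%N)%:R.

Lemma total_pmfT x t : T t -> total_pmf x t = h x t.
Proof. by move=> Tt; rewrite /total_pmf mem_set. Qed.

Lemma measurable_total_pmf x : measurable_fun setT (total_pmf x).
Proof.
rewrite (_ : total_pmf x = fun t => (((h x : measurableTypeR R -> R) \_ T) t + (x == 0%N)%:R * \1_(~` T) t)%R).
  apply: measurable_funD.
    by apply/(measurable_restrictT _ T_measurable); exact: measurable_pmf.
  apply: measurable_funM; first exact: measurable_cst.
  by apply: measurable_indic; exact: measurableC.
apply/funext => t; rewrite /total_pmf patchE indicE in_setC; case: ifP => _ /=.
  by rewrite mulr0 addr0.
by rewrite mulr1 add0r.
Qed.

Lemma total_pmf_ge0 x t : (0 <= total_pmf x t)%R.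
Proof. by rewrite /total_pmf; case: ifP => // _; exact: pmf_ge0. Qed.

Lemma total_pmf_sum t : \sum_(0 <= x <oo) (total_pmf x t)%:E = 1.
Proof.
have [Tt|nTt] := pselect (T t).
  by rewrite -(h_pmf Tt); apply: eq_eseriesr => x _; rewrite total_pmfT.
have tE x : total_pmf x t = (x == 0%N)%:R by rewrite /total_pmf memNset.
under eq_eseriesr do rewrite tE.
by rewrite (nneseries_single (n := 0%N)) ?lee_fin// => x /negbTE ->.
Qed.

(** Some positive [x] has [kappa x > 0], hence positive probability for every [t]. *)
Lemma pmf0_lt1 t : T t -> (h 0%N t < 1)%R.
Proof.
move=> Tt; have [x [x0 kx]] := kappa_nondegenerate.
have hx : (0 < h x t)%R by rewrite mulr_gt0 ?expR_gt0.
have := @nneseries_lim_ge R (fun x => (h x t)%:E) xpredT 0%N x.+1.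
rewrite h_pmf// big_mkord (bigD1 ord0)//= (bigD1 ord_max)//=; last by rewrite -val_eqE /= -lt0n.
move=> /(_ (fun k _ _ => ltac:(by rewrite lee_fin pmf_ge0))) le1.
rewrite -lte_fin; apply: lt_le_trans le1.
rewrite addeA -EFinD; apply: (@lt_le_trans _ _ (h 0%N t + h x t)%:E).
  by rewrite lte_fin ltrDl.
by rewrite leeDl// sume_ge0// => k _; rewrite lee_fin pmf_ge0.
Qed.

Lemma nu_density : forall C : set (measurableTypeR R), measurable C ->
  nu C = \int[leb]_(t in C) (((fun t => gamma * kernel xi lambda t)%R \_ T) t)%:E.
Proof.
move=> C mC; rewrite nu_conj// integral_mkcondr; apply: eq_integral => t _.
by rewrite !patchE; case: ifP.
Qed.

Lemma nu_T : nu T = +oo.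
Proof. by rewrite -nu_infinite nu_conj// nu_conj// setTI setIid. Qed.

(** Otherwise [nu] would vanish. *)
Lemma T_not_null : leb T != 0.
Proof.
apply/eqP => T0; have := nu_T; rewrite nu_conj// setIid null_set_integral//.
apply/measurable_EFinP; apply: measurable_funM; first exact: measurable_cst.
exact: measurable_kernel.
Qed.

Lemma integral_kernel_gt0 u l : 0 < \int[leb]_(t in T) (kernel u l t)%:E.
Proof.
rewrite lt0e integral_ge0 ?andbT => [|t _]; last by rewrite lee_fin kernel_ge0.
apply/eqP => I0; move/eqP: T_not_null; apply.
have mk : measurable_fun T (EFin \o (kernel u l : measurableTypeR R -> R)).
  by apply/measurable_EFinP; exact: measurable_kernel.
have := (ae_eq_integral_abs leb T_measurable mk).1.
rewrite (eq_integral (fun t : measurableTypeR R => (kernel u l t)%:E)); last first.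
  by move=> t _; rewrite gee0_abs// lee_fin kernel_ge0.
move=> /(_ I0) [N [mN N0 sub]]; apply/eqP; rewrite eq_le measure_ge0 andbT -N0.
apply: le_measure; rewrite ?inE// => t Tt; apply: sub => /= /(_ Tt).
by case=> /eqP; rewrite gt_eqF// expR_gt0.
Qed.

(** If [kappa 0] vanished, every mark would be positive, and the sum over [x >= 1] of
the integrals of [h x] against [nu] would be the mass of [nu], which is infinite. *)
Lemma kappa0_gt0 : (0 < kappa 0%N)%R.
Proof.
rewrite lt0r kappa_ge0 andbT; apply/eqP => k0.
move: nu_h_finite; rewrite ltey => /eqP; apply.
have I0 x : 0 <= \int[nu]_(t in T) (h x t)%:E.
  by apply: integral_ge0 => t _; rewrite lee_fin pmf_ge0.
have H0 : \int[nu]_(t in T) (h 0%N t)%:E = 0.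
  by apply: integral0_eq => t _; rewrite /expfam_pmf k0 mul0r.
have := @nneseries_split R (fun x => \int[nu]_(t in T) (h x t)%:E) 0 1 (fun k _ => I0 k).
rewrite add0n big_nat1 H0 add0e => <-.
rewrite -integral_nneseries//; last 2 first.
- by move=> x; apply/measurable_EFinP; exact: measurable_pmf.
- by move=> x t _; rewrite lee_fin pmf_ge0.
rewrite (eq_integral (cst 1)) => [|t /set_mem Tt]; last exact: h_pmf.
by rewrite integral_cst// mul1e nu_T.
Qed.

(** Conjugacy: multiplying the prior by the probability of a mark [y] adds [phi y] to
the first hyperparameter and 1 to the second one. A label [(a, b)] consists of [a]
marks 0 and one mark [b + 1]. *)
Lemma label_weight_kernel a b t : T t ->
  (label_weight total_pmf (a, b) t * (gamma * kernel xi lambda t) =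
   gamma * (kappa 0%N ^+ a * kappa b.+1) *
     kernel (size_xi phi xi a.+1 b.+1) (lambda + a.+1%:R) t)%R.
Proof.
move=> Tt; rewrite /label_weight /= !total_pmfT// /expfam_pmf /conj_kernel /size_xi /=.
rewrite exprMn -expRM_natl.
transitivity (gamma * (kappa 0%N ^+ a * kappa b.+1) *
  (expR (a%:R * (inner (eta t) (phi 0%N) - A t)) * expR (inner (eta t) (phi b.+1) - A t) *
   expR (inner xi (eta t) + lambda * - A t)))%R; first by ring.
rewrite -!expRD; congr (_ * expR _)%R.
rewrite !innerDl innerMnl (innerC (phi 0%N)) (innerC (phi b.+1)) -natr1 -mulr_natl; ring.
Qed.

Lemma integral_label_weight a b C : measurable C ->
  \int[nu]_(t in C) (label_weight total_pmf (a, b) t)%:E =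
  (gamma * (kappa 0%N ^+ a * kappa b.+1))%:E *
  \int[leb]_(t in C `&` T) (kernel (size_xi phi xi a.+1 b.+1) (lambda + a.+1%:R) t)%:E.
Proof.
move=> mC.
have mlw : measurable_fun setT (label_weight total_pmf (a, b)).
  exact: measurable_label_weight measurable_total_pmf _.
have lw0 t : (0 <= label_weight total_pmf (a, b) t)%R.
  exact: label_weight_ge0 total_pmf_ge0 _ _.
rewrite integral_mkcond.
transitivity (\int[nu]_t (label_weight total_pmf (a, b) t * \1_C t)%:E).
  by apply: eq_integral => t _; rewrite patchE indicE; case: ifP; rewrite ?mulr1 ?mulr0.
rewrite (integral_density _ _ nu_density)//; last 4 first.
- apply/(measurable_restrictT _ T_measurable).
  by apply: measurable_funM; [exact: measurable_cst|exact: measurable_kernel].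
- by move=> t; rewrite patchE; case: ifP => // _; rewrite mulr_ge0 ?kernel_ge0// ltW.
- by apply: measurable_funM => //; exact: measurable_indic.
- by move=> t; rewrite mulr_ge0.
rewrite -ge0_integralZl//; last 4 first.
- exact: measurableI.
- apply/measurable_EFinP; apply: measurable_funS (measurable_kernel _ _) => //.
- by move=> t _; rewrite lee_fin kernel_ge0.
- by rewrite lee_fin !mulr_ge0// ?exprn_ge0// ltW.
rewrite [RHS]integral_mkcond; apply: eq_integral => t _.
rewrite [RHS]patchE in_setI indicE patchE; case: (boolP (t \in C)) => [tC|_]; last first.
  by rewrite mulr0 mul0r.
rewrite mulr1; case: ifPn => [/set_mem Tt|_]; last by rewrite mulr0.
by rewrite label_weight_kernel.
Qed.

(** A label ends with a mark [b + 1], whose integral is a term of the finite sum. *)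
Lemma label_weight_finite a b : \int[nu]_t (label_weight total_pmf (a, b) t)%:E < +oo.
Proof.
have -> : \int[nu]_t (label_weight total_pmf (a, b) t)%:E =
    \int[nu]_(t in T) (label_weight total_pmf (a, b) t)%:E.
  by rewrite !integral_label_weight// setTI setIid.
apply: (@le_lt_trans _ _ (\int[nu]_(t in T) (h b.+1 t)%:E)).
  apply: ge0_le_integral => //.
  - by move=> t _; rewrite lee_fin; exact: label_weight_ge0 total_pmf_ge0 _ _.
  - apply/measurable_EFinP; apply: measurable_funTS.
    exact: measurable_label_weight measurable_total_pmf _.
  - by apply/measurable_EFinP; exact: measurable_pmf.
  move=> t Tt; rewrite lee_fin /label_weight/= !total_pmfT// ler_piMl ?pmf_ge0//.
  by rewrite exprn_ile1 ?pmf_ge0// ltW// pmf0_lt1.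
apply: le_lt_trans nu_h_finite.
have I0 x : 0 <= \int[nu]_(t in T) (h x t)%:E.
  by apply: integral_ge0 => t _; rewrite lee_fin pmf_ge0.
rewrite (nneseries_split 1 b.+1)// addSn add0n.
rewrite big_nat_recr//= -addeA addeC -addeA leeDl// adde_ge0//; first exact: nneseries_ge0.
by apply: sume_ge0.
Qed.

Local Notation B := (size_B T eta phi A xi lambda).
Local Notation M := (size_M T kappa eta phi A gamma xi lambda).
Local Notation f := (size_density T eta phi A xi lambda).

Lemma size_ME a b : M a.+1 b.+1 = \int[nu]_t (label_weight total_pmf (a, b) t)%:E.
Proof.
rewrite integral_label_weight// setTI /size_M /size_B /logpart; congr (_ * _).
by apply/eqP; rewrite lneK_eq; apply: integral_ge0 => t _; rewrite lee_fin kernel_ge0.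
Qed.

Lemma size_M_ge0 a b : 0 <= M a.+1 b.+1.
Proof.
rewrite size_ME; apply: integral_ge0 => t _; rewrite lee_fin.
exact: label_weight_ge0 total_pmf_ge0 _ _.
Qed.

Lemma size_M_fin a b : M a.+1 b.+1 \is a fin_num.
Proof. by rewrite ge0_fin_numE ?size_M_ge0// size_ME label_weight_finite. Qed.

(** The kernel is integrable because it is, up to a positive constant, the density of
a label; its integral is positive because [T] is not null. *)
Lemma size_B_fin a b : (0 < kappa b.+1)%R -> B a.+1 b.+1 \is a fin_num.
Proof.
move=> kb; have := label_weight_finite a b; rewrite integral_label_weight// setTI.
set c := (gamma * _)%R; have c0 : (0 < c)%R by rewrite !mulr_gt0// exprn_gt0// kappa0_gt0.
rewrite /size_B /logpart; set I := \int[leb]_(_ in _) _ => cI.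
have I0 : 0 < I by exact: integral_kernel_gt0.
by case: I cI I0 => [x| |]//; rewrite ?gt0_muley ?lte_fin// => _ x0; rewrite lne_EFin.
Qed.

(** The normalised kernel. When the kernel has infinite mass, [mnormalize] yields the
Dirac mass; this only occurs for [kappa b.+1 = 0], and then both sides of the second
identity vanish. *)
Lemma exists_size_law a b : exists D : probability (measurableTypeR R) R,
  (B a.+1 b.+1 \is a fin_num -> forall C, measurable C ->
     D C = \int[leb]_(t in C `&` T) (f a.+1 b.+1 t)%:E) /\
  (forall C, measurable C -> \int[nu]_(t in C) (label_weight total_pmf (a, b) t)%:E =
     M a.+1 b.+1 * D C).
Proof.
pose k : measurableTypeR R -> R := kernel (size_xi phi xi a.+1 b.+1) (lambda + a.+1%:R).
have k0 t : (0 <= (k \_ T) t)%R by rewrite patchE; case: ifP => // _; exact: kernel_ge0.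
have mk : measurable_fun setT (k \_ T).
  by apply/(measurable_restrictT _ T_measurable); exact: measurable_kernel.
have [D0 D0E] := @density_measure _ _ _ leb (k \_ T) mk k0.
have {}D0E C : measurable C -> D0 C = \int[leb]_(t in C `&` T) (k t)%:E.
  move=> mC; rewrite D0E// integral_mkcondr; apply: eq_integral => t _.
  by rewrite !patchE; case: ifP.
have I0 : D0 setT != 0.
  by rewrite D0E// setTI gt_eqF// integral_kernel_gt0.
have BE : B a.+1 b.+1 = lne (D0 setT) by rewrite D0E// setTI.
have D0pos : 0 < D0 setT by rewrite D0E// setTI integral_kernel_gt0.
pose D : probability (measurableTypeR R) R := mnormalize D0 (dirac point).
have DE C : D0 setT < +oo -> D C = D0 C * (fine (D0 setT))^-1%:E by exact: mnormalizeE.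
exists D; split.
  rewrite BE => Bfin C mC.
  have D0fin : D0 setT < +oo by move: Bfin; case: (D0 setT) => [y| |]//; rewrite ltry.
  rewrite DE// D0E//.
  have ex : expR (- fine (lne (D0 setT))) = ((fine (D0 setT))^-1)%R.
    rewrite -[D0 setT]fineK ?ge0_fin_numE ?(ltW D0pos)// lne_EFin ?expRN ?lnK//.
      by rewrite posrE fine_gt0// D0fin D0pos.
    by rewrite fine_gt0// D0fin D0pos.
  rewrite -ge0_integralZr//; last 3 first.
  - exact: measurableI.
  - by apply/measurable_EFinP; apply: measurable_funS (measurable_kernel _ _).
  - by move=> t _; rewrite lee_fin kernel_ge0.
  apply: eq_integral => t _; rewrite -EFinM; congr EFin.
  by rewrite /size_density BE expRD ex.
move=> C mC; rewrite integral_label_weight// -D0E//.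
have [kb|kb] := eqVneq (kappa b.+1) 0%R.
  by rewrite /size_M kb !mulr0 !mul0e.
have kb0 : (0 < kappa b.+1)%R by rewrite lt0r kb kappa_ge0.
have D0fin : D0 setT < +oo by have := size_B_fin a kb0; rewrite BE; case: (D0 setT) => [y| |]//; rewrite ltry.
rewrite DE// /size_M -/(size_B T eta phi A xi lambda a.+1 b.+1) BE.
have -> : expeR (lne (D0 setT)) = D0 setT by apply/eqP; rewrite lneK_eq ltW.
have Dfin : D0 setT \is a fin_num by rewrite ge0_fin_numE// ltW.
have DV : D0 setT * (fine (D0 setT))^-1%:E = 1.
  by rewrite -[X in X * _](fineK Dfin) -EFinM divff// gt_eqF// fine_gt0// D0fin D0pos.
by rewrite -muleA; congr (_ * _); rewrite muleCA DV mule1.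
Qed.

End Conjugacy.

(** * Independence of counts and values *)

Section GridIndependence.
Context (R : realType) (d : measure_display) (W : measurableType d) (P : probability W R).

(** Adding events [setT] enlarges a finite family to one of a convenient shape. *)
Lemma mutually_independent_cofinal (I : choiceType) (D : set I) (E : I -> set (set W)) :
  (forall i, E i setT) ->
  (forall s, uniq s -> (forall i, i \in s -> D i) -> exists g, [/\ uniq g, {subset s <= g} &
    forall F, (forall i, i \in g -> E i (F i)) ->
      P (\big[setI/setT]_(i <- g) F i) = \prod_(i <- g) P (F i)]) ->
  mutually_independent P D E.
Proof.
move=> ET cof s F us hF.
have [|g [ug sg indep]] := cof s us; first by move=> i /hF[].
pose F' i := if i \in s then F i else setT.
have {indep} := indep F'.
have F'E i : i \notin s -> F' i = setT by rewrite /F' => /negbTE ->.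
have FE i : i \in s -> F' i = F i by rewrite /F' => ->.
have -> : \big[setI/setT]_(i <- g) F' i = \big[setI/setT]_(i <- s) F i.
  rewrite (big_uniq_subset _ _ us ug sg) /= [X in _ `&` X]big1 ?setIT => [|i /F'E//].
  exact: eq_big_seq.
have -> : \prod_(i <- g) P (F' i) = \prod_(i <- s) P (F i).
  rewrite (big_uniq_subset _ _ us ug sg) /= [X in _ * X]big1 ?mule1 => [|i /F'E ->].
    by apply: eq_big_seq => i /FE ->.
  exact: probability_setT.
by apply=> i _; rewrite /F'; case: ifP => // /hF[].
Qed.

Context (d1 d2 : measure_display) (S1 : measurableType d1) (S2 : measurableType d2)
  (J : choiceType) (Dr : set J) (X : J -> W -> nat)
  (Y1 : J -> nat -> W -> S1) (Y2 : J -> nat -> W -> S2).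
Hypothesis joint : forall (I : seq J) (D : J -> set nat) (N : nat)
  (B1 : J -> nat -> set S1) (B2 : J -> nat -> set S2), uniq I -> (forall i, i \in I -> Dr i) ->
  (forall i j, measurable (B1 i j)) -> (forall i j, measurable (B2 i j)) ->
  P [set w | forall i, i \in I -> D i (X i w) /\
    forall j, (j < N)%N -> B1 i j (Y1 i j w) /\ B2 i j (Y2 i j w)] =
  \prod_(i <- I) (P (X i @^-1` D i) *
    \prod_(j < N) (P (Y1 i j @^-1` B1 i j) * P (Y2 i j @^-1` B2 i j))).

Definition grid_class (i : J * nat + J + J * nat) : J :=
  match i with inl (inl (k, _)) => k | inl (inr k) => k | inr (k, _) => k end.

Definition grid_position (i : J * nat + J + J * nat) : nat :=
  match i with inl (inl (_, j)) => j | inl (inr _) => 0%N | inr (_, j) => j end.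

Definition grid_events (i : J * nat + J + J * nat) : set (set W) :=
  match i with
  | inl (inl (k, j)) => events_of (Y1 k j)
  | inl (inr k) => events_of (X k)
  | inr (k, j) => events_of (Y2 k j)
  end.

(** Finite families of indices of this shape are cofinal, and their joint law is the
one given by the hypothesis. *)
Definition grid (I : seq J) N : seq (J * nat + J + J * nat) :=
  [seq inl (inr k) | k <- I] ++
  ([seq inl (inl (k, j)) | k <- I, j <- iota 0 N] ++ [seq inr (k, j) | k <- I, j <- iota 0 N]).

Lemma mem_grid I N i : (i \in grid I N) =
  (grid_class i \in I) && (if i is inl (inr _) then true else (grid_position i < N)%N).
Proof.
rewrite !mem_cat; case: i => [[[k j]|k]|[k j]] /=.
- rewrite (_ : _ \in [seq inl (inr _) | _ <- _] = false); last by apply/negbTE/mapP => -[].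
  rewrite orbC (_ : _ \in [seq inr _ | _ <- _, _ <- _] = false); last first.
    by apply/negbTE/allpairsP => -[? []].
  rewrite orbF orbF; apply/allpairsP/andP => [[[k' j'] /= [kI jN [-> ->]]]|[kI jN]].
    by rewrite mem_iota in jN.
  by exists (k, j); rewrite mem_iota.
- rewrite andbT; apply/orP/idP => [[/mapP[k' kI [->]]//|/orP[]/allpairsP[? []]//]|kI].
  by left; apply: map_f.
- rewrite (_ : _ \in [seq inl (inr _) | _ <- _] = false); last by apply/negbTE/mapP => -[].
  rewrite (_ : _ \in [seq inl (inl _) | _ <- _, _ <- _] = false); last first.
    by apply/negbTE/allpairsP => -[? []].
  apply/allpairsP/andP => [[[k' j'] /= [kI jN [-> ->]]]|[kI jN]].
    by rewrite mem_iota in jN.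
  by exists (k, j); rewrite mem_iota.
Qed.

Lemma grid_uniq I N : uniq I -> uniq (grid I N).
Proof.
move=> uI; rewrite !cat_uniq map_inj_uniq ?uI/=; last by move=> ? ? [].
rewrite !allpairs_uniq ?iota_uniq//=; last 2 first.
- by move=> [? ?] [? ?] _ _ /= [-> ->].
- by move=> [? ?] [? ?] _ _ /= [-> ->].
rewrite andbT; apply/andP; split; apply/hasPn => i.
  rewrite mem_cat => /orP[] /allpairsP[? [_ _ ->]]; by apply/negP => /mapP[].
by move=> /allpairsP[? [_ _ ->]]; apply/negP => /allpairsP[? []].
Qed.

Lemma big_grid (T : Type) (idx : T) (op : Monoid.com_law idx) I N F :
  \big[op/idx]_(i <- grid I N) F i = \big[op/idx]_(k <- I) op (F (inl (inr k)))
    (\big[op/idx]_(j < N) op (F (inl (inl (k, nat_of_ord j)))) (F (inr (k, nat_of_ord j)))).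
Proof.
rewrite !big_cat big_map !big_allpairs_dep /= -!big_split; apply: eq_bigr => k _ /=.
congr (op _ _); rewrite -big_split -{1}(subn0 N) -/(index_iota 0 N).
by rewrite (big_mkord xpredT (fun j => op (F (inl (inl (k, j)))) (F (inr (k, j))))).
Qed.

Lemma grid_independence :
  mutually_independent P [set i | Dr (grid_class i)] grid_events.
Proof.
apply: mutually_independent_cofinal.
  by case=> [[[k j]|k]|[k j]]; exists setT; rewrite //= setTI.
move=> s us sD.
pose I := undup (map grid_class s); pose N := (\max_(i <- s) grid_position i).+1.
have uI : uniq I by exact: undup_uniq.
have ID k : k \in I -> Dr k by rewrite mem_undup => /mapP[i /sD ? ->].
exists (grid I N); split.
- exact: grid_uniq.
- move=> i si; rewrite mem_grid mem_undup map_f//=.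
  have : (grid_position i < N)%N.
    by rewrite ltnS; exact: (@leq_bigmax_seq _ s xpredT grid_position).
  by case: i {si} => [[]|].
move=> F hF.
have ch (T : Type) (M : set (set T)) (Z : W -> T) (A : set W) : exists B,
    (M setT -> M B) /\ (preimage_set_system setT Z M A -> A = Z @^-1` B).
  have [h|nh] := pselect (exists2 B, M B & A = Z @^-1` B).
    by case: h => B MB AB; exists B.
  exists setT; split => // -[B MB AB]; exfalso; apply: nh; exists B => //.
  by rewrite -AB setTI.
have [D hD] : exists D : J -> set nat, forall k, k \in I -> F (inl (inr k)) = X k @^-1` D k.
  exists (fun k => sval (cid (ch nat measurable (X k) (F (inl (inr k)))))) => k kI.
  case: cid => B /= [_]; apply; apply: (hF (inl (inr k))).
  by rewrite mem_grid /= kI.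
have [B1 mB1 hB1] : exists2 B1 : J -> nat -> set S1, (forall k j, measurable (B1 k j)) &
    forall k j, k \in I -> (j < N)%N -> F (inl (inl (k, j))) = Y1 k j @^-1` B1 k j.
  exists (fun k j => sval (cid (ch S1 measurable (Y1 k j) (F (inl (inl (k, j))))))) => k j.
    by case: cid => B /= [+ _]; apply.
  move=> kI jN; case: cid => B /= [_]; apply; apply: (hF (inl (inl (k, j)))).
  by rewrite mem_grid /= kI.
have [B2 mB2 hB2] : exists2 B2 : J -> nat -> set S2, (forall k j, measurable (B2 k j)) &
    forall k j, k \in I -> (j < N)%N -> F (inr (k, j)) = Y2 k j @^-1` B2 k j.
  exists (fun k j => sval (cid (ch S2 measurable (Y2 k j) (F (inr (k, j)))))) => k j.
    by case: cid => B /= [+ _]; apply.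
  move=> kI jN; case: cid => B /= [_]; apply; apply: (hF (inr (k, j))).
  by rewrite mem_grid /= kI.
rewrite [RHS]big_grid.
rewrite (eq_big_seq (fun k => P (X k @^-1` D k) *
    \prod_(j < N) (P (Y1 k j @^-1` B1 k j) * P (Y2 k j @^-1` B2 k j)))); last first.
  move=> k kI; rewrite hD//; congr (_ * _); apply: eq_bigr => j _.
  by rewrite hB1// hB2.
rewrite -joint// -bigcap_seq; congr (P _); apply/seteqP; split => w /= h.
  move=> k kI; split.
    by have := h (inl (inr k)); rewrite /= mem_grid/= kI hD//; apply.
  move=> j jN; split.
    by have := h (inl (inl (k, j))); rewrite /= mem_grid/= kI hB1//; apply.
  by have := h (inr (k, j)); rewrite /= mem_grid/= kI hB2//; apply.
move=> [[[k j]|k]|[k j]]; rewrite /= mem_grid /= => /andP[kI jN].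
- by rewrite hB1//; have [_ /(_ j jN)[]] := h k kI.
- by rewrite hD//; have [] := h k kI.
- by rewrite hB2//; have [_ /(_ j jN)[]] := h k kI.
Qed.

End GridIndependence.

(** * Classes of a marked Poisson point process *)

(** The points are sorted by label into classes; [count i] is the size of class [i]
and [value i] its points in random order, continued by independent fillers. In the
hypotheses [M i] is the mean number of points of class [i] and [H i] the law of one of
them. The probability space is extended by the positions [V] and by the fillers [Z]. *)
Theorem marked_representation (R : realType) (d d' : measure_display) (Omega : measurableType d)
    (S : measurableType d') (P : probability Omega R) (mu : {measure set S -> \bar R})
    (p : nat -> Omega -> S) (q : nat -> S -> R) (x : nat -> nat -> Omega -> nat)
    (M : nat * nat -> R) (H : nat * nat -> probability S R) :
  poisson_point_process P mu p ->
  (forall n k, measurable_fun setT (x n k)) ->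
  (forall v, measurable_fun setT (q v)) -> (forall v s, (0 <= q v s)%R) ->
  (forall s, \sum_(0 <= v <oo) (q v s)%:E = 1) ->
  (forall (s : seq (nat * nat)) (a : nat * nat -> nat) E, uniq s -> atoms p E ->
    P (E `&` [set w | forall i, i \in s -> x i.1 i.2 w = a i]) =
      \int[P]_(w in E) (\prod_(i <- s) q (a i) (p i.2 w))%:E) ->
  (forall k w, (q 0%N (p k w) < 1)%R) -> (forall i, (0 <= M i)%R) ->
  (forall i C, measurable C -> \int[mu]_(s in C) (label_weight q i s)%:E = (M i)%:E * H i C) ->
  exists (d0 : measure_display) (W : measurableType d0) (PW : probability W R)
    (proj : W -> Omega) (count : nat * nat -> W -> nat) (value : nat * nat -> nat -> W -> S),
    [/\ measurable_fun setT proj /\ (forall E, measurable E -> PW (proj @^-1` E) = P E),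
      (forall i n, measurable [set w | count i w = n] /\
        PW [set w | count i w = n] = poisson_law (M i) n),
      (forall i j, measurable_fun setT (value i j) /\
        forall C, measurable C -> PW (value i j @^-1` C) = H i C),
      (forall (I : seq (nat * nat)) (D : nat * nat -> set nat) N (B : nat * nat -> nat -> set S),
        uniq I -> (forall i j, measurable (B i j)) ->
        PW [set w | forall i, i \in I -> D i (count i w) /\
          forall j, (j < N)%N -> B i j (value i j w)] =
        \prod_(i <- I) (PW (count i @^-1` D i) * \prod_(j < N) H i (B i j))) &
      (forall i j w, (j < count i w)%N -> exists k, value i j w = p k (proj w)) /\
      {ae PW, forall w, forall F : S -> \bar R, (forall k, 0 <= F (p k (proj w))) ->
        \sum_(0 <= k <oo) F (p k (proj w)) = \sum_(0 <= a <oo) \sum_(0 <= b <oo)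
          \sum_(0 <= j < count (a, b) w) F (value (a, b) j w)}].
Proof.
move=> ppp mx mq q0 qsum marks qlt1 M0 HE.
have lw0 i s : (0 <= label_weight q i s)%R by exact: label_weight_ge0.
have lwM i : \int[mu]_s (label_weight q i s)%:E = (M i)%:E.
  by rewrite HE// probability_setT mule1.
have pi_fin i : \int[mu]_s (label_weight q i s)%:E < +oo by rewrite lwM ltry.
have mean_law i C : measurable C ->
    class_mean mu (label_weight q) i C = (M i * fine (H i C))%R.
  move=> mC; rewrite /class_mean /mean -[RHS]/(fine (M i * fine (H i C))%:E) EFinM.
  rewrite fineK ?fin_num_measure// -HE// [in RHS]integral_mkcond; congr fine.
  by apply: eq_integral => s _; rewrite patchE indicE; case: ifP => _; rewrite ?mulr1 ?mulr0.
have [d2 [Q2 [PQ2 [V [mV VP Vunif]]]]] := uniform_positions R.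
have [d1 [Q1 [PQ1 [Z [mZ Zlaw]]]]] := countable_product (fun c : nat * nat * nat => H c.1).
pose W1 := (Omega * Q2)%type; pose P1 : probability W1 R := P \x PQ2.
pose cl := class_list x V : nat * nat -> W1 -> seq nat.
pose p1 k : W1 -> S := p k \o fst.
have mp k : measurable_fun setT (p k) by have [] := ppp.
have mfst : measurable_fun setT (fst : W1 -> Omega) by exact: measurable_fst.
have mp1 k : measurable_fun setT (p1 k) by exact: measurableT_comp.
have mcl i l : measurable [set w | cl i w = l] by exact: measurable_class_list.
have list_law (I : seq (nat * nat)) (B : nat * nat -> seq (set S)) :
    uniq I -> measurable_pattern B ->
    P1 [set w | forall i, i \in I -> size (cl i w) = size (B i) /\
      forall j, (j < size (B i))%N -> nth set0 (B i) j (p1 (nth 0%N (cl i w) j) w)] =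
    (\prod_(i <- I) ((\prod_(j < size (B i)) (M i * fine (H i (nth set0 (B i) j)))) /
      (size (B i))`!%:R * expR (- M i)))%:E.
  move=> uI mB; transitivity (arrangement_limit mu (label_weight q) I B)%:E.
    exact: (class_list_law ppp mx mq q0 qsum marks pi_fin mV VP Vunif uI mB).
  congr EFin; apply: eq_bigr => i _; congr (_ / _ * expR (- _))%R.
    by apply: eq_bigr => j _; rewrite mean_law.
  by rewrite mean_law// probability_setT mulr1.
pose W := (W1 * Q1)%type; pose PW : probability W R := P1 \x PQ1.
exists _, W, PW, (fun w => w.1.1), (class_count cl), (fun i j => class_value p1 cl Z (i, j)).
split.
- split; first exact: (measurableT_comp mfst (@measurable_fst _ _ W1 Q1)).
  move=> E mE; rewrite (_ : _ @^-1` E = fst @^-1` (fst @^-1` E : set W1))//.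
  transitivity (P1 (fst @^-1` E)); last exact: product_probability_fst.
  apply: product_probability_fst.
  by rewrite -[X in measurable X]setTI; exact: mfst.
- move=> i n; split; first exact: measurable_class_count.
  exact: (class_count_law mp1 mcl M0 list_law mZ Zlaw).
- move=> i j; split; first exact: measurable_class_value.
  by move=> C mC; exact: (class_value_law mp1 mcl M0 list_law mZ Zlaw (i, j) mC).
- move=> I D N B uI mB.
  exact: (count_value_events mp1 mcl M0 list_law mZ Zlaw D N uI mB).
split.
  move=> i j w jn; exists (nth 0%N (cl i w.1) j).
  have jn' : (j < size (cl i w.1))%N by exact: jn.
  by rewrite /class_value /= jn'.
(* Only values with an index below the count enter the sums, and these are points. *)
have [N0 [mN0 PN0 sub]] := class_list_sum ppp mx mq q0 qsum marks qlt1 pi_fin mV VP Vunif.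
exists (fst @^-1` N0); split.
- have := @measurable_fst _ _ W1 Q1 measurableT _ mN0; by rewrite setTI.
- by transitivity (P1 N0); first exact: product_probability_fst.
move=> w h; apply: sub => /= h'; apply: h => F F0.
rewrite (h' (fun k => F (p k w.1.1)))//.
apply: eq_eseriesr => a _; apply: eq_eseriesr => b _.
apply: eq_big_nat => j /andP[_ jn].
by rewrite /class_value /= jn.
Qed.
(** * The size-biased representation *)

Theorem corollary5p2 (R : realType)
  (dPsi : measure_display) (Psi : measurableType dPsi)
  (singletons_measurable : forall y : Psi, measurable [set y])
  (T : set (measurableTypeR R)) (T_measurable : measurable T)
  (T_nonneg : forall t : R, T t -> (0 <= t)%R)
  (r : nat) (kappa : nat -> R) (eta : R -> 'rV[R]_r) (phi : nat -> 'rV[R]_r)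
  (A : R -> R)
  (kappa_ge0 : forall x, (0 <= kappa x)%R)
  (kappa_nondegenerate : exists x, (0 < x)%N /\ (0 < kappa x)%R)
  (eta_measurable : forall i, measurable_fun T (fun t : measurableTypeR R => eta t 0%R i))
  (A_measurable : measurable_fun T (A : measurableTypeR R -> R))
  (h_pmf : forall t : R, T t ->
     \sum_(0 <= x <oo) (expfam_pmf kappa eta phi A x t)%:E = 1)
  (gamma : R) (xi : 'rV[R]_r) (lambda : R) (gamma_gt0 : (0 < gamma)%R)
  (nu : {measure set (measurableTypeR R) -> \bar R})
  (nu_conj : forall S : set (measurableTypeR R), measurable S ->
     nu S = \int[@lebesgue_measure R]_(t in S `&` T)
              (gamma * conj_kernel eta A xi lambda t)%:E)
  (nu_infinite : nu setT = +oo)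
  (nu_h_finite : \sum_(1 <= x <oo)
     \int[nu]_(t in T) (expfam_pmf kappa eta phi A x t)%:E < +oo)
  (G : probability Psi R) (G_diffuse : forall y : Psi, G [set y] = 0)
  (d : measure_display) (Omega : measurableType d) (P : probability Omega R)
  (Theta : Omega -> {measure set Psi -> \bar R})
  (theta : nat -> Omega -> measurableTypeR R) (psi : nat -> Omega -> Psi)
  (Theta_crm : ordinary_crm P T nu G Theta theta psi)
  (X : nat -> Omega -> {measure set Psi -> \bar R})
  (xw : nat -> nat -> Omega -> nat)
  (X_crm : fixed_atoms_crm_given P (expfam_pmf kappa eta phi A) theta psi X xw) :
  let B := size_B T eta phi A xi lambda in
  let M := size_M T kappa eta phi A gamma xi lambda in
  let f := size_density T eta phi A xi lambda in
  exists (d' : measure_display) (Omega' : measurableType d')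
    (P' : probability Omega' R) (proj : Omega' -> Omega),
    measurable_fun setT proj /\
    (forall E, measurable E -> P' (proj @^-1` E) = P E) /\
  exists (psi' : nat -> nat -> nat -> Omega' -> Psi)
    (rho : nat -> nat -> Omega' -> nat)
    (theta' : nat -> nat -> nat -> Omega' -> measurableTypeR R),
    {ae P', forall w, forall C, measurable C ->
       Theta (proj w) C =
         \sum_(1 <= m <oo) \sum_(1 <= x <oo) \sum_(0 <= j < rho m x w)
           (theta' m x j w : R)%:E * \d_(psi' m x j w) C} /\
    (forall m x j, (0 < m)%N -> (0 < x)%N ->
       measurable_fun setT (psi' m x j) /\
       forall C, measurable C -> P' (psi' m x j @^-1` C) = G C) /\
    (forall m x, (0 < m)%N -> (0 < x)%N ->
       measurable_fun setT (rho m x) /\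
       M m x \is a fin_num /\
       forall n : nat, P' (rho m x @^-1` [set n]) = poisson_law (fine (M m x)) n) /\
    (forall m x j, (0 < m)%N -> (0 < x)%N ->
       measurable_fun setT (theta' m x j) /\
       ((0 < kappa x)%R -> B m x \is a fin_num) /\
       (B m x \is a fin_num -> forall S, measurable S ->
          P' (theta' m x j @^-1` S) =
            \int[@lebesgue_measure R]_(t in S `&` T) (f m x t)%:E)) /\
    mutually_independent P' size_range (size_events psi' rho theta').
Proof.
move=> B M f.
have [theta_T ppp ThetaE] := Theta_crm.
have [mxw xw_law _] := X_crm.
pose S := (measurableTypeR R * Psi)%type.
pose p k w : S := (theta k w, psi k w).
pose tp := total_pmf T kappa eta phi A.
pose q v (s : S) := tp v s.1.
have mtp v : measurable_fun setT (tp v) by exact: measurable_total_pmf.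
have tp0 v t : (0 <= tp v t)%R by exact: total_pmf_ge0.
have mfst : measurable_fun setT (fst : S -> measurableTypeR R) by exact: measurable_fst.
have mq v : measurable_fun setT (q v) by exact: (measurableT_comp (mtp v) mfst).
have q0 v s : (0 <= q v s)%R by exact: tp0.
have qsum s : \sum_(0 <= v <oo) (q v s)%:E = 1 by exact: total_pmf_sum.
have marks (s : seq (nat * nat)) (a : nat * nat -> nat) E : uniq s -> atoms p E ->
    P (E `&` [set w | forall i, i \in s -> xw i.1 i.2 w = a i]) =
      \int[P]_(w in E) (\prod_(i <- s) q (a i) (p i.2 w))%:E.
  move=> us aE; rewrite xw_law//; apply: eq_integral => w _; congr EFin.
  by apply: eq_bigr => i _; rewrite /q /tp total_pmfT//; exact: theta_T.
have qlt1 k w : (q 0%N (p k w) < 1)%R.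
  rewrite /q /tp total_pmfT//; last exact: theta_T.
  apply: (pmf0_lt1 kappa_ge0 kappa_nondegenerate h_pmf); exact: theta_T.
have M_ge0 a b : 0 <= M a.+1 b.+1.
  exact: (size_M_ge0 phi T_measurable kappa_ge0 eta_measurable A_measurable gamma_gt0 nu_conj).
have M_fin a b : M a.+1 b.+1 \is a fin_num.
  exact: (size_M_fin T_measurable kappa_ge0 kappa_nondegenerate eta_measurable A_measurable
    h_pmf gamma_gt0 nu_conj nu_h_finite).
have ex i := exists_size_law T_measurable kappa_ge0 kappa_nondegenerate eta_measurable
  A_measurable h_pmf gamma_gt0 nu_conj nu_infinite nu_h_finite i.1 i.2.
pose D (i : nat * nat) := sval (cid (ex i)).
have D_density a b : B a.+1 b.+1 \is a fin_num -> forall C, measurable C ->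
    D (a, b) C = \int[@lebesgue_measure R]_(t in C `&` T) (f a.+1 b.+1 t)%:E.
  by rewrite /D; case: cid => D' /= [].
have D_law a b C : measurable C ->
    \int[nu]_(t in C) (label_weight tp (a, b) t)%:E = M a.+1 b.+1 * D (a, b) C.
  by move=> mC; rewrite /D; case: cid => D' /= [_ ->].
pose m i := fine (M i.1.+1 i.2.+1).
have m0 i : (0 <= m i)%R by rewrite fine_ge0.
have mE i : (m i)%:E = M i.1.+1 i.2.+1 by rewrite fineK.
have rect i C1 C2 : measurable C1 -> measurable C2 ->
    \int[nu \x G]_(s in C1 `*` C2) (label_weight q i s)%:E = (m i)%:E * (D i C1 * G C2).
  move=> mC1 mC2; case: i => a b.
  rewrite muleA mE -D_law// -integral_rectangle//; last 2 first.
  - exact: measurable_label_weight.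
  - by move=> t; exact: label_weight_ge0.
  rewrite integral_mkcond; apply: eq_integral => s _.
  by rewrite patchE indicE; case: ifP => _; rewrite ?mulr1 ?mulr0.
(* The law of a point (theta, psi) of class [i]. If the class has mean 0, the law cannot
   be obtained by normalising, and the product law is chosen so that the marginal of
   theta still has the required density. *)
have [H HE Hrect] : exists2 H : nat * nat -> probability S R,
    (forall i C, measurable C -> \int[nu \x G]_(s in C) (label_weight q i s)%:E = (m i)%:E * H i C) &
    (forall i C1 C2, measurable C1 -> measurable C2 -> H i (C1 `*` C2) = D i C1 * G C2).
  suff h i : exists H : probability S R,
      (forall C, measurable C -> \int[nu \x G]_(s in C) (label_weight q i s)%:E = (m i)%:E * H C) /\
      (forall C1 C2, measurable C1 -> measurable C2 -> H (C1 `*` C2) = D i C1 * G C2).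
    by exists (fun i => sval (cid (h i))) => i; case: cid => H' /= [].
  have mlw : measurable_fun setT (label_weight q i) by exact: measurable_label_weight.
  have lw0 s : (0 <= label_weight q i s)%R by exact: label_weight_ge0.
  have [rho rhoE] := density_measure (nu \x G) mlw lw0.
  have rhoT : rho setT = (m i)%:E.
    by rewrite rhoE// -setXTT rect// !probability_setT !mule1.
  have [mi|mi] := eqVneq (m i) 0%R.
    exists (D i \x G); split => [C mC|C1 C2 mC1 mC2]; last exact: product_measure1E.
    rewrite mi mul0e -rhoE//; apply/eqP; rewrite eq_le measure_ge0 andbT.
    by rewrite -[leRHS]/(0%:E) -mi -rhoT le_measure// inE.
  pose H : probability S R := mnormalize rho (D i \x G).
  have HE C : H C = rho C * (m i)^-1%:E.
    rewrite -[m i]/(fine (m i)%:E) -rhoT; apply: mnormalizeE; rewrite rhoT ?eqe ?ltry//.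
  exists H; split => [C mC|C1 C2 mC1 mC2].
    by rewrite HE -rhoE// muleCA -EFinM divff// mule1.
  by rewrite HE rhoE ?rect//; [rewrite muleAC -EFinM divff// mul1e|exact: measurableX].
have [d' [W [PW [proj [count [value [[mproj Pproj] countP valueP joint [points repr]]]]]]]] :=
  marked_representation ppp mxw mq q0 qsum marks qlt1 m0 HE.
exists d', W, PW, proj; split => //; split => //.
have mcount i : measurable_fun setT (count i).
  move=> _ Y _; rewrite setTI (_ : _ @^-1` _ = \bigcup_(n in Y) [set w | count i w = n]).
    by apply: bigcup_measurable => n _; case: (countP i n).
  by apply/seteqP; split => w /=; [exists (count i w)|move=> [n Yn /= Xn]; rewrite Xn].
have mvalue i j : measurable_fun setT (value i j) by case: (valueP i j).
have msnd : measurable_fun setT (snd : S -> Psi) by exact: measurable_snd.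
(* Classes are indexed from 1 here and from 0 above. *)
pose cls m' x' := (m'.-1, x'.-1).
exists (fun m' x' j w => (value (cls m' x') j w).2), (fun m' x' => count (cls m' x')),
  (fun m' x' j w => (value (cls m' x') j w).1).
have psi_law i j C : measurable C -> PW ((fun w => (value i j w).2) @^-1` C) = G C.
  move=> mC; rewrite (_ : _ @^-1` _ = value i j @^-1` (setT `*` C)).
    have [_ ->] := valueP i j; last exact: measurableX.
    by rewrite Hrect// probability_setT mul1e.
  by apply/seteqP; split => w /=; tauto.
have theta_law i j C : measurable C -> PW ((fun w => (value i j w).1) @^-1` C) = D i C.
  move=> mC; rewrite (_ : _ @^-1` _ = value i j @^-1` (C `*` setT)).
    have [_ ->] := valueP i j; last exact: measurableX.
    by rewrite Hrect// probability_setT mule1.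
  by apply/seteqP; split => w /=; tauto.
split.
  apply: filterS repr => w h C mC; rewrite ThetaE// /atomic_measure.
  pose F (s : S) : \bar R := (s.1 : R)%:E * \d_s.2 C.
  have F0 k : 0 <= F (p k (proj w)).
    by rewrite /F mule_ge0 ?lee_fin ?diracE// T_nonneg//; exact: theta_T.
  pose G' m' x' := \sum_(0 <= j < count (cls m' x') w) F (value (cls m' x') j w).
  have G0 m' x' : 0 <= G' m' x'.
    rewrite /G' big_nat; apply: sume_ge0 => j /andP[_ jn].
    by have [k ->] := points _ _ _ jn; exact: F0.
  transitivity (\sum_(1 <= m' <oo) \sum_(1 <= x' <oo) G' m' x'); last by [].
  rewrite -(nneseries_addn 1); last by move=> m'; apply: nneseries_ge0.
  transitivity (\sum_(0 <= k <oo) F (p k (proj w))); first by [].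
  rewrite h//; apply: eq_eseriesr => a _; rewrite -(nneseries_addn 1); last by move=> b'.
  by apply: eq_eseriesr => b _; rewrite !addn1.
split.
  move=> m' x' j _ _; split; first exact: (measurableT_comp msnd (mvalue _ _)).
  by move=> C mC; exact: psi_law.
split.
  move=> [|a] [|b]// _ _; split => //; split => // n.
  by have [_] := countP (a, b) n.
split.
  move=> [|a] [|b]// j _ _; split; first exact: (measurableT_comp mfst (mvalue _ _)).
  split.
    exact: (size_B_fin T_measurable kappa_ge0 kappa_nondegenerate eta_measurable A_measurable
      h_pmf gamma_gt0 nu_conj nu_infinite nu_h_finite).
  move=> Bfin C mC; rewrite -D_density//; exact: theta_law.
pose Dr : set (nat * nat) := [set k | (0 < k.1)%N /\ (0 < k.2)%N].
pose cl2 (k : nat * nat) := cls k.1 k.2.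
have indep := @grid_independence R _ W PW _ _ Psi (measurableTypeR R) (nat * nat)%type Dr
  (fun k => count (cl2 k)) (fun k j w => (value (cl2 k) j w).2) (fun k j w => (value (cl2 k) j w).1).
move=> s F us hF; apply: indep => //; last first.
  by move=> i /hF; case: i => [[[[m' x'] j]|[m' x']]|[[m' x'] j]].
move=> I E N B1 B2 uI ID mB1 mB2.
have uI' : uniq (map cl2 I).
  rewrite map_inj_in_uniq// => -[[|a] [|b]] [[|a'] [|b']] /ID[//= _ _] /ID[//= _ _].
  by rewrite /cl2 /cls /= => -[-> ->].
(* The inverse of [cl2] on classes with positive indices. *)
pose up (k : nat * nat) := (k.1.+1, k.2.+1).
have upK k : k \in I -> up (cl2 k) = k by move=> /ID; case: k => [[|a] [|b]] [].
have := joint (map cl2 I) (fun k => E (up k)) N (fun k j => B2 (up k) j `*` B1 (up k) j) uI'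
  (fun i j => measurableX (mB2 _ _) (mB1 _ _)).
rewrite big_map => h.
transitivity (\prod_(i <- I) (PW (count (cl2 i) @^-1` E (up (cl2 i))) *
    \prod_(j < N) H (cl2 i) (B2 (up (cl2 i)) j `*` B1 (up (cl2 i)) j))).
  rewrite -h; congr (PW _); apply/seteqP; split => w /= hw.
    move=> _ /mapP[k kI ->]; have [Ek Bk] := hw k kI; rewrite upK//; split => // j jN.
    by have [? ?] := Bk j jN.
  move=> k kI; have [|Ek Bk] := hw (cl2 k); first exact: map_f.
  rewrite upK// in Ek Bk; split => // j jN; by have [? ?] := Bk j jN.
apply: eq_big_seq => k kI; rewrite upK//; congr (_ * _); apply: eq_bigr => j _.
by rewrite Hrect// psi_law// theta_law// muleC.
Qed.
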